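(* Suppose that $V_{\min}\le V\le V_{\max}$ on $\Omega$ for some constants $V_{\min},V_{\max}\in(0,+\infty)$. Then for every $\mathbf u^0\in\mathcal M$ there exists a constant $C_\tau>0$, depending only on $\|\mathbf u^0\|_X$ and $\Omega, V_{\min},V_{\max},\alpha,\beta,k$, such that the following holds. If $\{\mathbf u^n\}_{n=0}^\infty$ is the sequence generated from $\mathbf u^0$ by $$\mathbf u^{n+1}=R_h\big(\mathbf u^n-\tau_n\nabla_X^{\mathcal R}\mathbf E_h(\mathbf u^n)\big),\qquad n\ge 0,$$ with step sizes satisfying $0<\tau_{\min}\le\tau_n\le\tau_{\max}\le\min\{1,C_\tau\}$ for all $n\ge0$, then every limit point of $\{\mathbf u^n\}_{n=0}^\infty$ in $\mathbb R^N$ is a critical point, i.e. a point $\mathbf u\in\mathcal M$ with $\nabla_X^{\mathcal R}\mathbf E_h(\mathbf u)=0$.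
   Context: Let $d\in\{1,2,3\}$, $L>0$, $\Omega=[-L,L]^d$, $\beta>0$, $\alpha>0$, and let $V:\Omega\to\mathbb R$ satisfy $V\ge c>0$ for some constant $c$. Discretization. Fix $k\ge1$ and one of the following two finite element methods with quadrature. (a) $Q^k$ spectral element method: $\Omega_h$ is a uniform mesh of cubes of $\Omega$, $V_0^h$ is the space of continuous functions on $\Omega$ vanishing on $\partial\Omega$ whose restriction to each cell is a polynomial of degree at most $k$ in each variable, and the quadrature on each cell is the tensor product $(k+1)$-point Gauss–Lobatto rule. (b) $P^k$ method: $\Omega_h$ is a conforming simplicial mesh of $\Omega$, $V_0^h$ is the space of continuous functions vanishing on $\partial\Omega$ whose restriction to each simplex is a polynomial of total degree at most $k$, and the quadrature on each simplex is the affine image of a fixed $(k+1)$-th order accurate reference rule with positive weights, using $\frac{(k+d)!}{k!\,d!}$ points which are Lagrange interpolation nodes for $P^k$. The mesh size is denoted $h$. $\langle f,g\rangle$ denotes $\int_\Omega fg$ (or $\int_\Omega f\cdot g$ for vector fields) with the integral on each element replaced by the quadrature. Let $\mathbf x_1,\dots,\mathbf x_N$ be the quadrature points in the interior of $\Omega$, $w_i>0$ the total quadrature weight at $\mathbf x_i$, and $\phi_i\in V_0^h$ the Lagrange basis function with $\phi_i(\mathbf x_j)=\delta_{ij}$. A vector $\mathbf u=(u_1,\dots,u_N)^\top\in\mathbb R^N$ is identified with $u_h=\Pi\mathbf u=\sum_i u_i\phi_i\in V_0^h$. Put $\mathbb M=\mathrm{diag}(w_1,\dots,w_N)$, $\mathbb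 S_{ij}=\langle\nabla\phi_i,\nabla\phi_j\rangle$, $\mathbb V=\mathrm{diag}(V(\mathbf x_1),\dots,V(\mathbf x_N))$, $\Delta_h=-\mathbb M^{-1}\mathbb S$, $\langle\mathbf u,\mathbf v\rangle_h=\mathbf u^\top\mathbb M\mathbf v$; $\mathbb M$ and $\mathbb S$ are symmetric positive definite. Powers of vectors are entrywise. Discrete energy: $\mathbf E_h(\mathbf u)=\frac12\langle-\Delta_h\mathbf u,\mathbf u\rangle_h+\frac12\langle\mathbb V\mathbf u,\mathbf u\rangle_h+\frac\beta4\langle\mathbf u^2,\mathbf u^2\rangle_h$. Let $A_{\mathbf u}=-\Delta_h+\mathbb V+\beta\,\mathrm{diag}(\mathbf u^2)$. Constraint manifold: $\mathcal M=\{\mathbf u\in\mathbb R^N:\langle\mathbf u,\mathbf u\rangle_h=1\}$. Modified $H^1$ metric: $\langle\mathbf u,\mathbf v\rangle_X=\mathbf u^\top(\mathbb S+\alpha\mathbb M)\mathbf v$, $\|\mathbf u\|_X=\sqrt{\langle\mathbf u,\mathbf u\rangle_X}$, $\mathbb G_X=(-\Delta_h+\alpha\mathbb I)^{-1}$, $\nabla_X\mathbf E_h(\mathbf u)=\mathbb G_XA_{\mathbf u}\mathbf u$, and $$\nabla_X^{\mathcal R}\mathbf E_h(\mathbf u)=\nabla_X\mathbf E_h(\mathbf u)-\frac{\langle\mathbf u,\nabla_X\mathbf E_h(\mathbf u)\rangle_h}{\langle\mathbb G_X\mathbf u,\mathbf u\rangle_h}\mathbb G_X\mathbf u.$$ Retraction: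 $R_h(\mathbf u)=\mathbf u/\sqrt{\langle\mathbf u,\mathbf u\rangle_h}$. Constants are independent of the mesh size, the element type and reference quadrature rule being fixed. *)

(* Defs.v *)
From HB Require Import structures.
From mathcomp Require Import all_boot all_order all_algebra.
From mathcomp Require Import all_classical all_reals all_analysis.
(* The notations of mpoly clash with those of mathcomp-analysis. *)
From mathcomp Require mpoly.
Import -(notations) mpoly.

Set Implicit Arguments.
Unset Strict Implicit.
Unset Printing Implicit Defensive.

Import Order.TTheory GRing.Theory Num.Theory.
Import numFieldNormedType.Exports.

Local Open Scope classical_set_scope.
Local Open Scope ring_scope.

Definition Omega (R : realType) (d : nat) (L : R) : set 'rV[R]_d :=
  [set x | forall i, - L <= x ord0 i <= L].
Arguments Omega {R} d L.

Definition peval (R : realType) (d : nat) (p : mpoly d R)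
    (x : 'rV[R]_d) : R :=
  meval (fun i => x ord0 i) p.

Definition Qk (R : realType) (d k : nat) : set (mpoly d R) :=
  [set p : mpoly d R | forall m : multinom d,
     m \in msupp p -> forall i : 'I_d, (m i <= k)%N].

Definition Pk (R : realType) (d k : nat) : set (mpoly d R) :=
  [set p : mpoly d R | forall m : multinom d,
     m \in msupp p -> (mdeg m <= k)%N].

(* The (k+1)-point Gauss-Lobatto rule on [-1, 1]: both end points are nodes and
   the rule has the maximal degree of exactness 2k - 1.  These conditions
   determine nodes and weights uniquely. *)
Definition gauss_lobatto (R : realType) (k : nat) (x w : 'I_k.+1 -> R) : Prop :=
  [/\ forall i j : 'I_k.+1, (i < j)%N -> x i < x j,
      x ord0 = - 1, x ord_max = 1 &
      forall p : {poly R}, (size p <= 2 * k)%N ->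
        \sum_(i < k.+1) w i * p.[x i]
        = \int[lebesgue_measure]_(t in `[(-1 : R), 1]) p.[t]].

Definition unit_simplex (R : realType) (d : nat) : set 'rV[R]_d :=
  [set x | (forall i, 0 <= x ord0 i) /\ \sum_i x ord0 i <= 1].

(* Integral over {x >= 0, x_1 + ... + x_d <= s}, as an iterated integral. *)
Fixpoint simplex_integral (R : realType) (d : nat) (s : R) :
    ('rV[R]_d -> R) -> R :=
  match d return ('rV[R]_d -> R) -> R with
  | 0%N => fun f => f 0
  | d'.+1 => fun f =>
      \int[lebesgue_measure]_(t in `[0, s])
        simplex_integral (s - t)
          (fun y : 'rV[R]_d' => f (row_mx (const_mx t : 'rV[R]_1) y))
  end.

(* A rule of order k+1 (i.e. exact on polynomials of total degree <= k) with
   positive weights, whose binomial(k+d, d) nodes are unisolvent for P^k. *)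
Definition simplex_rule (R : realType) (d k : nat)
    (x : 'I_'C(k + d, d) -> 'rV[R]_d) (w : 'I_'C(k + d, d) -> R) : Prop :=
  [/\ forall q, unit_simplex (x q),
      forall q, 0 < w q,
      forall y : 'I_'C(k + d, d) -> R,
        exists! p : mpoly d R, Pk k p /\ forall q, peval p (x q) = y q &
      forall p : mpoly d R, Pk k p ->
        \sum_q w q * peval p (x q) = simplex_integral 1 (peval p)].

Inductive method (R : realType) (d k : nat) : Type :=
| QkSEM (x w : 'I_k.+1 -> R) of gauss_lobatto x w
| PkFEM (x : 'I_'C(k + d, d) -> 'rV[R]_d) (w : 'I_'C(k + d, d) -> R)
    of simplex_rule x w.

Record ref_element (R : realType) (d : nat) := RefElement {
  ref_domain : set 'rV[R]_d;
  local_space : set (mpoly d R);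
  quad_index : finType;
  ref_node : quad_index -> 'rV[R]_d;
  ref_weight : quad_index -> R }.

Definition cube_element (R : realType) (d k : nat) (x w : 'I_k.+1 -> R) :
    ref_element R d :=
  @RefElement R d
    [set y | forall i, -1 <= y ord0 i <= 1]
    (Qk k)
    {ffun 'I_d -> 'I_k.+1}
    (fun q => \row_i x (q i))
    (fun q => \prod_i w (q i)).

Definition simplex_element (R : realType) (d k : nat)
    (x : 'I_'C(k + d, d) -> 'rV[R]_d) (w : 'I_'C(k + d, d) -> R) :
    ref_element R d :=
  @RefElement R d (@unit_simplex R d) (Pk k) 'I_'C(k + d, d) x w.

Definition element (R : realType) (d k : nat) (m : method R d k) :
    ref_element R d :=
  match m with
  | QkSEM x w _ => cube_element d x w
  | PkFEM x w _ => simplex_element x w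
  end.

(* The cells are the images of the reference domain under the affine maps
   y |-> mesh_origin c + y *m mesh_linear c. *)
Record mesh (R : realType) (d : nat) := Mesh {
  mesh_cell : finType;
  mesh_origin : mesh_cell -> 'rV[R]_d;
  mesh_linear : mesh_cell -> 'M[R]_d }.

(* n^d cubes of side 2L/n; the cell with multi-index j is centred at the point
   with coordinates -L + (2 j_i + 1) L/n. *)
Definition cube_mesh (R : realType) (d : nat) (L : R) (n : nat) : mesh R d :=
  @Mesh R d {ffun 'I_d -> 'I_n}
    (fun j => \row_i (- L + (2 * j i + 1)%:R * (L / n%:R)))
    (fun _ => (L / n%:R)%:M).

Definition simplex_mesh (R : realType) (d n : nat)
    (v : 'I_n -> 'I_d.+1 -> 'rV[R]_d) : mesh R d :=
  @Mesh R d 'I_n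
    (fun c => v c ord0)
    (fun c => \matrix_i (v c (lift ord0 i) - v c ord0)).

(* Convex hull of the vertices v i, i \in I. *)
Definition face (R : realType) (d : nat) (v : 'I_d.+1 -> 'rV[R]_d)
    (I : set 'I_d.+1) : set 'rV[R]_d :=
  [set x | exists l : 'I_d.+1 -> R,
     [/\ forall i, 0 <= l i, \sum_i l i = 1, forall i, ~ I i -> l i = 0 &
         x = \sum_i l i *: v i]].

(* Distinct simplices have distinct vertex sets, and two simplices meet exactly
   in the (possibly empty) face spanned by their common vertices. *)
Definition conforming_triangulation (R : realType) (d n : nat) (L : R)
    (v : 'I_n -> 'I_d.+1 -> 'rV[R]_d) : Prop :=
  [/\ forall c, mesh_linear (m := simplex_mesh v) c \in unitmx,
      \bigcup_c face (v c) setT = Omega d L,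
      forall c c', range (v c) = range (v c') -> c = c' &
      forall c c', face (v c) setT `&` face (v c') setT
                   = face (v c) [set i | range (v c') (v c i)]].

Definition is_mesh (R : realType) (d k : nat) (L : R) (m : method R d k)
    (T : mesh R d) : Prop :=
  match m with
  | QkSEM _ _ _ => exists n : nat, (0 < n)%N /\ T = cube_mesh d L n
  | PkFEM _ _ _ =>
      exists (n : nat) (v : 'I_n -> 'I_d.+1 -> 'rV[R]_d),
        conforming_triangulation L v /\ T = simplex_mesh v
  end.

Definition cell_map (R : realType) (d : nat) (T : mesh R d) (c : mesh_cell T)
    (y : 'rV[R]_d) : 'rV[R]_d :=
  mesh_origin c + y *m mesh_linear c.

Definition cell_set (R : realType) (d : nat) (K : ref_element R d)
    (T : mesh R d) (c : mesh_cell T) : set 'rV[R]_d :=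
  cell_map c @` ref_domain K.

Definition node (R : realType) (d : nat) (K : ref_element R d) (T : mesh R d)
    (c : mesh_cell T) (q : quad_index K) : 'rV[R]_d :=
  cell_map c (ref_node q).

Definition weight (R : realType) (d : nat) (K : ref_element R d) (T : mesh R d)
    (c : mesh_cell T) (q : quad_index K) : R :=
  `|\det (mesh_linear c)| * ref_weight q.

(* The values of u outside Omega are irrelevant. *)
Definition V0h (R : realType) (d : nat) (L : R) (K : ref_element R d)
    (T : mesh R d) : set ('rV[R]_d -> R) :=
  [set u | [/\ {within Omega d L, continuous u},
               forall x, (Omega d L `\` (Omega d L)°) x -> u x = 0 &
               forall c : mesh_cell T, exists2 p, local_space K p &
                 forall x, cell_set K c x -> u x = peval p x]].

Definition nodal_basis (R : realType) (d : nat) (L : R) (K : ref_element R d)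
    (T : mesh R d) (N : nat) (x : 'I_N -> 'rV[R]_d)
    (phi : 'I_N -> 'rV[R]_d -> R) : Prop :=
  [/\ injective x,
      range x = [set y | (Omega d L)° y /\
                   exists (c : mesh_cell T) (q : quad_index K), y = node c q],
      forall i, V0h L K T (phi i) &
      forall i j, phi i (x j) = (i == j)%:R].

(* The polynomial equal to u on the cell c; it is unique for nondegenerate
   cells, which have nonempty interior. *)
Definition local_poly (R : realType) (d : nat) (K : ref_element R d)
    (T : mesh R d) (u : 'rV[R]_d -> R) (c : mesh_cell T) : mpoly d R :=
  xget (0 : mpoly d R)
    [set p | local_space K p /\ forall x, cell_set K c x -> u x = peval p x].

(* <grad u, grad v>; at a node on a cell boundary the gradient is taken from
   within the cell whose quadrature is being evaluated. *)
Definition grad_inner (R : realType) (d : nat) (K : ref_element R d)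
    (T : mesh R d) (u v : 'rV[R]_d -> R) : R :=
  \sum_(c : mesh_cell T) \sum_(q : quad_index K) weight c q *
    \sum_(i < d) peval (mderiv i (local_poly K u c)) (node c q)
               * peval (mderiv i (local_poly K v c)) (node c q).

Definition mass_mx (R : realType) (d : nat) (K : ref_element R d)
    (T : mesh R d) (N : nat) (x : 'I_N -> 'rV[R]_d) : 'M[R]_N :=
  diag_mx (\row_i \sum_(c : mesh_cell T)
                    \sum_(q : quad_index K | node c q == x i) weight c q).

Definition stiffness_mx (R : realType) (d : nat) (K : ref_element R d)
    (T : mesh R d) (N : nat) (phi : 'I_N -> 'rV[R]_d -> R) : 'M[R]_N :=
  \matrix_(i, j) grad_inner K T (phi i) (phi j).

Definition potential_mx (R : realType) (d N : nat) (x : 'I_N -> 'rV[R]_d)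
    (V : 'rV[R]_d -> R) : 'M[R]_N :=
  diag_mx (\row_i V (x i)).

(* From here on M, S and P stand for the mass, stiffness and potential
   matrices. *)

Definition inner_h (R : realType) (N : nat) (M : 'M[R]_N) (u v : 'cV[R]_N) : R :=
  (u^T *m M *m v) ord0 ord0.

Definition manifold (R : realType) (N : nat) (M : 'M[R]_N) : set 'cV[R]_N :=
  [set u | inner_h M u u = 1].

Definition laplace_h (R : realType) (N : nat) (M S : 'M[R]_N) : 'M[R]_N :=
  - (invmx M *m S).

Definition norm_X (R : realType) (N : nat) (M S : 'M[R]_N) (alpha : R)
    (u : 'cV[R]_N) : R :=
  Num.sqrt ((u^T *m (S + alpha *: M) *m u) ord0 ord0).

Definition A_mx (R : realType) (N : nat) (M S P : 'M[R]_N) (beta : R)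
    (u : 'cV[R]_N) : 'M[R]_N :=
  - laplace_h M S + P + beta *: diag_mx (\row_i u i ord0 ^+ 2).

Definition G_X (R : realType) (N : nat) (M S : 'M[R]_N) (alpha : R) : 'M[R]_N :=
  invmx (- laplace_h M S + alpha%:M).

(* The discrete energy is E_h(u) = 1/2 <-Delta_h u, u>_h + 1/2 <P u, u>_h
   + beta/4 <u^2, u^2>_h; its gradient for the X inner product is: *)
Definition grad_X (R : realType) (N : nat) (M S P : 'M[R]_N) (alpha beta : R)
    (u : 'cV[R]_N) : 'cV[R]_N :=
  G_X M S alpha *m (A_mx M S P beta u *m u).

Definition riem_grad_X (R : realType) (N : nat) (M S P : 'M[R]_N)
    (alpha beta : R) (u : 'cV[R]_N) : 'cV[R]_N :=
  grad_X M S P alpha beta u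
  - (inner_h M u (grad_X M S P alpha beta u)
     / inner_h M (G_X M S alpha *m u) u) *: (G_X M S alpha *m u).

Definition retraction (R : realType) (N : nat) (M : 'M[R]_N) (u : 'cV[R]_N) :
    'cV[R]_N :=
  (Num.sqrt (inner_h M u u))^-1 *: u.

(* Main.v *)
Require Import Defs.
From HB Require Import structures.
From mathcomp Require Import all_boot all_order all_algebra.
From mathcomp Require Import all_classical all_reals all_analysis.
From mathcomp Require Import perm polyrcf ring lra zify.
From mathcomp Require mpoly.
Import -(notations) mpoly.

(** The step size constant rests on the discrete Sobolev inequality
    [sum_i w_i u_i^4 <= C (u^T S u)^2], with [C] independent of the mesh, of
    its shape regularity in particular.  It is obtained without integrating
    over Omega: the finite element function is sampled on a uniform grid of
    [-L, L]^d, so fine (depending on the mesh and on [u]) that grid sums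
    replace integrals.  On the grid, Ladyzhenskaya's argument bounds the sum
    of [u^4] by the square of the sum of squared difference quotients.  Grid
    sums are compared with quadrature sums cell by cell: the number of grid
    points in an affine image of a cube is, up to constants depending on [d]
    only, the determinant times the grid density; a function of the local
    space is at least half its largest nodal value on a small homothetic copy
    of the cell; and a difference quotient is bounded by the nodal values of
    the gradient on the cells met by the segment.

    Given the Sobolev inequality, the energy bounds the X-norm of the
    Riemannian gradient [g] along the iteration; expanding the energy at
    [u - tau g] gives a decrease by [tau/2 |g|_X^2], and the retraction only
    decreases the energy since [<u - tau g, u - tau g>_h >= 1].  Hence
    [g(u^n) -> 0], and [g] is continuous at the limit points. *)

Set Implicit Arguments.
Unset Strict Implicit.
Unset Printing Implicit Defensive.

Import Order.TTheory GRing.Theory Num.Theory.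
Import numFieldNormedType.Exports.

Local Open Scope classical_set_scope.
Local Open Scope ring_scope.

(** * Ladyzhenskaya inequalities for grid functions *)

(** The triangulations of [is_mesh] may be arbitrarily thin, so a scaling argument through the
    reference element, which costs the condition number of the cell map, is excluded. Two facts
    replace it. Partial derivatives in physical coordinates stay in the local space and are
    recovered from their own nodal values, so no Jacobian enters. And a parallelepiped, however
    thin, holds a number of grid points comparable with its determinant as soon as the grid is fine
    enough. How fine it must be may depend on the mesh and on the function, because the grid
    disappears from the final inequality; this is why the counting results are stated near infinity
    while their constants come first. In the descent argument, likewise, the mesh is felt only
    through the Sobolev constant, the upper bound of the potential and the initial norm, which is
    what makes the step size bound independent of it. *)

Lemma cauchy_schwarz_sum (R : realFieldType) (I : finType) (a b : I -> R) :
  (\sum_i a i * b i) ^+ 2 <= (\sum_i a i ^+ 2) * (\sum_i b i ^+ 2).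
Proof.
(* Lagrange's identity: this double sum is twice the gap in the inequality. *)
have h : 0 <= \sum_i \sum_j (a i * b j - a j * b i) ^+ 2.
  by do 2 apply: sumr_ge0 => ? _; exact: sqr_ge0.
have e : \sum_i \sum_j (a i * b j - a j * b i) ^+ 2 =
   2 * ((\sum_i a i ^+ 2) * (\sum_i b i ^+ 2)) - 2 * (\sum_i a i * b i) ^+ 2.
  rewrite (eq_bigr (fun i => \sum_j a i ^+ 2 * b j ^+ 2
     + \sum_j b i ^+ 2 * a j ^+ 2 - 2 * (\sum_j (a i * b i) * (a j * b j)))); last first.
    move=> i _; rewrite mulr_sumr -big_split -sumrB /=.
    by apply: eq_bigr => j _; ring.
  rewrite sumrB big_split /= -mulr_sumr -!big_distrlr /= expr2; ring.
move: h; rewrite e; lra.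
Qed.

Section GridSums.
Variable R : realFieldType.

Lemma le_total_variation (f : nat -> R) m j : f 0%N = 0 -> (j <= m)%N ->
  `|f j| <= \sum_(i < m) `|f i.+1 - f i|.
Proof.
move=> f0 jm.
have -> : f j = \sum_(0 <= i < j) (f i.+1 - f i).
  by rewrite telescope_sumr // f0 subr0.
apply: le_trans (ler_norm_sum _ _ _) _.
rewrite -[X in _ <= X](big_mkord xpredT (fun i => `|f i.+1 - f i|)).
rewrite (big_cat_nat (n := j) (p := m)) //= lerDl.
exact: sumr_ge0.
Qed.

(** A discrete Poincare inequality: Cauchy-Schwarz with weights 1 on the telescoping sum. *)
Lemma sqr_le_diff (f : nat -> R) m j : f 0%N = 0 -> (j <= m)%N ->
  f j ^+ 2 <= m%:R * \sum_(i < m) (f i.+1 - f i) ^+ 2.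
Proof.
move=> f0 jm; rewrite -(real_normK (num_real (f j))).
have h := le_total_variation f0 jm.
apply: (@le_trans _ _ ((\sum_(i < m) `|f i.+1 - f i|) ^+ 2)).
  by rewrite ler_pXn2r // ?nnegrE // sumr_ge0.
have := cauchy_schwarz_sum (fun=> 1) (fun i : 'I_m => `|f i.+1 - f i|).
under eq_bigr do rewrite mul1r.
rewrite [X in _ <= X * _ -> _](eq_bigr (fun=> 1)) => [|i _]; last by rewrite expr1n.
rewrite sumr_const card_ord.
by under [X in _ <= _ * X -> _]eq_bigr do rewrite real_normK ?num_real //.
Qed.

Lemma sum_shift (f : nat -> R) m : f 0%N = 0 -> f m = 0 ->
  \sum_(i < m) f i.+1 = \sum_(i < m) f i.
Proof.
move=> f0 fm.
rewrite -(big_mkord xpredT (fun i => f i.+1)) -(big_mkord xpredT f).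
apply/eqP; rewrite -subr_eq0 -sumrB telescope_sumr // f0 fm subr0 //.
Qed.

(* The total variation of f^2 along all lines of a family, by Cauchy-Schwarz
   applied to |f'^2 - f^2| = |f' - f| |f' + f|. *)
Lemma sqr_variation (I : finType) (f : I -> nat -> R) m :
  (forall x, f x 0%N = 0) -> (forall x, f x m = 0) ->
  (\sum_x \sum_(i < m) `|f x i.+1 ^+ 2 - f x i ^+ 2|) ^+ 2 <=
  4 * (\sum_x \sum_(i < m) (f x i.+1 - f x i) ^+ 2)
    * (\sum_x \sum_(i < m) f x i ^+ 2).
Proof.
move=> f0 fm; rewrite !pair_big /=.
have := cauchy_schwarz_sum
  (fun p : I * 'I_m => `|f p.1 p.2.+1 - f p.1 p.2|)
  (fun p : I * 'I_m => `|f p.1 p.2.+1 + f p.1 p.2|).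
rewrite /=; under eq_bigr do rewrite -normrM -subr_sqr.
under [X in _ <= X * _ -> _]eq_bigr do rewrite real_normK ?num_real //.
under [X in _ <= _ * X -> _]eq_bigr do rewrite real_normK ?num_real //.
move/le_trans; apply.
rewrite [4 * _]mulrC -mulrA ler_wpM2l //; first by apply: sumr_ge0 => *; exact: sqr_ge0.
apply: (@le_trans _ _ (\sum_(p : I * 'I_m)
   (2 * (f p.1 p.2.+1) ^+ 2 + 2 * (f p.1 p.2) ^+ 2))).
  apply: ler_sum => p _.
  have := sqr_ge0 (f p.1 p.2.+1 - f p.1 p.2); nra.
rewrite big_split /= -!mulr_sumr.
(* Both ends of each line carry the value 0, so the shifted sum of squares is the same sum. *)
suff -> : \sum_(p : I * 'I_m) f p.1 p.2.+1 ^+ 2 =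
  \sum_(p : I * 'I_m) f p.1 p.2 ^+ 2 by lra.
rewrite -(pair_big xpredT xpredT (fun x (i : 'I_m) => f x i.+1 ^+ 2)) /=.
rewrite -(pair_big xpredT xpredT (fun x (i : 'I_m) => f x i ^+ 2)) /=.
apply: eq_bigr => x _.
by apply: (@sum_shift (fun i => f x i ^+ 2)); rewrite ?f0 ?fm expr0n.
Qed.

Lemma ladyzhenskaya1 (u : nat -> R) m : u 0%N = 0 ->
  \sum_(i < m) u i ^+ 4 <= m%:R ^+ 3 * (\sum_(i < m) (u i.+1 - u i) ^+ 2) ^+ 2.
Proof.
move=> u0; set D := \sum_(i < m) (u i.+1 - u i) ^+ 2.
have D0 : 0 <= D by apply: sumr_ge0 => *; exact: sqr_ge0.
apply: (@le_trans _ _ (\sum_(i < m) (m%:R * D) ^+ 2)).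
  apply: ler_sum => i _.
  have -> : u i ^+ 4 = (u i ^+ 2) ^+ 2 by ring.
  by rewrite ler_pXn2r ?nnegrE ?sqr_ge0 ?mulr_ge0 // sqr_le_diff // ltnW.
rewrite sumr_const card_ord -[_ *+ m]mulr_natl.
rewrite le_eqVlt; apply/orP; left; apply/eqP; ring.
Qed.

(** In u^4 = u^2 * u^2 one factor is bounded by the variation of u^2 in the first index, which
    depends on j only, the other by that in the second index, which depends on i only; the double
    sum then factors. The factor 4 of [sqr_variation] is halved by a b <= (a^2 + b^2) / 2. *)
Lemma ladyzhenskaya2 (u : nat -> nat -> R) m :
  (forall j, u 0%N j = 0) -> (forall j, u m j = 0) ->
  (forall i, u i 0%N = 0) -> (forall i, u i m = 0) ->
  \sum_(i < m) \sum_(j < m) u i j ^+ 4 <=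
  2 * (\sum_(i < m) \sum_(j < m) u i j ^+ 2)
    * (\sum_(i < m) \sum_(j < m) (u i.+1 j - u i j) ^+ 2
       + \sum_(i < m) \sum_(j < m) (u i j.+1 - u i j) ^+ 2).
Proof.
move=> u0j umj ui0 uim.
pose X j := \sum_(i < m) `|u i.+1 j ^+ 2 - u i j ^+ 2|.
pose Y i := \sum_(j < m) `|u i j.+1 ^+ 2 - u i j ^+ 2|.
have X0 j : 0 <= X j by apply: sumr_ge0.
have Y0 j : 0 <= Y j by apply: sumr_ge0.
have uX (i j : 'I_m) : u i j ^+ 2 <= X j.
  have := @le_total_variation (fun i => u i j ^+ 2) m i _ (ltnW (ltn_ord i)).
  by rewrite u0j expr0n ger0_norm ?sqr_ge0 //; apply.
have uY (i j : 'I_m) : u i j ^+ 2 <= Y i.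
  have := @le_total_variation (fun j => u i j ^+ 2) m j _ (ltnW (ltn_ord j)).
  by rewrite ui0 expr0n ger0_norm ?sqr_ge0 //; apply.
apply: (@le_trans _ _ ((\sum_(i < m) Y i) * (\sum_(j < m) X j))).
  rewrite big_distrlr /=; apply: ler_sum => i _; apply: ler_sum => j _.
  have -> : u i j ^+ 4 = u i j ^+ 2 * u i j ^+ 2 by ring.
  by apply: ler_pM; rewrite ?sqr_ge0.
have hX := @sqr_variation 'I_m (fun j i => u i j) m (fun j => u0j j) (fun j => umj j).
have hY := @sqr_variation 'I_m (fun i j => u i j) m (fun j => ui0 j) (fun j => uim j).
rewrite -!/(X _) in hX; rewrite -!/(Y _) in hY.
rewrite /= in hX hY.
rewrite [\sum_(x < m) \sum_(i < m) (u i.+1 x - u i x) ^+ 2]exchange_big in hX.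
rewrite [\sum_(x < m) \sum_(i < m) (u i x) ^+ 2]exchange_big in hX.
move: hX hY.
under eq_bigr => j _ do rewrite -/(X j).
under [in X in _ -> X <= _ -> _]eq_bigr => j _ do rewrite -/(Y j).
move: (\sum_(i < m) X i) (\sum_(i < m) Y i) => a b.
move=> h1 h2; have := sqr_ge0 (a - b); nra.
Qed.

(** The planar inequality is applied to the slices of fixed i. The sum of squares [N i] over a slice
    is bounded, uniformly in i, by the variation [Z] in the first direction, and [Z <= 2 m D1] by
    Cauchy-Schwarz and Poincare. *)
Lemma ladyzhenskaya3 (u : nat -> nat -> nat -> R) m :
  (forall j k, u 0%N j k = 0) -> (forall j k, u m j k = 0) ->
  (forall i k, u i 0%N k = 0) -> (forall i k, u i m k = 0) ->
  (forall i j, u i j 0%N = 0) -> (forall i j, u i j m = 0) ->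
  \sum_(i < m) \sum_(j < m) \sum_(k < m) u i j k ^+ 4 <=
  4 * m%:R * (\sum_(i < m) \sum_(j < m) \sum_(k < m) (u i.+1 j k - u i j k) ^+ 2)
    * (\sum_(i < m) \sum_(j < m) \sum_(k < m) (u i j.+1 k - u i j k) ^+ 2
       + \sum_(i < m) \sum_(j < m) \sum_(k < m) (u i j k.+1 - u i j k) ^+ 2).
Proof.
move=> u0 um v0 vm w0 wm.
pose N i := \sum_(j < m) \sum_(k < m) u i j k ^+ 2.
set D1 := \sum_(i < m) \sum_(j < m) \sum_(k < m) (u i.+1 j k - u i j k) ^+ 2.
have D10 : 0 <= D1 by do 3 (apply: sumr_ge0 => ? _); exact: sqr_ge0.
pose Z := \sum_(i < m) \sum_(j < m) \sum_(k < m) `|u i.+1 j k ^+ 2 - u i j k ^+ 2|.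
have Z0 : 0 <= Z by do 3 (apply: sumr_ge0 => ? _).
have NZ (i : 'I_m) : N i <= Z.
  apply: le_trans (ler_norm _) _.
  apply: le_trans (le_total_variation _ (ltnW (ltn_ord i))) _.
    by rewrite /N big1 // => j _; rewrite big1 // => k _; rewrite u0 expr0n.
  apply: ler_sum => a _; rewrite /N -sumrB.
  apply: le_trans (ler_norm_sum _ _ _) _; apply: ler_sum => b _; rewrite -sumrB.
  exact: ler_norm_sum.
have swap (F : nat -> nat -> nat -> R) :
  \sum_(i < m) \sum_(j < m) \sum_(k < m) F i j k =
  \sum_(p : 'I_m * 'I_m) \sum_(i < m) F i p.1 p.2.
  rewrite exchange_big /= -(pair_big xpredT xpredT
     (fun (j k : 'I_m) => \sum_(i < m) F i j k)) /=.
  by apply: eq_bigr => j _; rewrite exchange_big.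
have hZ : Z ^+ 2 <= 4 * D1 * (m%:R ^+ 2 * D1).
  have := @sqr_variation ('I_m * 'I_m)%type (fun p i => u i p.1 p.2) m
    (fun p => u0 p.1 p.2) (fun p => um p.1 p.2).
  rewrite /= -(swap (fun i j k => `|u i.+1 j k ^+ 2 - u i j k ^+ 2|)) -/Z.
  rewrite -(swap (fun i j k => (u i.+1 j k - u i j k) ^+ 2)) -/D1.
  move/le_trans; apply; apply: ler_wpM2l; first by rewrite mulr_ge0.
  rewrite /D1 (swap (fun i j k => (u i.+1 j k - u i j k) ^+ 2)) mulr_sumr.
  apply: ler_sum => p _.
  apply: (@le_trans _ _ (\sum_(i < m)
     (m%:R * \sum_(i < m) (u i.+1 p.1 p.2 - u i p.1 p.2) ^+ 2))).
    by apply: ler_sum => i _; apply: (@sqr_le_diff (fun i => u i p.1 p.2)) => //;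
      exact: ltnW.
  rewrite sumr_const card_ord -[_ *+ m]mulr_natl.
  by rewrite le_eqVlt; apply/orP; left; apply/eqP; ring.
have Zle : Z <= 2 * m%:R * D1.
  rewrite -(@ler_pXn2r _ 2) ?nnegrE ?mulr_ge0 //; apply: le_trans hZ _.
  by rewrite le_eqVlt; apply/orP; left; apply/eqP; ring.
apply: (@le_trans _ _ (\sum_(i < m) 2 * N i *
   (\sum_(j < m) \sum_(k < m) (u i j.+1 k - u i j k) ^+ 2
       + \sum_(j < m) \sum_(k < m) (u i j k.+1 - u i j k) ^+ 2))).
  by apply: ler_sum => i _; apply: ladyzhenskaya2.
rewrite -big_split /= mulr_sumr; apply: ler_sum => i _.
apply: ler_wpM2r.
  by apply: addr_ge0; do 2 (apply: sumr_ge0 => ? _); exact: sqr_ge0.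
have := NZ i; nra.
Qed.

End GridSums.

(** * Grid sums over [-L, L]^d and their Sobolev inequality *)

Definition vcons (R : Type) (d : nat) (t : R) (y : 'rV[R]_d) : 'rV[R]_d.+1 :=
  \row_i if unlift ord0 i is Some j then y ord0 j else t.

Lemma vcons0 (R : Type) d (t : R) (y : 'rV[R]_d) o :
  vcons t y o ord0 = t.
Proof. by rewrite mxE unlift_none. Qed.

Lemma vconsS (R : Type) d (t : R) (y : 'rV[R]_d) o i :
  vcons t y o (lift ord0 i) = y ord0 i.
Proof. by rewrite mxE liftK. Qed.

Definition grid_pt (R : realType) (L : R) (m : nat) (j : nat) : R :=
  - L + j%:R * (2 * L / m%:R).

(* The last grid point [j = m] of each line is left out, so that forward
   differences at the points of the sum stay in [-L, L]^d. *)
Fixpoint gsum (R : realType) (L : R) (m d : nat) : ('rV[R]_d -> R) -> R :=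
  match d return ('rV[R]_d -> R) -> R with
  | 0%N => fun f => f 0
  | d'.+1 => fun f => (2 * L / m%:R) * \sum_(j < m)
      gsum L m (fun y : 'rV[R]_d' => f (vcons (grid_pt L m j) y))
  end.

Definition grid (R : realType) (L : R) (m d : nat) : set 'rV[R]_d :=
  [set z | forall i, exists2 j : nat, (j < m)%N & z ord0 i = grid_pt L m j].

Definition fdiff (R : realType) (L : R) (m d : nat) (i : 'I_d)
    (f : 'rV[R]_d -> R) (z : 'rV[R]_d) : R :=
  (f (z + (2 * L / m%:R) *: delta_mx ord0 i) - f z) / (2 * L / m%:R).

Section Gsum.
Variables (R : realType) (L : R) (m : nat).
Hypothesis L0 : 0 < L.

Local Notation dl := (2 * L / m%:R).

Lemma grid_step_ge0 : 0 <= dl.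
Proof. by rewrite divr_ge0 // mulr_ge0 // ltW. Qed.

Lemma grid_ptS j : grid_pt L m j.+1 = grid_pt L m j + dl.
Proof. rewrite /grid_pt -natr1; ring. Qed.

Lemma grid_pt_bounds j : (j <= m)%N -> - L <= grid_pt L m j <= L.
Proof.
move=> jm; rewrite /grid_pt.
have [m0|m0] := posnP m.
  have -> : j = 0%N by move: jm; rewrite m0 leqn0 => /eqP.
  by rewrite mulr0n mul0r addr0 lexx /= ge0_cp ?ltW.
have h : 0 <= j%:R * dl by rewrite mulr_ge0 // grid_step_ge0.
have : j%:R * dl <= 2 * L.
  rewrite mulrA ler_pdivrMr ?ltr0n // mulrC ler_wpM2l ?ler_nat //.
  by rewrite mulr_ge0 // ltW.
move=> h'; apply/andP; split; lra.
Qed.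

Lemma gsum_le d (f g : 'rV[R]_d -> R) :
  (forall z, grid L m z -> f z <= g z) -> gsum L m f <= gsum L m g.
Proof.
elim: d f g => [|d IH] f g fg /=; first by apply: fg => -[].
apply: ler_wpM2l; first exact: grid_step_ge0.
apply: ler_sum => j _; apply: IH => z gz; apply: fg => i.
case: (unliftP ord0 i) => [k ->|->]; first by rewrite vconsS; exact: gz.
by rewrite vcons0; exists j.
Qed.

Lemma gsum_ext d (f g : 'rV[R]_d -> R) :
  (forall z, f z = g z) -> gsum L m f = gsum L m g.
Proof. by move=> fg; apply/eqP; rewrite eq_le !gsum_le // => z _; rewrite fg. Qed.

Lemma gsumZ d (a : R) (f : 'rV[R]_d -> R) :
  gsum L m (fun z => a * f z) = a * gsum L m f.
Proof.
elim: d f => [//|d IH] f /=.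
by under eq_bigr do rewrite IH; rewrite -mulr_sumr mulrCA.
Qed.

Lemma gsum0 d : gsum L m (fun _ : 'rV[R]_d => 0) = 0.
Proof.
rewrite -[RHS](mul0r (gsum L m (fun _ : 'rV[R]_d => 0))) -gsumZ.
by apply: gsum_ext => z; rewrite mul0r.
Qed.

Lemma gsumD d (f g : 'rV[R]_d -> R) :
  gsum L m (fun z => f z + g z) = gsum L m f + gsum L m g.
Proof.
elim: d f g => [//|d IH] f g /=.
by under eq_bigr do rewrite IH; rewrite big_split mulrDr.
Qed.

Lemma gsum_sum d (I : Type) (r : seq I) (F : I -> 'rV[R]_d -> R) :
  gsum L m (fun z => \sum_(i <- r) F i z) = \sum_(i <- r) gsum L m (F i).
Proof.
elim: r => [|i r IH].
  by rewrite big_nil -[RHS](gsum0 d); apply: gsum_ext => z; rewrite big_nil.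
by rewrite big_cons -IH -gsumD; apply: gsum_ext => z; rewrite big_cons.
Qed.

Lemma gsum_ge0 d (f : 'rV[R]_d -> R) :
  (forall z, 0 <= f z) -> 0 <= gsum L m f.
Proof. by move=> f0; rewrite -[leLHS](gsum0 d); apply: gsum_le => z _. Qed.

Lemma vcons_shift0 d (t a : R) (y : 'rV[R]_d) :
  vcons t y + a *: delta_mx ord0 ord0 = vcons (t + a) y.
Proof.
apply/rowP => i; rewrite !mxE.
case: (unliftP ord0 i) => [k ->|->]; last by rewrite mulr1.
by rewrite [lift _ _ == _]eq_sym (negbTE (neq_lift _ _)) andbF mulr0 addr0.
Qed.

Lemma vcons_shiftS d (t a : R) (y : 'rV[R]_d) (i : 'I_d) :
  vcons t y + a *: delta_mx ord0 (lift ord0 i) =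
  vcons t (y + a *: delta_mx ord0 i).
Proof.
apply/rowP => k; rewrite !mxE.
case: (unliftP ord0 k) => [l ->|->]; first by rewrite !mxE (inj_eq lift_inj).
by rewrite (negbTE (neq_lift _ _)) andbF mulr0 addr0.
Qed.

Let vanish d (f : 'rV[R]_d -> R) :=
  forall z : 'rV[R]_d, (exists i, z ord0 i = - L \/ z ord0 i = L) -> f z = 0.

Let grid_pt0 : grid_pt L m 0 = - L.
Proof. by rewrite /grid_pt mul0r addr0. Qed.

Let grid_ptm : (0 < m)%N -> grid_pt L m m = L.
Proof.
move=> m0; rewrite /grid_pt mulrCA divff ?mulr1; first by ring.
by rewrite pnatr_eq0 -lt0n.
Qed.

Let vanish0 d (f : 'rV[R]_d.+1 -> R) y : vanish f ->
  f (vcons (grid_pt L m 0) y) = 0.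
Proof.
by move=> vf; apply: vf; exists ord0; left; rewrite vcons0.
Qed.

Let vanishm d (f : 'rV[R]_d.+1 -> R) y : (0 < m)%N -> vanish f ->
  f (vcons (grid_pt L m m) y) = 0.
Proof.
move=> m0 vf; apply: vf; exists ord0; right.
by rewrite vcons0 grid_ptm.
Qed.

Let vanishS d (f : 'rV[R]_d.+1 -> R) t : vanish f ->
  vanish (fun y : 'rV_d => f (vcons t y)).
Proof.
by move=> vf z [i iP]; apply: vf; exists (lift ord0 i); rewrite vconsS.
Qed.

Let dlE (m0 : (0 < m)%N) : dl != 0 /\ m%:R = 2 * L / dl.
Proof.
have mn0 : m%:R != 0 :> R by rewrite pnatr_eq0 -lt0n.
have Ln0 : L != 0 by rewrite gt_eqF.
split; first by rewrite !mulf_neq0 ?invr_neq0.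
by field; rewrite mn0.
Qed.

Let pt1 i : 'rV[R]_1 := vcons (grid_pt L m i) 0.
Let pt2 i j : 'rV[R]_2 := vcons (grid_pt L m i) (pt1 j).
Let pt3 i j k : 'rV[R]_3 := vcons (grid_pt L m i) (pt2 j k).

Let gsum1E f : gsum L m f = dl * \sum_(i < m) f (pt1 i).
Proof. by []. Qed.

Let gsum2E f : gsum L m f = dl ^+ 2 * \sum_(i < m) \sum_(j < m) f (pt2 i j).
Proof. by rewrite /= -mulr_sumr mulrA. Qed.

Let gsum3E f : gsum L m f =
  dl ^+ 3 * \sum_(i < m) \sum_(j < m) \sum_(k < m) f (pt3 i j k).
Proof.
rewrite exprS -mulrA mulr_sumr /=; congr (_ * _); apply: eq_bigr => i _.
exact: (gsum2E (fun y => f (vcons _ y))).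
Qed.

Lemma gsum_sobolev1 (f : 'rV[R]_1 -> R) : (0 < m)%N -> vanish f ->
  gsum L m (fun z => f z ^+ 4) <=
  8 * L ^+ 3 * (\sum_i gsum L m (fun z => fdiff L m i f z ^+ 2)) ^+ 2.
Proof.
move=> m0 vf; have [dl0 mE] := dlE m0.
rewrite big_ord1 !gsum1E.
pose u i := f (pt1 i).
have := @ladyzhenskaya1 _ u m (vanish0 _ vf).
rewrite [X in _ -> _ <= _ * (_ * X) ^+ 2](eq_bigr
  (fun i : 'I_m => (u i.+1 - u i) ^+ 2 * dl^-1 ^+ 2)); last first.
  by move=> i _; rewrite /fdiff vcons_shift0 -grid_ptS exprMn.
rewrite -mulr_suml; set D := \sum_(i < m) (_ - _) ^+ 2 => h.
apply: le_trans (ler_wpM2l grid_step_ge0 h) _.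
(* With m written as 2L divided by the step, all powers of the step cancel and the constant depends
   on L only. *)
move: dl dl0 mE => e e0 ->.
by rewrite le_eqVlt; apply/orP; left; apply/eqP; field.
Qed.

Lemma gsum_sobolev2 (f : 'rV[R]_2 -> R) : (0 < m)%N -> vanish f ->
  gsum L m (fun z => f z ^+ 4) <=
  8 * L ^+ 2 * (\sum_i gsum L m (fun z => fdiff L m i f z ^+ 2)) ^+ 2.
Proof.
move=> m0 vf; have [dl0 mE] := dlE m0.
rewrite !big_ord_recl big_ord0 addr0 !gsum2E.
pose u i j := f (pt2 i j).
have vS i : vanish (fun y => f (vcons (grid_pt L m i) y)) by exact: vanishS.
have u0 j : u 0%N j = 0 by exact: (vanish0 _ vf).
have := @ladyzhenskaya2 _ u m u0 (fun j => vanishm _ m0 vf)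
  (fun i => vanish0 _ (vS i)) (fun i => vanishm _ m0 (vS i)).
rewrite [X in _ -> _ <= _ * (_ * X + _) ^+ 2](eq_bigr (fun i : 'I_m =>
  (\sum_(j < m) (u i.+1 j - u i j) ^+ 2) * dl^-1 ^+ 2)); last first.
  move=> i _; rewrite mulr_suml; apply: eq_bigr => j _.
  by rewrite /fdiff vcons_shift0 -grid_ptS exprMn.
rewrite [X in _ -> _ <= _ * (_ + _ * X) ^+ 2](eq_bigr (fun i : 'I_m =>
  (\sum_(j < m) (u i j.+1 - u i j) ^+ 2) * dl^-1 ^+ 2)); last first.
  move=> i _; rewrite mulr_suml; apply: eq_bigr => j _.
  by rewrite /fdiff vcons_shiftS vcons_shift0 -grid_ptS exprMn.
rewrite -!mulr_suml.
set D1 := (X in _ <= _ * (X + _) -> _); set D2 := (X in _ <= _ * (_ + X) -> _).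
set N := (X in _ <= _ * X * _ -> _) => h.
have D10 : 0 <= D1 by do 2 (apply: sumr_ge0 => ? _); exact: sqr_ge0.
have D20 : 0 <= D2 by do 2 (apply: sumr_ge0 => ? _); exact: sqr_ge0.
(* The right-hand side may contain differences only, so the sum of squares is traded for differences
   by the Poincare inequality in the first coordinate. *)
have N_le : N <= m%:R ^+ 2 * D1.
  rewrite /N /D1 exchange_big [X in _ <= _ * X]exchange_big /= mulr_sumr.
  apply: ler_sum => j _.
  apply: (@le_trans _ _ (\sum_(i < m) (m%:R * \sum_(i < m) (u i.+1 j - u i j) ^+ 2))).
    by apply: ler_sum => i _; apply: (@sqr_le_diff _ (fun i => u i j)) => //; exact: ltnW.
  by rewrite sumr_const card_ord -[_ *+ m]mulr_natl mulrA -expr2.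
apply: le_trans (ler_wpM2l (exprn_ge0 _ grid_step_ge0) h) _.
apply: (@le_trans _ _ (dl ^+ 2 * (2 * (m%:R ^+ 2 * D1) * (D1 + D2)))).
  apply: ler_wpM2l; first exact: exprn_ge0 grid_step_ge0.
  by apply: ler_wpM2r; [exact: addr_ge0 | apply: ler_wpM2l].
move: dl dl0 mE => e e0 ->.
have -> : e ^+ 2 * (2 * ((2 * L / e) ^+ 2 * D1) * (D1 + D2)) =
  8 * L ^+ 2 * (D1 * (D1 + D2)) by field.
have -> : e ^+ 2 * (D1 * e^-1 ^+ 2) + e ^+ 2 * (D2 * e^-1 ^+ 2) = D1 + D2 by field.
by rewrite expr2; apply: ler_wpM2l; [rewrite mulr_ge0 // sqr_ge0 | nra].
Qed.

Lemma gsum_sobolev3 (f : 'rV[R]_3 -> R) : (0 < m)%N -> vanish f ->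
  gsum L m (fun z => f z ^+ 4) <=
  8 * L * (\sum_i gsum L m (fun z => fdiff L m i f z ^+ 2)) ^+ 2.
Proof.
move=> m0 vf; have [dl0 mE] := dlE m0.
rewrite !big_ord_recl big_ord0 addr0 !gsum3E.
pose u i j k := f (pt3 i j k).
have vS i : vanish (fun y => f (vcons (grid_pt L m i) y)) by exact: vanishS.
have vSS i j : vanish (fun y => f (vcons (grid_pt L m i) (vcons (grid_pt L m j) y))).
  exact: (vanishS _ (vS i)).
have := @ladyzhenskaya3 _ u m (fun j k => vanish0 _ vf) (fun j k => vanishm _ m0 vf)
  (fun i k => vanish0 _ (vS i)) (fun i k => vanishm _ m0 (vS i))
  (fun i j => vanish0 _ (vSS i j)) (fun i j => vanishm _ m0 (vSS i j)).
have pull (g : nat -> nat -> nat -> R) :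
  \sum_(i < m) \sum_(j < m) \sum_(k < m) (g i j k) ^+ 2 * dl^-1 ^+ 2 =
  (\sum_(i < m) \sum_(j < m) \sum_(k < m) (g i j k) ^+ 2) * dl^-1 ^+ 2.
  by rewrite mulr_suml; apply: eq_bigr => i _; rewrite mulr_suml;
     apply: eq_bigr => j _; rewrite mulr_suml.
rewrite [X in _ -> _ <= _ * (_ * X + _) ^+ 2](_ : _ = \sum_(i < m) \sum_(j < m)
   \sum_(k < m) (u i.+1 j k - u i j k) ^+ 2 * dl^-1 ^+ 2); last first.
  by do 3 (apply: eq_bigr => ? _); rewrite /fdiff vcons_shift0 -grid_ptS exprMn.
rewrite [X in _ -> _ <= _ * (_ + (_ * X + _)) ^+ 2](_ : _ = \sum_(i < m) \sum_(j < m)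
   \sum_(k < m) (u i j.+1 k - u i j k) ^+ 2 * dl^-1 ^+ 2); last first.
  by do 3 (apply: eq_bigr => ? _);
     rewrite /fdiff vcons_shiftS vcons_shift0 -grid_ptS exprMn.
rewrite [X in _ -> _ <= _ * (_ + (_ + _ * X)) ^+ 2](_ : _ = \sum_(i < m) \sum_(j < m)
   \sum_(k < m) (u i j k.+1 - u i j k) ^+ 2 * dl^-1 ^+ 2); last first.
  by do 3 (apply: eq_bigr => ? _);
     rewrite /fdiff !vcons_shiftS vcons_shift0 -grid_ptS exprMn.
rewrite (pull (fun i j k => u i.+1 j k - u i j k)).
rewrite (pull (fun i j k => u i j.+1 k - u i j k)).
rewrite (pull (fun i j k => u i j k.+1 - u i j k)).
set D1 := (X in _ <= _ * X * (_ + _) -> _).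
set D2 := (X in _ <= _ * (X + _) -> _); set D3 := (X in _ <= _ * (_ + X) -> _) => h.
have D10 : 0 <= D1 by do 3 (apply: sumr_ge0 => ? _); exact: sqr_ge0.
have D20 : 0 <= D2 by do 3 (apply: sumr_ge0 => ? _); exact: sqr_ge0.
have D30 : 0 <= D3 by do 3 (apply: sumr_ge0 => ? _); exact: sqr_ge0.
apply: le_trans (ler_wpM2l (exprn_ge0 _ grid_step_ge0) h) _.
move: dl dl0 mE => e e0 ->.
have -> : e ^+ 3 * (4 * (2 * L / e) * D1 * (D2 + D3)) =
  8 * L * (e ^+ 2 * (D1 * (D2 + D3))) by field.
have -> : e ^+ 3 * (D1 * e^-1 ^+ 2) + (e ^+ 3 * (D2 * e^-1 ^+ 2) +
  e ^+ 3 * (D3 * e^-1 ^+ 2)) = e * (D1 + (D2 + D3)) by field.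
apply: ler_wpM2l; first by rewrite mulr_ge0 // ltW.
by rewrite exprMn; apply: ler_wpM2l; [exact: sqr_ge0 | nra].
Qed.

Lemma gsum_sobolev d (f : 'rV[R]_d -> R) : (1 <= d <= 3)%N -> (0 < m)%N ->
  (forall z : 'rV[R]_d, (exists i, z ord0 i = - L \/ z ord0 i = L) -> f z = 0) ->
  gsum L m (fun z => f z ^+ 4) <=
  8 * (L + L ^+ 2 + L ^+ 3) *
    (\sum_i gsum L m (fun z => fdiff L m i f z ^+ 2)) ^+ 2.
Proof.
move=> /andP[d1 d3] m0 vf.
have : [\/ d = 1, d = 2 | d = 3]%N.
  by move: d d1 d3 {f vf} => [|[|[|[|d]]]] // _ _; constructor.
have L2 : 0 <= L ^+ 2 by exact: sqr_ge0.
have L3 : 0 <= L ^+ 3 by apply: exprn_ge0; exact: ltW.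
case=> dE; subst d;
  [apply: le_trans (gsum_sobolev1 m0 vf) _ | apply: le_trans (gsum_sobolev2 m0 vf) _
  |apply: le_trans (gsum_sobolev3 m0 vf) _];
  (apply: ler_wpM2r; [exact: sqr_ge0 | move: L2 L3 L0; lra]).
Qed.
End Gsum.

(** * Grid points in parallelepipeds *)

Lemma block_mx_bound (R : realFieldType) (n : nat) (C : R) (a : 'M[R]_1)
    (b : 'M[R]_(1, n)) (c : 'M[R]_(n, 1)) (e : 'M[R]_n) :
  (forall i j, `|a i j| <= C) -> (forall i j, `|b i j| <= C) ->
  (forall i j, `|c i j| <= C) -> (forall i j, `|e i j| <= C) ->
  forall i j, `|block_mx a b c e i j| <= C.
Proof.
move=> ha hb hc he i j.
case: (split_ordP i) => i' ->; case: (split_ordP j) => j' ->.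
- by rewrite block_mxEul.
- by rewrite block_mxEur.
- by rewrite block_mxEdl.
- by rewrite block_mxEdr.
Qed.

(* LU decomposition with partial pivoting: the multipliers are bounded by 1,
   so B and its inverse B' are bounded by a constant depending only on d. *)
Lemma pivoted_lu (R : realFieldType) (d : nat) :
  exists2 C : R, 0 < C & forall A : 'M[R]_d, A \in unitmx ->
  exists B B' U : 'M[R]_d,
    [/\ A = B *m U, U = B' *m A,
        forall i j, `|B i j| <= C /\ `|B' i j| <= C,
        forall i j : 'I_d, (j < i)%N -> U i j = 0 &
        `|\det A| = `|\det U|].
Proof.
elim: d => [|d [C C0 IH]].
  exists 1 => // A _; exists 1%:M, 1%:M, A.
  by rewrite mul1mx; split => // -[].
(* The 1 serves the identity block and the multipliers [l], C serves [B] and [B'], and d C serves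
   the product of [B'] and [l]. *)
pose C' := 1 + C + d%:R * C.
have dC0 : 0 <= d%:R * C by rewrite mulr_ge0 // ltW.
have C'0 : 0 < C' by rewrite /C'; lra.
have C'1 : 1 <= C' by rewrite /C'; lra.
have C'C : C <= C' by rewrite /C'; lra.
have C'd : d%:R * C <= C' by rewrite /C'; lra.
exists C' => //; rewrite -[d.+1]/(1 + d)%N => A uA.
pose i0 := [arg max_(i > (ord0 : 'I_(1 + d))) `|A i ord0|]%O.
have i0max i : `|A i ord0| <= `|A i0 ord0|.
  by rewrite /i0; case: arg_maxP => // k _ /(_ i); apply.
pose A1 := xrow i0 ord0 A.
have A1E : A1 = tperm_mx i0 ord0 *m A by rewrite /A1 xrowE.
have dA1 : `|\det A1| = `|\det A|.
  by rewrite A1E det_mulmx det_perm normrM normr_sign mul1r.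
have detA0 : \det A != 0 by move: uA; rewrite unitmxE unitfE.
pose a := A1 ord0 ord0.
have aE : a = A i0 ord0 by rewrite /a mxE tpermR.
have a0 : a != 0.
  (* The pivot is the largest entry of its column; were it 0, the whole column and hence the
     determinant would vanish. *)
  apply: contraNneq detA0; rewrite aE => h.
  rewrite (expand_det_col _ ord0) big1 // => i _.
  by have := i0max i; rewrite h normr0 normr_le0 => /eqP ->; rewrite mul0r.
pose l : 'M[R]_(d, 1) := a^-1 *: dlsubmx A1.
have l1 i j : `|l i j| <= 1.
  rewrite !mxE normrM normfV ler_pdivrMl ?normr_gt0 // mulr1 aE.
  have -> : lshift d j = ord0 by apply/val_inj; rewrite /= ord1.
  exact: i0max.
have ulE : ulsubmx A1 = a%:M.
  apply/matrixP => i j; rewrite !ord1 !mxE eqxx mulr1n /a !mxE.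
  by congr (A (tperm _ _ _) _); apply/val_inj.
have dlE : dlsubmx A1 = a *: l by rewrite scalerA divff // scale1r.
pose r := ursubmx A1.
pose A2 := drsubmx A1 - l *m r.
have A1b : A1 = block_mx 1%:M 0 l 1%:M *m block_mx a%:M r 0 A2.
  rewrite mulmx_block !mul1mx !mul0mx ?mulmx0 !addr0 mul_mx_scalar -dlE /A2.
  by rewrite addrCA subrr addr0 -ulE /r submxK.
have dA2 : \det A1 = a * \det A2.
  rewrite A1b det_mulmx det_lblock det_ublock !det1 !mul1r.
  by rewrite det_scalar expr1.
have uA2 : A2 \in unitmx.
  rewrite unitmxE unitfE; apply: contraNneq detA0 => h.
  by rewrite -normr_eq0 -dA1 dA2 h mulr0 normr0.
have [B [B' [U [A2E UE bB trU dU]]]] := IH _ uA2.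
pose B1 := block_mx 1%:M 0 l B.
pose B1' := block_mx 1%:M 0 (- (B' *m l)) B'.
pose U1 := block_mx a%:M r 0 U.
have A1B : A1 = B1 *m U1.
  rewrite A1b !mulmx_block !mul1mx !mul0mx ?mulmx0 !addr0.
  by rewrite -A2E.
have U1B : U1 = B1' *m A1.
  rewrite A1b !mulmx_block !mul1mx !mul0mx ?mulmx0 !addr0 !mulNmx.
  by rewrite mulmxDr !mulmxA addKr addNr -UE.
have tt : tperm_mx i0 ord0 *m tperm_mx i0 ord0 = 1%:M :> 'M[R]_(1 + d).
  by rewrite -perm_mxM tperm2 perm_mx1.
exists (xrow i0 ord0 B1), (xcol i0 ord0 B1'), U1; split.
- by rewrite xrowE -mulmxA -A1B A1E mulmxA tt mul1mx.
- by rewrite xcolE -mulmxA -A1E.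
- have C'1' i j : `|(1%:M : 'M[R]_1) i j| <= C'.
    by rewrite !mxE; case: eqP; rewrite ?normr0 ?normr1 // ltW.
  have C'0' i j : `|(0 : 'M[R]_(1, d)) i j| <= C' by rewrite mxE normr0 ltW.
  move=> i j; split; rewrite mxE; apply: block_mx_bound => // {}i {}j.
  + exact: le_trans (l1 _ _) C'1.
  + exact: le_trans (bB _ _).1 C'C.
  + rewrite mxE normrN mxE; apply: le_trans C'd.
    apply: le_trans (ler_norm_sum _ _ _) _.
    apply: (@le_trans _ _ (\sum_(k < d) C)); last first.
      by rewrite sumr_const card_ord mulr_natl.
    apply: ler_sum => k _; rewrite normrM -[leRHS]mulr1.
    by apply: ler_pM => //; exact: (bB _ _).2.
  + exact: le_trans (bB _ _).2 C'C.
- move=> i j; rewrite /U1.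
  case: (split_ordP i) => i' ->; case: (split_ordP j) => j' -> /=.
  + by rewrite !ord1.
  + by rewrite !ord1 /= ltnNge.
  + by rewrite block_mxEdl mxE.
  + by rewrite block_mxEdr ltn_add2l; exact: trU.
- rewrite -dA1 dA2 det_ublock det_scalar expr1 !normrM; congr (_ * _).
  exact: dU.
Qed.

Section Count1.
Variable R : realFieldType.

Lemma count_le (p q : R) (n : nat) : p <= q ->
  \sum_(j < n) (p <= j%:R <= q)%R%:R <= q - p + 1.
Proof.
move=> pq.
(* The second bound strengthens the induction: when n itself is counted, the integers counted before
   it number at most n - p. *)
suff [] : \sum_(j < n) (p <= j%:R <= q)%R%:R <= q - p + 1 /\
   \sum_(j < n) (p <= j%:R <= q)%R%:R <= Num.max 0 (n%:R - p) by [].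
elim: n => [|n [h1 h2]].
  by rewrite big_ord0 le_max lexx; split => //; lra.
rewrite big_ord_recr /=; move: h1 h2; set f := \sum_(i < n) _ => h1 h2.
rewrite -natr1; case: (boolP (p <= n%:R <= q)) => /= [/andP[pn nq]|_].
  have h3 : f <= n%:R - p by move: h2; rewrite le_max => /orP[|//]; lra.
  by rewrite le_max; split; [lra | apply/orP; right; lra].
rewrite mulr0n addr0; split => //; apply: le_trans h2 _.
rewrite ge_max !le_max lexx /=; apply/orP; right; lra.
Qed.

Lemma count_ge (p q : R) (n : nat) : 0 <= p -> q <= n%:R ->
  q - p - 1 <= \sum_(j < n) (p <= j%:R <= q)%R%:R.
Proof.
move=> p0 qn.
(* Truncating q at n gives a statement that is true at every stage of the induction. *)
suff : Num.min q n%:R - p - 1 <= \sum_(j < n) (p <= j%:R <= q)%R%:R by rewrite min_l.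
elim: n {qn} => [|n h].
  rewrite big_ord0 /=; have : Num.min q 0 <= 0 by rewrite ge_min lexx orbT.
  lra.
rewrite big_ord_recr /=; move: h; set f := \sum_(i < n) _ => h.
have f0 : 0 <= f by apply: sumr_ge0.
rewrite -natr1; move: h; rewrite !minElt.
case: (ltP q n%:R) => h1; case: (ltP q (n%:R + 1)) => h2; case: (leP p n%:R) => h3;
  case: (leP n%:R q) => h4 /=; lra.
Qed.

End Count1.

(** The parallelepiped with centre [b] whose half-edges are the rows of [A]; its volume is 2^d |det
    A|. *)
Definition box (R : realFieldType) (d : nat) (A : 'M[R]_d) (b : 'rV[R]_d) : set 'rV[R]_d :=
  [set z | exists2 s : 'rV[R]_d, (forall i, `|s ord0 i| <= 1) & z = b + s *m A].

Definition vtail (R : Type) (d : nat) (x : 'rV[R]_d.+1) : 'rV[R]_d :=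
  \row_i x ord0 (lift ord0 i).

Section Count.
Variables (R : realType) (L : R).
Hypothesis L0 : 0 < L.

(** The induction step for counting by slices. As the first column of [U] vanishes below the pivot,
    the first coordinate of a point determines the first parameter [s], and the slice is a box of
    one dimension less whose centre is shifted by [s] times the first row. *)
Lemma vcons_box d (U : 'M[R]_d.+1) (b : 'rV[R]_d.+1) t y :
  (forall i, U (lift ord0 i) ord0 = 0) -> U ord0 ord0 != 0 ->
  let s := (t - b ord0 ord0) / U ord0 ord0 in
  box U b (vcons t y) <->
  (`|s| <= 1) /\ box (row' ord0 (col' ord0 U)) (vtail b + s *: vtail (row ord0 U)) y.
Proof.
move=> Ut U0 s; split.
- move=> [r rP e].
  have sE : s = r ord0 ord0.
    have := congr1 (fun x : 'rV_d.+1 => x ord0 ord0) e.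
    rewrite /= vcons0 !mxE big_ord_recl big1 => [|i _]; last by rewrite Ut mulr0.
    by rewrite /s => ->; field.
  split; first by rewrite sE rP.
  exists (vtail r) => [i|]; first by rewrite mxE rP.
  apply/rowP => i.
  have := congr1 (fun x : 'rV_d.+1 => x ord0 (lift ord0 i)) e.
  rewrite /= vconsS !mxE big_ord_recl => ->; rewrite sE addrA.
  by congr (_ + _); apply: eq_bigr => k _; rewrite !mxE.
- move=> [s1 [r rP e]].
  exists (vcons s r) => [i|].
    by case: (unliftP ord0 i) => [k ->|->]; rewrite ?vconsS ?vcons0.
  apply/rowP => i; rewrite [RHS]mxE [X in _ + X]mxE big_ord_recl vcons0.
  case: (unliftP ord0 i) => [k ->|->].
    rewrite vconsS e !mxE addrA; congr (_ + _); apply: eq_bigr => j _.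
    by rewrite vconsS !mxE.
  rewrite vcons0 big1 => [|j _]; last by rewrite Ut mulr0.
  by rewrite /s; field.
Qed.

Let slab m (j : nat) (x a : R) : (0 < m)%N -> a != 0 ->
  (`|(grid_pt L m j - x) / a| <= 1) =
  ((x - `|a| + L) / (2 * L / m%:R) <= j%:R <= (x + `|a| + L) / (2 * L / m%:R)).
Proof.
move=> m0 a0; rewrite normrM normfV ler_pdivrMr ?normr_gt0 // mul1r ler_norml.
have dl0 : 0 < 2 * L / m%:R by rewrite divr_gt0 ?mulr_gt0 ?ltr0n.
rewrite ler_pdivrMr // ler_pdivlMr // /grid_pt; move: (2 * L / m%:R) => e.
by congr (_ && _); apply/idP/idP; lra.
Qed.

(** Along each axis a slab of width 2a holds at most 2a / step + 1 grid points; times the step this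
    is at most 3a, since the step does not exceed a. *)
Lemma gsum_box_le d (U : 'M[R]_d) m :
  (0 < m)%N -> (forall i j : 'I_d, (j < i)%N -> U i j = 0) ->
  (forall i, U i i != 0) -> (forall i, 2 * L / m%:R <= `|U i i|) ->
  forall b, gsum L m (\1_(box U b)) <= \prod_i (3 * `|U i i|) :> R.
Proof.
move=> m0.
have dl0 : 0 < 2 * L / m%:R by rewrite divr_gt0 ?mulr_gt0 ?ltr0n.
elim: d U => [|d IH] U Ut U0 Um b.
  by rewrite /= big_ord0 indicE; case: (_ \in _).
rewrite /= big_ord_recl.
pose s j := (grid_pt L m j - b ord0 ord0) / U ord0 ord0.
have U0' i : (row' ord0 (col' ord0 U)) i i != 0 by rewrite !mxE.
have Ut' (i j : 'I_d) : (j < i)%N -> (row' ord0 (col' ord0 U)) i j = 0.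
  by rewrite !mxE => ji; apply: Ut.
have Um' i : 2 * L / m%:R <= `|(row' ord0 (col' ord0 U)) i i| by rewrite !mxE.
have {}IH := IH _ Ut' U0' Um'.
set Pi := \prod_(i < d) _.
have PiE : \prod_i (3 * `|row' ord0 (col' ord0 U) i i|) = Pi.
  by apply: eq_bigr => i _; rewrite !mxE.
have Pi0 : 0 <= Pi by apply: prodr_ge0 => i _; rewrite mulr_ge0.
have Uc i : U (lift ord0 i) ord0 = 0 by apply: Ut.
apply: (@le_trans _ _ ((2 * L / m%:R) * \sum_(j < m) ((`|s j| <= 1)%R%:R * Pi))).
  apply: ler_wpM2l; first exact: ltW.
  apply: ler_sum => j _.
  case: (boolP (`|s j| <= 1)) => sj; last first.
    rewrite mul0r -(gsum0 m L0 d); apply: gsum_le => // y _; rewrite indicE memNset //.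
    by move=> /(vcons_box _ _ _ Uc (U0 _))[]; rewrite -/(s j) (negbTE sj).
  rewrite mul1r -PiE.
  apply: le_trans (IH (vtail b + s j *: vtail (row ord0 U))).
  apply: gsum_le => // y _; rewrite !indicE.
  case: (boolP (_ \in _)) => // /set_mem /(vcons_box _ _ _ Uc (U0 _))[_ h].
  by rewrite mem_set.
rewrite -mulr_suml mulrA; apply: ler_wpM2r => //.
under eq_bigr => j _ do rewrite /s slab //.
have dm := Um ord0.
have a0 := normr_ge0 (U ord0 ord0).
apply: le_trans (ler_wpM2l (ltW dl0) (count_le _ _)) _.
  by rewrite ler_pM2r ?invr_gt0 //; lra.
rewrite -mulrBl mulrDr mulr1 mulrCA divff ?gt_eqF // mulr1; lra.
Qed.

(** Dual to the upper bound: a slab of width 2a inside [-L, L] contributes at least 2a minus the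
    step, hence at least a. The loss of one point in [count_ge] also accounts for the last grid
    point, which is left out. *)
Lemma gsum_box_ge d (U : 'M[R]_d) m :
  (0 < m)%N -> (forall i j : 'I_d, (j < i)%N -> U i j = 0) ->
  (forall i, U i i != 0) -> (forall i, 2 * L / m%:R <= `|U i i|) ->
  forall b, box U b `<=` Omega d L ->
  \prod_i `|U i i| <= gsum L m (\1_(box U b)) :> R.
Proof.
move=> m0.
have dl0 : 0 < 2 * L / m%:R by rewrite divr_gt0 ?mulr_gt0 ?ltr0n.
elim: d U => [|d IH] U Ut U0 Um b bO.
  rewrite /= big_ord0 indicE mem_set //; exists 0 => [[]//|].
  by apply/rowP => -[].
rewrite /= big_ord_recl.
pose s j := (grid_pt L m j - b ord0 ord0) / U ord0 ord0.
have U0' i : (row' ord0 (col' ord0 U)) i i != 0 by rewrite !mxE.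
have Ut' (i j : 'I_d) : (j < i)%N -> (row' ord0 (col' ord0 U)) i j = 0.
  by rewrite !mxE => ji; apply: Ut.
have Um' i : 2 * L / m%:R <= `|(row' ord0 (col' ord0 U)) i i| by rewrite !mxE.
have {}IH := IH _ Ut' U0' Um'.
set Pi := \prod_(i < d) _.
have PiE : \prod_i (`|row' ord0 (col' ord0 U) i i|) = Pi.
  by apply: eq_bigr => i _; rewrite !mxE.
have Pi0 : 0 <= Pi by apply: prodr_ge0.
have Uc i : U (lift ord0 i) ord0 = 0 by apply: Ut.
apply: (@le_trans _ _ ((2 * L / m%:R) * \sum_(j < m) ((`|s j| <= 1)%R%:R * Pi))); last first.
  apply: ler_wpM2l; first exact: ltW.
  apply: ler_sum => j _.
  case: (boolP (`|s j| <= 1)) => sj; last first.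
    by rewrite mul0r; apply: gsum_ge0 => // y; rewrite indicE.
  rewrite mul1r -PiE.
  have hb y : box (row' ord0 (col' ord0 U)) (vtail b + s j *: vtail (row ord0 U)) y ->
    box U b (vcons (grid_pt L m j) y).
    by move=> h; apply/vcons_box.
  apply: le_trans (IH (vtail b + s j *: vtail (row ord0 U)) _) _.
    by move=> y /hb /bO h i; have := h (lift ord0 i); rewrite vconsS.
  apply: gsum_le => // y _; rewrite !indicE.
  by case: (boolP (_ \in _)) => // /set_mem /hb h; rewrite mem_set.
rewrite -mulr_suml mulrA; apply: ler_wpM2r => //.
under eq_bigr => j _ do rewrite /s slab //.
have dm := Um ord0.
(* The centre plus or minus the first row of [U] lies in the box, hence in [Omega]; so the whole
   slab lies in [-L, L] and no integer to be counted falls outside the range of j. *)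
have bnd (e : R) : `|e| = 1 -> - L <= b ord0 ord0 + e * U ord0 ord0 <= L.
  move=> e1; have : box U b (b + (e *: delta_mx ord0 ord0) *m U).
    exists (e *: delta_mx ord0 ord0) => // i; rewrite !mxE /= normrM e1 mul1r.
    by case: eqP => _; rewrite ?normr1 ?normr0.
  move=> /bO /(_ ord0); rewrite mxE -scalemxAl -rowE !mxE //.
have : - L <= b ord0 ord0 - `|U ord0 ord0| /\ b ord0 ord0 + `|U ord0 ord0| <= L.
  have := bnd 1 (normr1 _); have := bnd (-1); rewrite normrN1 => /(_ erefl).
  by move=> /andP[h1 h2] /andP[h3 h4]; case: (ger0P (U ord0 ord0)) => _; lra.
move: (U0 ord0) dm; rewrite -normr_gt0; set a := `|U ord0 ord0|; set b0 := b ord0 ord0.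
move=> a0 dm [h1 h2].
apply: le_trans (ler_wpM2l (ltW dl0) (count_ge _ _)).
- rewrite -mulrBl mulrBr mulr1 mulrCA divff ?gt_eqF // mulr1; lra.
- by rewrite divr_ge0 ?(ltW dl0) //; lra.
- rewrite ler_pdivrMr // mulrCA divff ?mulr1; first by lra.
  by rewrite pnatr_eq0 -lt0n.
Qed.

End Count.

Lemma grid_step_small (R : realType) (L e : R) : 0 < L -> 0 < e ->
  \forall m \near \oo, (0 < m)%N /\ 2 * L / m%:R <= e.
Proof.
move=> L0 e0; exists (Num.bound (2 * L / e)).+1 => // m /= hm.
have m0 : (0 < m)%N by exact: leq_trans hm.
split => //; rewrite ler_pdivrMr ?ltr0n // [e * _]mulrC -ler_pdivrMr //.
have h0 : 0 <= 2 * L / e by rewrite divr_ge0 ?mulr_ge0 // ltW.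
apply: ltW; apply: lt_le_trans (archi_boundP h0) _.
by rewrite ler_nat ltnW.
Qed.

(** With A = B U, the entries of B and of its inverse being bounded by K, the box of A lies between
    the boxes of U / K1 and K1 U, which are triangular and can be counted by slices. The constants
    are the resulting factors K1 per dimension; only the required fineness of the grid depends on
    A. *)
Lemma box_count (R : realType) (d : nat) : exists c C : R, [/\ 0 < c, 0 < C &
  forall (L : R) (A : 'M[R]_d), 0 < L -> A \in unitmx ->
  \forall m \near \oo, forall b,
     gsum L m (\1_(box A b)) <= C * `|\det A| /\
     (box A b `<=` Omega d L -> c * `|\det A| <= gsum L m (\1_(box A b)))].
Proof.
have [K K0 HK] := pivoted_lu R d.
pose K1 := d%:R * K + 1.
have dK0 : 0 <= d%:R * K by rewrite mulr_ge0 // ltW.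
have K10 : 0 < K1 by rewrite /K1; lra.
have K11 : 1 <= K1 by rewrite /K1; lra.
have bnd (s : 'rV[R]_d) (B : 'M[R]_d) :
    (forall i, `|s ord0 i| <= 1) -> (forall i j, `|B i j| <= K) ->
    forall j, `|(K1^-1 *: (s *m B)) ord0 j| <= 1.
  move=> s1 BK j; rewrite mxE normrM normfV (gtr0_norm K10) ler_pdivrMl // mulr1.
  apply: (@le_trans _ _ (d%:R * K)); last by rewrite /K1; lra.
  rewrite mxE; apply: le_trans (ler_norm_sum _ _ _) _.
  apply: (@le_trans _ _ (\sum_(k < d) K)); last first.
    by rewrite sumr_const card_ord mulr_natl.
  by apply: ler_sum => k _; rewrite normrM -[leRHS]mul1r; apply: ler_pM.
exists (K1^-1 ^+ d), ((3 * K1) ^+ d); split.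
- by rewrite exprn_gt0 // invr_gt0.
- by rewrite exprn_gt0 // mulr_gt0.
move=> L A L0 uA.
have [B [B' [U [AB UB bB Ut dU]]]] := HK A uA.
have detU : \det U = \prod_i U i i.
  rewrite -det_tr det_trig; first by apply: eq_bigr => i _; rewrite mxE.
  by apply/is_trig_mxP => i j ij; rewrite mxE Ut.
have detU0 : \det U != 0.
  by rewrite -normr_eq0 -dU normr_eq0 -unitfE -unitmxE.
have U0 i : U i i != 0.
  by apply: contraNneq detU0 => h; rewrite detU (bigD1 i) //= h mul0r.
have : \forall m \near \oo, forall i, (0 < m)%N /\ 2 * L / m%:R <= K1^-1 * `|U i i|.
  apply: filter_forall => i.
  by apply: grid_step_small => //; rewrite mulr_gt0 ?invr_gt0 ?normr_gt0.
have := grid_step_small L0 (@ltr01 R).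
apply: filterS2 => m [m0 _] Hm b; have {}Hm i := (Hm i).2.
have prodE (a : R) : 0 < a -> \prod_i `|(a *: U) i i| = a ^+ d * `|\det A|.
  move=> a0; rewrite dU detU normr_prod -[X in _ ^+ X]card_ord -prodr_const -big_split /=.
  by apply: eq_bigr => i _; rewrite mxE normrM gtr0_norm.
have sU0 (a : R) i : 0 < a -> (a *: U) i i != 0.
  by move=> a0; rewrite mxE mulf_neq0 // gt_eqF.
split.
  apply: (@le_trans _ _ (gsum L m (\1_(box (K1 *: U) b)))).
    apply: gsum_le => // z _; rewrite !indicE.
    case: (boolP (_ \in _)) => // /set_mem[s s1 ->]; rewrite mem_set //.
    exists (K1^-1 *: (s *m B)) => [|]; first by apply: bnd => // i j; exact: (bB i j).1.
    by rewrite -scalemxAl -scalemxAr scalerA mulVf ?gt_eqF // scale1r -mulmxA -AB.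
  apply: le_trans (gsum_box_le L0 m0 _ _ _ b) _.
  - by move=> i j ji; rewrite mxE Ut ?mulr0.
  - by move=> i; exact: sU0.
  - move=> i; apply: le_trans (Hm i) _.
    rewrite mxE normrM gtr0_norm //; apply: ler_wpM2r => //.
    by apply: (le_trans _ K11); rewrite invf_le1.
  rewrite big_split /= prodr_const card_ord prodE //.
  by rewrite exprMn mulrA.
move=> bO; rewrite -prodE ?invr_gt0 //.
have sub : box (K1^-1 *: U) b `<=` box A b.
  move=> z [s s1 ->]; exists (K1^-1 *: (s *m B')).
    by apply: bnd => // i j; exact: (bB i j).2.
  by rewrite -scalemxAl -scalemxAr -mulmxA -UB.
apply: le_trans (gsum_box_ge L0 m0 _ _ _ (subset_trans sub bO)) _.
- by move=> i j ji; rewrite mxE Ut ?mulr0.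
- by move=> i; apply: sU0; rewrite invr_gt0.
- by move=> i; rewrite mxE normrM gtr0_norm ?invr_gt0.
apply: gsum_le => // z _; rewrite !indicE.
by case: (boolP (_ \in _)) => // /set_mem/sub h; rewrite mem_set.
Qed.

(** This spares subdividing a segment at cell boundaries. Finitely many closed pieces that miss t
    stay away from t, so near t only the pieces containing t matter, and the bound holds between t
    and its neighbours. The supremum of the points reached from 0 with the bound is then [dl]. *)
Lemma lipschitz_closed_cover (R : realType) (I : finType) (F : I -> set R)
    (g : R -> R) (B dl : R) : 0 <= dl ->
  (forall c, closed (F c)) ->
  (forall t, 0 <= t <= dl -> exists c, F c t) ->
  (forall c s t, 0 <= s <= dl -> 0 <= t <= dl -> F c s -> F c t ->
     `|g s - g t| <= B * `|s - t|) ->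
  `|g dl - g 0| <= B * dl.
Proof.
move=> dl0 Fcl Fcov glip.
have loc t : 0 <= t <= dl -> exists2 e : R, 0 < e &
    forall s, 0 <= s <= dl -> `|s - t| < e -> `|g s - g t| <= B * `|s - t|.
  move=> tI.
  have : \forall s \near t, forall c, F c s -> F c t.
    apply: (@filter_forall _ I (fun c s => F c s -> F c t) (nbhs t)) => c.
    have [Ft|nFt] := pselect (F c t).
      exact: nearW.
    have : nbhs t (~` F c).
      by have := closed_openC (Fcl c); rewrite openE => /(_ _ nFt).
    by apply: filterS => s nFs /nFs.
  move=> /nbhs_ballP[e /= e0 he]; exists e => // s sI st.
  have [c Fs] := Fcov s sI; apply: (glip c) => //.
  by apply: (he s) => //; rewrite /ball /= distrC.
pose S := [set t | 0 <= t <= dl /\ `|g t - g 0| <= B * t].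
have S0 : S 0 by rewrite /S /= lexx dl0 subrr normr0 mulr0.
have hs : has_sup S.
  by split; [exists 0 | exists dl => t [/andP[]]].
have step s t : S s -> 0 <= t <= dl -> s <= t -> `|g t - g s| <= B * `|t - s| -> S t.
  move=> [_ hs0] tI st h; split => //.
  have -> : g t - g 0 = (g t - g s) + (g s - g 0) by ring.
  apply: le_trans (ler_normD _ _) _; apply: le_trans (lerD h hs0) _.
  by rewrite ger0_norm ?subr_ge0 // -mulrDr subrK.
pose ts := sup S.
have tsI : 0 <= ts <= dl.
  apply/andP; split; first by apply: ub_le_sup => //; exact: hs.2.
  by apply: ge_sup; [exists 0 | move=> t [/andP[]]].
have [e e0 he] := loc ts tsI.
have tsS : S ts.
  have [s Ss ls] := sup_adherent e0 hs.
  have sts : s <= ts by apply: ub_le_sup => //; exact: hs.2.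
  apply: (step s) => //; rewrite distrC [X in _ * X]distrC; apply: he; first exact: Ss.1.
  by rewrite distrC ger0_norm ?subr_ge0 //; move: ls; rewrite -/ts; lra.
have [ltdl|] := ltP ts dl; last first.
  by move=> h; have -> : dl = ts; [apply: le_anti; rewrite h; case/andP: tsI | exact: tsS.2].
pose t := Num.min dl (ts + e / 2).
have tst : ts < t by rewrite lt_min ltdl /=; lra.
have tI : 0 <= t <= dl.
  rewrite ge_min lexx andbT le_min dl0 /=; case/andP: tsI => h _; lra.
have St : S t.
  apply: (step ts) => //; first exact: ltW.
  apply: he => //; rewrite gtr0_norm ?subr_gt0 //.
  have : t <= ts + e / 2 by rewrite ge_min lexx orbT.
  lra.
have : t <= ts by apply: ub_le_sup => //; exact: hs.2.
by rewrite leNgt tst.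

Qed.

(** * Multivariate polynomials *)

Lemma mpoly_ring_ind (R : realType) (d : nat) (P : mpoly d R -> Prop) :
  (forall c, P (mpolyC d c)) ->
  (forall i, P (mpolyX R (mnm1 i))) ->
  (forall p q, P p -> P q -> P (p + q)) ->
  (forall p q, P p -> P q -> P (p * q)) ->
  forall p, P p.
Proof.
move=> PC PX PD PM; elim/mpolyind => [|c m p _ _ Pp].
  by rewrite -(mpolyC0 d R); exact: PC.
apply: PD => //; rewrite -mul_mpolyC; apply: (PM _ _); first exact: PC.
rewrite mpolyXE_id; apply: big_ind => [||i _].
- exact: PC.
- exact: PM.
- elim: (m i) => [|n IH]; first exact: PC.
  by rewrite exprS; apply: (PM _ _).
Qed.

Section Peval.
Variables (R : realType) (d : nat).
Implicit Types (p q : mpoly d R) (x y : 'rV[R]_d).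

Lemma pevalD p q x : peval (p + q) x = peval p x + peval q x.
Proof. exact: mevalD. Qed.

Lemma pevalM p q x : peval (p * q) x = peval p x * peval q x.
Proof. exact: mevalM. Qed.

Lemma pevalC c x : peval (mpolyC d c) x = c.
Proof. exact: mevalC. Qed.

Lemma pevalX i x : peval (mpolyX R (mnm1 i)) x = x ord0 i.
Proof. exact: mevalXU. Qed.

Lemma pevalZ c p x : peval (c *: p) x = c * peval p x.
Proof. exact: mevalZ. Qed.

Lemma peval_sum (I : Type) (r : seq I) (F : I -> mpoly d R) x :
  peval (\sum_(i <- r) F i) x = \sum_(i <- r) peval (F i) x.
Proof. exact: raddf_sum. Qed.

(** Restriction to a coordinate line gives a univariate polynomial, to which [poly_mvt] applies. *)
Lemma peval_line p (x : 'rV[R]_d) (i : 'I_d) : exists Q : {poly R},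
  forall t, Q.[t] = peval p (x + t *: delta_mx ord0 i) /\
            Q^`().[t] = peval (mderiv i p) (x + t *: delta_mx ord0 i).
Proof.
elim/mpoly_ring_ind: p => [c|j|p q [P hP] [Q hQ]|p q [P hP] [Q hQ]].
- exists c%:P => t; rewrite derivC hornerC horner0 mderivC.
  by rewrite -(mpolyC0 d R) !pevalC.
- exists ((x ord0 j)%:P + (j == i)%:R *: 'X) => t.
  rewrite derivD derivC add0r derivZ derivX hornerD hornerC !hornerZ hornerX hornerC.
  rewrite pevalX !mxE eqxx /= [_ * t]mulrC; split => //.
  rewrite mderivX pevalZ mnm1E mulr1.
  case: (eqVneq j i) => [->|_]; last by rewrite !mul0r.
  rewrite (_ : mnm_sub (mnm1 i) (mnm1 i) = mnm0); last by apply/mnmP => k; rewrite !mnmE subnn.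
  by rewrite mpolyX0 -(mpolyC1 d R) pevalC mulr1.
- exists (P + Q) => t; rewrite derivD !hornerD mderivD !pevalD.
  by have [-> ->] := hP t; have [-> ->] := hQ t.
- exists (P * Q) => t; rewrite derivM hornerD !hornerM mderivM pevalD !pevalM.
  by have [-> ->] := hP t; have [-> ->] := hQ t.
Qed.

Lemma peval_mvt p (x : 'rV[R]_d) (i : 'I_d) (s t B : R) : s <= t ->
  (forall r, s <= r <= t ->
     `|peval (mderiv i p) (x + r *: delta_mx ord0 i)| <= B) ->
  `|peval p (x + t *: delta_mx ord0 i) - peval p (x + s *: delta_mx ord0 i)|
    <= B * (t - s).
Proof.
rewrite le_eqVlt => /orP[/eqP ->|st] hB.
  by rewrite !subrr normr0 mulr0.
have [Q hQ] := peval_line p x i.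
rewrite -!(proj1 (hQ _)).
have [c cI ->] := poly_mvt Q st.
rewrite normrM (hQ c).2 (gtr0_norm (x := t - s)) ?subr_gt0 //.
apply: ler_wpM2r; first by rewrite subr_ge0 ltW.
by apply: hB; move: cI; rewrite in_itv /= => /andP[/ltW -> /ltW ->].
Qed.

End Peval.

Section MonomialSpace.
Variables (R : realType) (d : nat).

(** [Qk] and [Pk] are both instances by conversion, so the closure properties are proved once. *)
Definition monomial_space (D : multinom d -> Prop) : set (mpoly d R) :=
  [set p | forall m, m \in msupp p -> D m].

Lemma monomial_spaceD D p q :
  monomial_space D p -> monomial_space D q -> monomial_space D (p + q).
Proof.
by move=> hp hq m /msuppD_le; rewrite mem_cat => /orP[/hp|/hq].
Qed.

Lemma monomial_spaceZ D c p : monomial_space D p -> monomial_space D (c *: p).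
Proof. by move=> hp m /msuppZ_le /hp. Qed.

Lemma monomial_space_sum D (I : Type) (r : seq I) (F : I -> mpoly d R) :
  (forall i, monomial_space D (F i)) -> monomial_space D (\sum_(i <- r) F i).
Proof.
move=> hF; elim: r => [|i r IH]; first by rewrite big_nil => m; rewrite msupp0.
by rewrite big_cons; apply: monomial_spaceD.
Qed.

Lemma monomial_space_mderiv D i p :
  (forall m : multinom d, D (mnm_add m (mnm1 i)) -> D m) ->
  monomial_space D p -> monomial_space D (mderiv i p).
Proof.
move=> hD hp m; rewrite mcoeff_msupp mcoeff_deriv => h; apply: hD; apply: hp.
by rewrite mcoeff_msupp; apply: contraNneq h => ->; rewrite mul0rn.
Qed.

End MonomialSpace.

Section PkSpace.
Variables (R : realType) (d : nat).

Lemma Pk_mul a b (p q : mpoly d R) : Pk a p -> Pk b q -> Pk (a + b) (p * q).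
Proof.
move=> hp hq m /msuppM_le /allpairsP[[m1 m2] /= [h1 h2 ->]].
by rewrite mdegD leq_add // ?hp ?hq.
Qed.

Lemma PkC (c : R) : Pk 0 (mpolyC d c).
Proof.
move=> m; rewrite msuppC; case: ifP => // _; rewrite mem_seq1 => /eqP ->.
by rewrite mdeg0.
Qed.

Lemma Pk_exp a n (p : mpoly d R) : Pk a p -> Pk (a * n) (p ^+ n).
Proof.
move=> hp; elim: n => [|n IH]; first by rewrite muln0; exact: PkC.
by rewrite exprS mulnS; exact: Pk_mul.
Qed.

(** Substitution turns a monomial into a product of as many affine forms as its total degree. *)
Lemma Pk_affine k (p : mpoly d R) (o : 'rV[R]_d) (A : 'M[R]_d) : Pk k p ->
  exists2 p' : mpoly d R, Pk k p' & forall y, peval p' y = peval p (o + y *m A).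
Proof.
move=> hp.
pose lq := [tuple (mpolyC d (o ord0 i) + \sum_(j < d) A j i *: mpolyX R (mnm1 j)) | i < d].
have lq1 i : Pk 1 (tnth lq i).
  rewrite tnth_mktuple; apply: monomial_spaceD.
    by move=> m /PkC; rewrite leqn0 => /eqP ->.
  apply: monomial_space_sum => j; apply: monomial_spaceZ => m.
  by rewrite msuppX mem_seq1 => /eqP ->; rewrite mdeg1.
exists (comp_mpoly lq p).
  rewrite comp_mpolyE; have : all (fun m => mdeg m <= k)%N (msupp p) by apply/allP.
  elim: (msupp p) => [_|m s IH /= /andP[mk /IH {}IH]].
    by rewrite big_nil => m; rewrite msupp0.
  rewrite big_cons; apply: monomial_spaceD => //; apply: monomial_spaceZ.
  suff h : Pk (mdeg m) (\prod_(i < d) tnth lq i ^+ m i).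
    by move=> m' /h /leq_trans; apply.
  rewrite mdegE; apply: (big_ind2 (fun n q => Pk n q)).
  - exact: PkC.
  - by move=> *; exact: Pk_mul.
  - by move=> i _; rewrite -[X in Pk X _]mul1n; apply: Pk_exp.
move=> y; rewrite /peval comp_mpoly_meval; apply: meval_eq => i.
rewrite tnth_mktuple !mxE mevalD mevalC raddf_sum; congr (_ + _).
by apply: eq_bigr => j _; rewrite /= mevalZ mevalXU mulrC.
Qed.

End PkSpace.

(** * The Sobolev inequality on affine meshes *)

(* [adm] restricts the linear parts of the cell maps: [Pk] is invariant under all
   affine maps, [Qk] only under scalings (and translations).  The [l q] are the
   Lagrange functions of the nodes, and [core] is the interior of the reference
   domain, whose images in distinct cells are disjoint. *)
Record affine_element (R : realType) (d : nat) (K : ref_element R d)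
    (adm : 'M[R]_d -> Prop) (core : set 'rV[R]_d)
    (l : quad_index K -> 'rV[R]_d -> R) (Lam rho : R) (b0 : 'rV[R]_d) : Prop :=
  AffineElement {
    ae_weight : forall q : quad_index K, 0 < ref_weight q;
    ae_node : forall q : quad_index K, ref_domain K (ref_node q);
    ae_bounded : forall y, ref_domain K y -> forall i, `|y ord0 i| <= 1;
    ae_closed : forall y v : 'rV[R]_d, closed [set t : R | ref_domain K (y + t *: v)];
    ae_convex : forall x y e, ref_domain K x -> ref_domain K y -> 0 <= e <= 1 ->
      ref_domain K ((1 - e) *: x + e *: y);
    ae_core : core `<=` ref_domain K;
    ae_core_convex : forall x y e, ref_domain K x -> core y -> 0 < e <= 1 ->
      core ((1 - e) *: x + e *: y);
    ae_rho : 0 < rho;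
    ae_core_cube : forall s : 'rV[R]_d, (forall i, `|s ord0 i| <= 1) ->
      core (b0 + rho *: s);
    ae_Lam : 0 < Lam;
    ae_l_bound : forall q (y : 'rV[R]_d), (forall i, `|y ord0 i| <= 1) -> `|l q y| <= Lam;
    ae_l_lipschitz : forall q (x y : 'rV[R]_d) e, 0 <= e -> (forall i, `|x ord0 i| <= 1) ->
      (forall i, `|y ord0 i| <= 1) -> (forall i, `|x ord0 i - y ord0 i| <= e) ->
      `|l q x - l q y| <= Lam * e;
    ae_mderiv : forall i p, local_space K p -> local_space K (mderiv i p);
    ae_interp : forall p (o : 'rV[R]_d) A y, local_space K p -> adm A ->
      peval p (o + y *m A) = \sum_q peval p (o + ref_node q *m A) * l q y }.

Record affine_mesh (R : realType) (d : nat) (L : R) (K : ref_element R d)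
    (adm : 'M[R]_d -> Prop) (core : set 'rV[R]_d) (T : mesh R d) : Prop :=
  AffineMesh {
    am_unit : forall c : mesh_cell T, mesh_linear c \in unitmx;
    am_adm : forall c : mesh_cell T, adm (mesh_linear c);
    am_cover : forall x, Omega d L x -> exists c : mesh_cell T, cell_set K c x;
    am_sub : forall (c : mesh_cell T) x, cell_set K c x -> Omega d L x;
    am_disjoint : forall (c c' : mesh_cell T) x y, core x -> core y ->
      cell_map c x = cell_map c' y -> c = c' }.

Section ElementSobolev.
Variables (R : realType) (d : nat) (L : R) (K : ref_element R d).
Variables (adm : 'M[R]_d -> Prop) (core : set 'rV[R]_d).
Variables (l : quad_index K -> 'rV[R]_d -> R) (Lam rho : R) (b0 : 'rV[R]_d).
Hypothesis L0 : 0 < L.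
Hypothesis AE : affine_element adm core l Lam rho b0.

Let nq : R := #|quad_index K|%:R.
(** The shrinking factor of the copies in [subcell]. Their points are within 2 eps of a node, so the
    Lagrange functions, [nq] in number and with Lipschitz constant [Lam], change the value by at
    most half of the largest nodal value ([epsP]). *)
Let eps : R := (4 * nq * Lam + 4)^-1.

Let nq0 : 0 <= nq. Proof. exact: ler0n. Qed.
Let Lam0 : 0 < Lam := ae_Lam AE.
Let rho0 : 0 < rho := ae_rho AE.

Let eps_denom : 4 <= 4 * nq * Lam + 4.
Proof. by rewrite lerDr mulr_ge0 ?mulr_ge0 // ltW. Qed.

Let eps0 : 0 < eps.
Proof. by rewrite invr_gt0; move: eps_denom; lra. Qed.

Let eps1 : eps <= 1.
Proof. by rewrite invf_le1; move: eps_denom; lra. Qed.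

Let epsP : nq * Lam * (2 * eps) <= 2^-1.
Proof.
rewrite /eps mulrA ler_pdivrMr; move: eps_denom; lra.
Qed.

Section Mesh.
Variables (T : mesh R d).
Hypothesis AM : affine_mesh L K adm core T.
Variables (P : mesh_cell T -> mpoly d R) (u : 'rV[R]_d -> R).
Hypothesis PK : forall c, local_space K (P c).
Hypothesis uP : forall c x, cell_set K c x -> u x = peval (P c) x.

Implicit Types (c : mesh_cell T) (q : quad_index K).

Let nval c q := peval (P c) (node c q).

Definition max_nodal c : R := \big[Num.max/0]_q `|nval c q|.

Lemma max_nodal_ge c q : `|nval c q| <= max_nodal c.
Proof. by rewrite /max_nodal (bigD1 q) //= le_max lexx. Qed.

Lemma max_nodal_ge0 c : 0 <= max_nodal c.
Proof.
by rewrite /max_nodal; elim/big_ind: _ => // x y x0 y0; rewrite le_max x0.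
Qed.

Lemma max_nodal_attained c (q0 : quad_index K) :
  exists q, max_nodal c = `|nval c q|.
Proof.
exists [arg max_(q > q0) `|nval c q|]%O; case: arg_maxP => // q1 _ q1max.
apply: le_anti; rewrite max_nodal_ge andbT /max_nodal.
by elim/big_ind: _ => // x y x0 y0; rewrite ge_max x0.
Qed.

(* A copy of a cube of the core, shrunk towards the node [q]: copies in distinct
   cells are disjoint, and the function varies there by at most half of its
   largest nodal value. *)
Definition subcell c q : set 'rV[R]_d :=
  box ((eps * rho) *: mesh_linear c)
      (cell_map c ((1 - eps) *: ref_node q + eps *: b0)).

Lemma subcellP c q z : subcell c q z -> exists2 y, core y &
  z = cell_map c y /\ forall i, `|y ord0 i - ref_node q ord0 i| <= 2 * eps.
Proof.
move=> [s s1 ->].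
have cy : core (b0 + rho *: s) by exact: (ae_core_cube AE).
exists ((1 - eps) *: ref_node q + eps *: (b0 + rho *: s)).
  by apply: (ae_core_convex AE) => //; [exact: (ae_node AE) | rewrite eps0 eps1].
split.
  rewrite /cell_map -addrA; congr (_ + _).
  by rewrite -scalemxAr scalemxAl -mulmxDl -addrA scalerDr scalerA.
move=> i; rewrite !mxE.
have -> (a b e : R) : (1 - e) * a + e * b - a = e * (b - a) by ring.
rewrite normrM (gtr0_norm eps0) mulrC; apply: ler_wpM2r; first exact: ltW.
have h1 := ae_bounded AE (ae_core AE cy) i.
have h2 := ae_bounded AE (ae_node AE q) i.
by apply: le_trans (ler_normB _ _) _; move: h1; rewrite !mxE => h1; move: h2; lra.
Qed.

Lemma subcell_lower c q z : max_nodal c = `|nval c q| -> subcell c q z ->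
  max_nodal c / 2 <= `|u z|.
Proof.
move=> mq /subcellP[y cy [-> yq]].
have dy := ae_core AE cy.
rewrite (uP (c := c)); last by exists y.
rewrite /cell_map (ae_interp AE) //; last exact: (am_adm AM).
(* The nodal value is itself expanded by interpolation, so that the difference with u(z) involves
   only differences of Lagrange functions. *)
have nE : nval c q = \sum_q' nval c q' * l q' (ref_node q).
  by rewrite /nval /node /cell_map (ae_interp AE) //; exact: (am_adm AM).
set S := \sum_q' _.
have : `|S - nval c q| <= max_nodal c / 2.
  rewrite nE -sumrB; apply: le_trans (ler_norm_sum _ _ _) _.
  apply: (@le_trans _ _ (\sum_(q' : quad_index K) (max_nodal c * (Lam * (2 * eps))))).
    apply: ler_sum => q' _; rewrite -mulrBr normrM; apply: ler_pM => //.
      exact: max_nodal_ge.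
    apply: (ae_l_lipschitz AE) => //; [by rewrite mulr_ge0 // ltW|exact: (ae_bounded AE dy)|].
    exact: (ae_bounded AE (ae_node AE q)).
  rewrite sumr_const -[_ *+ _]mulr_natl -/nq.
  have := ler_wpM2l (max_nodal_ge0 c) epsP; lra.
have := ler_normB S (S - nval c q); rewrite opprB addrC subrK -mq.
rewrite addrC; lra.
Qed.

Lemma nodal_quartic_le (Wt : R) : (forall q : quad_index K, ref_weight q <= Wt) ->
  \sum_c \sum_(q : quad_index K) weight c q * nval c q ^+ 4 <=
  nq * Wt * \sum_c `|\det (mesh_linear c)| * max_nodal c ^+ 4.
Proof.
move=> HW; rewrite mulr_sumr; apply: ler_sum => c _.
apply: (@le_trans _ _ (\sum_(q : quad_index K)
   (Wt * (`|\det (mesh_linear c)| * max_nodal c ^+ 4)))).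
  apply: ler_sum => q _; rewrite /weight [`|_| * _]mulrC -mulrA.
  have -> : nval c q ^+ 4 = `|nval c q| ^+ 4.
    by rewrite -normrX ger0_norm // (exprM _ 2 2) sqr_ge0.
  apply: ler_pM => //; first exact: ltW (ae_weight AE q).
  apply: ler_wpM2l => //; apply: lerXn2r; rewrite ?nnegrE ?max_nodal_ge0 //.
  exact: max_nodal_ge.
by rewrite sumr_const -[_ *+ _]mulr_natl -/nq mulrA.
Qed.

(** One subcell per cell is used, at a node where the nodal value is largest. These subcells are
    disjoint, so at each grid point at most one indicator is 1, and there u^4 is at least (max /
    2)^4, whence the 16. *)
Lemma gsum_quartic_ge (c0 : R) : 0 < c0 ->
  (forall A : 'M[R]_d, A \in unitmx -> \forall m \near \oo, forall b,
     box A b `<=` Omega d L -> c0 * `|\det A| <= gsum L m (\1_(box A b))) ->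
  \forall m \near \oo,
  c0 * (eps * rho) ^+ d / 16 * \sum_c `|\det (mesh_linear c)| * max_nodal c ^+ 4
   <= gsum L m (fun z => u z ^+ 4).
Proof.
move=> c00 Hc0.
have u4 z : u z ^+ 4 = `|u z| ^+ 4.
  by rewrite -normrX ger0_norm // (exprM _ 2 2) sqr_ge0.
(* Without quadrature points there is no maximizing node, but then [max_nodal] is 0 everywhere. *)
case: (pickP (fun q : quad_index K => true)) => [q0 _|noq]; last first.
  apply: nearW => m; rewrite big1 => [|c _]; last first.
    by rewrite /max_nodal big_pred0 // expr0n mulr0.
  rewrite mulr0; apply: gsum_ge0 => // z; rewrite u4; exact: exprn_ge0.
have er0 : 0 < eps * rho by exact: mulr_gt0.
have : \forall m \near \oo, forall c b, box ((eps * rho) *: mesh_linear c) b `<=` Omega d L ->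
   c0 * `|\det ((eps * rho) *: mesh_linear c)|
     <= gsum L m (\1_(box ((eps * rho) *: mesh_linear (m := T) c) b)).
  apply: filter_forall => c; apply: Hc0.
  by rewrite unitmxZ ?unitfE ?gt_eqF //; exact: (am_unit AM).
apply: filterS => m Hm.
have /choice[qs qsE] c := max_nodal_attained c q0.
apply: (@le_trans _ _ (gsum L m (fun z =>
   \sum_c max_nodal c ^+ 4 / 16 * \1_(subcell c (qs c)) z))); last first.
  apply: gsum_le => // z _.
  have [[c zc]|none] := pselect (exists c, subcell c (qs c) z); last first.
    rewrite big1 ?u4 ?exprn_ge0 // => c _.
    by rewrite indicE memNset ?mulr0 // => h; apply: none; exists c.
  rewrite (bigD1 c) //= big1 => [|c' c'c].
    rewrite addr0 indicE mem_set // mulr1 u4.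
    have := subcell_lower (qsE c) zc; have := max_nodal_ge0 c => h1 h2.
    have -> : max_nodal c ^+ 4 / 16 = (max_nodal c / 2) ^+ 4 by field.
    by apply: lerXn2r; rewrite ?nnegrE // divr_ge0.
  rewrite indicE memNset ?mulr0 //.
  have [y cy [zy _]] := subcellP zc; move=> /subcellP[y' cy' [zy' _]].
  move/eqP: c'c; apply; apply: (am_disjoint AM cy' cy); by rewrite -zy'.
rewrite gsum_sum // mulr_sumr; apply: ler_sum => c _.
rewrite gsumZ //.
have sub : subcell c (qs c) `<=` Omega d L.
  by move=> z /subcellP[y /(ae_core AE) dy [-> _]]; apply: (am_sub AM (c := c)); exists y.
have := Hm c _ sub; rewrite -/(subcell c (qs c)) detZ normrM (gtr0_norm (exprn_gt0 _ er0)).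
move=> h; have m0 : 0 <= max_nodal c ^+ 4 / 16.
  by rewrite divr_ge0 // exprn_ge0 // max_nodal_ge0.
apply: le_trans (ler_wpM2l m0 h).
by rewrite le_eqVlt; apply/orP; left; apply/eqP; field.
Qed.

(** The derivative is taken in physical coordinates and lies in the local space, so its nodal values
    interpolate it: this bound holds on the whole cell and is blind to the shape of the cell. *)
Let dbound c i : R := Lam * \sum_(q : quad_index K) `|peval (mderiv i (P c)) (node c q)|.

Lemma dbound_ge c i x : cell_set K c x -> `|peval (mderiv i (P c)) x| <= dbound c i.
Proof.
move=> [y dy <-]; rewrite /cell_map (ae_interp AE);
  [|exact: (ae_mderiv AE)|exact: (am_adm AM)].
apply: le_trans (ler_norm_sum _ _ _) _.
rewrite /dbound mulr_sumr; apply: ler_sum => q _.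
rewrite normrM [leLHS]mulrC; apply: ler_wpM2r => //.
by apply: (ae_l_bound AE); exact: (ae_bounded AE dy).
Qed.

Lemma cell_setE c x : cell_set K c x <->
  ref_domain K ((x - mesh_origin c) *m invmx (mesh_linear c)).
Proof.
have uc := am_unit AM c; split.
  by move=> [y dy <-]; rewrite /cell_map [_ + _ *m _]addrC addrK mulmxK.
by move=> h; exists ((x - mesh_origin c) *m invmx (mesh_linear c)) => //;
  rewrite /cell_map mulmxKV // addrC subrK.
Qed.

(** The segment from z to its neighbour may cross many cells. Each cell it meets has z in its
    doubled parallelepiped, hence contributes its full [dbound] to the sum [S]; so the square root
    of [S] bounds the derivative all along the segment. *)
Lemma fdiff_le (m : nat) (i : 'I_d) (z : 'rV[R]_d) : (0 < m)%N ->
  (forall c : mesh_cell T, forall j,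
    2 * L / m%:R * `|invmx (mesh_linear c) i j| <= 1) ->
  grid L m z ->
  fdiff L m i u z ^+ 2 <=
  \sum_c dbound c i ^+ 2 * \1_(box (2 *: mesh_linear c) (mesh_origin c)) z.
Proof.
move=> m0 Hm gz.
set S := \sum_c _.
have S0 : 0 <= S.
  by apply: sumr_ge0 => c _; rewrite mulr_ge0 ?sqr_ge0 // indicE.
have dl0 : 0 < 2 * L / m%:R by rewrite divr_gt0 ?mulr_gt0 ?ltr0n.
set dl := 2 * L / m%:R in dl0 Hm *.
pose zt t := z + t *: delta_mx ord0 i.
(* A point of the cell has reference coordinates at most 1 in absolute value, and by the fineness of
   the grid going back to z changes them by at most 1; hence the factor 2. *)
have near_cell c t : 0 <= t <= dl -> cell_set K c (zt t) ->
    box (2 *: mesh_linear c) (mesh_origin c) z.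
  move=> /andP[t0 tdl] /cell_setE dy; have uc := am_unit AM c.
  set y := (X in ref_domain K X) in dy.
  pose v := (t *: delta_mx ord0 i : 'rV[R]_d) *m invmx (mesh_linear c).
  exists (2^-1 *: (y - v)).
    move=> j; rewrite mxE normrM gtr0_norm ?invr_gt0 // ler_pdivrMl // mulr1.
    rewrite mxE; apply: le_trans (ler_normD _ _) _.
    have h1 := ae_bounded AE dy j.
    have h2 : `|v ord0 j| <= 1.
      rewrite /v -scalemxAl -rowE !mxE normrM ger0_norm //.
      by apply: le_trans (Hm c j); apply: ler_wpM2r.
    by rewrite [X in _ + `|X|]mxE normrN; move: h1 h2; lra.
  rewrite -scalemxAl -scalemxAr scalerA mulVf // scale1r mulmxBl.
  rewrite /y /v !mulmxKV // /zt [_ + _ - mesh_origin c]addrAC addrK.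
  by rewrite addrCA subrr addr0.
have dbS c : box (2 *: mesh_linear c) (mesh_origin c) z -> dbound c i <= Num.sqrt S.
  move=> zc; apply: le_trans (ler_norm _) _; rewrite -sqrtr_sqr ler_wsqrtr //.
  rewrite /S (bigD1 c) //= indicE mem_set // mulr1 lerDl.
  by apply: sumr_ge0 => c' _; rewrite mulr_ge0 ?sqr_ge0 // indicE.
have ztO t : 0 <= t <= dl -> Omega d L (zt t).
  move=> /andP[t0 tdl] j; rewrite !mxE eqxx /=.
  have [k km ->] := gz j.
  have /andP[h1 _] := grid_pt_bounds L0 (ltnW km).
  have := grid_pt_bounds L0 km; rewrite grid_ptS -/dl => /andP[_ h2].
  case: (j == i); rewrite /= ?mulr1 ?mulr0; apply/andP; split;
    move: h1 h2 t0 tdl dl0; lra.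
have key : `|u (zt dl) - u (zt 0)| <= Num.sqrt S * dl.
  apply: (@lipschitz_closed_cover R (mesh_cell T) (fun c => [set t | cell_set K c (zt t)])
    (fun t => u (zt t))).
  - exact: ltW.
  - move=> c; rewrite (_ : [set t | _] = [set t : R | ref_domain K
      ((z - mesh_origin c) *m invmx (mesh_linear c) +
       t *: (delta_mx ord0 i *m invmx (mesh_linear c)))]).
      exact: (ae_closed AE).
    have zE t : (zt t - mesh_origin c) *m invmx (mesh_linear c) =
      (z - mesh_origin c) *m invmx (mesh_linear c) +
       t *: (delta_mx ord0 i *m invmx (mesh_linear c)).
      by rewrite /zt addrAC mulmxDl scalemxAl.
    by apply/seteqP; split => t /=; rewrite cell_setE zE.
  - by move=> t0 ht0; apply: (am_cover AM); exact: ztO.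
  - move=> c.
    have lip s t : 0 <= s <= dl -> 0 <= t <= dl -> cell_set K c (zt s) ->
       cell_set K c (zt t) -> s <= t -> `|u (zt t) - u (zt s)| <= Num.sqrt S * (t - s).
      move=> sI tI cs ct st; rewrite (uP cs) (uP ct).
      apply: peval_mvt => // r /andP[sr rt].
      have rI : 0 <= r <= dl.
        by case/andP: sI => h1 _; case/andP: tI => _ h2; rewrite (le_trans h1) // (le_trans rt).
      suff cr : cell_set K c (zt r).
        by apply: le_trans (dbound_ge _ cr) (dbS _ (near_cell _ _ rI cr)).
      have [ts|] := ltP s t; last first.
        move=> ts; have -> : r = s; last by [].
        by apply: le_anti; rewrite sr andbT; apply: le_trans ts.
      (* The reference domain is convex, so the segment between two points of a cell stays in it and
         the mean value theorem applies to a single polynomial. *)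
      apply/cell_setE; move/cell_setE: cs => cs; move/cell_setE: ct => ct.
      have ts0 : t - s != 0 by rewrite gt_eqF // subr_gt0.
      pose e := (r - s) / (t - s).
      have eI : 0 <= e <= 1.
        rewrite /e ler_pdivlMr ?ler_pdivrMr ?subr_gt0 // mul0r mul1r.
        by apply/andP; split; move: sr rt; lra.
      have := ae_convex AE cs ct eI.
      rewrite !scalemxAl -mulmxDl; congr (ref_domain K (_ *m _)).
      rewrite /zt; apply/rowP => j; rewrite !mxE /e; field.
      by move: ts0; rewrite -subr_eq0.
    move=> s t sI tI cs ct; case: (leP s t) => st.
      by rewrite distrC [`|s - t|]distrC (ger0_norm (x := t - s)) ?subr_ge0 //; apply: lip.
    by rewrite (gtr0_norm (x := s - t)) ?subr_gt0 //; apply: lip => //; exact: ltW.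
rewrite /fdiff -/dl -(real_normK (num_real _)) normrM normfV (gtr0_norm dl0).
have -> : S = Num.sqrt S ^+ 2 by rewrite sqr_sqrtr.
apply: lerXn2r; rewrite ?nnegrE ?sqrtr_ge0 ?mulr_ge0 ?invr_ge0 ?(ltW dl0) //.
rewrite ler_pdivrMr //; move: key.
by rewrite /zt scale0r addr0.
Qed.

Lemma gsum_fdiff_le (C0 wm : R) : 0 < C0 -> 0 < wm ->
  (forall q : quad_index K, wm <= ref_weight q) ->
  (forall A : 'M[R]_d, A \in unitmx -> \forall m \near \oo, forall b,
     gsum L m (\1_(box A b)) <= C0 * `|\det A|) ->
  \forall m \near \oo,
   \sum_i gsum L m (fun z => fdiff L m i u z ^+ 2) <=
   C0 * 2 ^+ d * (Lam ^+ 2 * nq / wm) *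
   \sum_c \sum_(q : quad_index K) weight c q *
      \sum_i peval (mderiv i (P c)) (node c q) ^+ 2.
Proof.
move=> C00 wm0 Hw HC0.
have H1 : \forall m \near \oo, forall c b,
   gsum L m (\1_(box (2 *: mesh_linear (m := T) c) b))
     <= C0 * `|\det (2 *: mesh_linear c)|.
  apply: filter_forall => c; apply: HC0.
  by rewrite unitmxZ ?unitfE ?pnatr_eq0 //; exact: (am_unit AM).
have H2 : \forall m \near \oo, forall c i j,
    2 * L / m%:R * `|invmx (mesh_linear (m := T) c) i j| <= 1.
  apply: filter_forall => c; apply: filter_forall => i; apply: filter_forall => j.
  set a := `|_|; have a1 : 0 < a + 1 by rewrite ltr_wpDl // normr_ge0.
  have e0 : 0 < (a + 1)^-1 by rewrite invr_gt0.
  apply: filterS (grid_step_small L0 e0) => m [_ h].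
  apply: le_trans (ler_wpM2r (normr_ge0 _) h) _.
  by rewrite ler_pdivrMl // mulr1 lerDl.
have H3 := grid_step_small L0 (@ltr01 R).
near=> m.
have m0 : (0 < m)%N by have : (0 < m)%N /\ 2 * L / m%:R <= 1; [near: m | case].
have h1 : forall c b, gsum L m (\1_(box (2 *: mesh_linear (m := T) c) b))
     <= C0 * `|\det (2 *: mesh_linear c)| by near: m.
have h2 : forall c i j, 2 * L / m%:R * `|invmx (mesh_linear (m := T) c) i j| <= 1 by near: m.
apply: (@le_trans _ _ (\sum_i \sum_c dbound c i ^+ 2 * (C0 * `|\det (2 *: mesh_linear c)|))).
  apply: ler_sum => i _.
  apply: (@le_trans _ _ (gsum L m (fun z =>
    \sum_c dbound c i ^+ 2 * \1_(box (2 *: mesh_linear c) (mesh_origin c)) z))).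
    by apply: gsum_le => // z gz; apply: fdiff_le.
  rewrite gsum_sum //; apply: ler_sum => c _; rewrite gsumZ //.
  by apply: ler_wpM2l; rewrite ?sqr_ge0.
rewrite exchange_big mulr_sumr /=; apply: ler_sum => c _.
rewrite detZ normrM ger0_norm ?exprn_ge0 //.
apply: (@le_trans _ _ (\sum_i (C0 * 2 ^+ d * (Lam ^+ 2 * nq / wm)) *
  \sum_(q : quad_index K) weight c q * peval (mderiv i (P c)) (node c q) ^+ 2)); last first.
  rewrite -mulr_sumr; rewrite le_eqVlt; apply/orP; left; apply/eqP; congr (_ * _).
  by rewrite exchange_big; apply: eq_bigr => q _; rewrite mulr_sumr.
apply: ler_sum => i _.
(* The squared sum of nodal derivatives in [dbound] becomes [nq] times the sum of squares, which the
   lower bound [wm] on the weights compares with the quadrature. *)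
have CS := cauchy_schwarz_sum (fun=> 1)
   (fun q : quad_index K => `|peval (mderiv i (P c)) (node c q)|).
rewrite (eq_bigr (fun q : quad_index K => `|peval (mderiv i (P c)) (node c q)|)) in CS;
  last by move=> q _; rewrite mul1r.
rewrite [X in _ <= X * _](eq_bigr (fun=> 1)) in CS; last by move=> q _; rewrite expr1n.
rewrite sumr_const -/nq in CS.
rewrite /dbound exprMn.
have W : wm * (\sum_(q : quad_index K) `|peval (mderiv i (P c)) (node c q)| ^+ 2) *
   `|\det (mesh_linear c)| <=
  \sum_(q : quad_index K) weight c q * peval (mderiv i (P c)) (node c q) ^+ 2.
  rewrite mulr_sumr mulr_suml; apply: ler_sum => q _.
  rewrite real_normK ?num_real // /weight mulrAC; apply: ler_wpM2r; first exact: sqr_ge0.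
  by rewrite mulrC; apply: ler_wpM2l.
set N2 := \sum_q `|_| ^+ 2 in CS W.
set D := `|\det _| in W *; set Q := \sum_q weight _ _ * _ in W *.
set N1 := (\sum_q `|_|) ^+ 2 in CS *.
have LC0 : 0 <= Lam ^+ 2 * (C0 * 2 ^+ d).
  by rewrite mulr_ge0 ?sqr_ge0 // mulr_ge0 ?exprn_ge0 // ltW.
have D0 : 0 <= D by exact: normr_ge0.
apply: (@le_trans _ _ (Lam ^+ 2 * (C0 * 2 ^+ d) * (nq * N2 * D))).
  have -> : Lam ^+ 2 * N1 * (C0 * (2 ^+ d * D)) = Lam ^+ 2 * (C0 * 2 ^+ d) * (N1 * D) by ring.
  by apply: ler_wpM2l => //; apply: ler_wpM2r.
have -> : C0 * 2 ^+ d * (Lam ^+ 2 * nq / wm) * Q = Lam ^+ 2 * (C0 * 2 ^+ d) * (nq * (Q / wm)).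
  by field; rewrite gt_eqF.
apply: ler_wpM2l => //; rewrite -mulrA; apply: ler_wpM2l => //.
by rewrite ler_pdivlMr // mulrC mulrA.
Unshelve. all: by end_near.
Qed.

End Mesh.

Theorem element_sobolev : (1 <= d <= 3)%N -> exists2 C : R, 0 <= C &
  forall T : mesh R d, affine_mesh L K adm core T ->
  forall (P : mesh_cell T -> mpoly d R) (u : 'rV[R]_d -> R),
  (forall c, local_space K (P c)) ->
  (forall c x, cell_set K c x -> u x = peval (P c) x) ->
  (forall z : 'rV[R]_d, (exists i, z ord0 i = - L \/ z ord0 i = L) -> u z = 0) ->
  \sum_c \sum_(q : quad_index K) weight c q * peval (P c) (node c q) ^+ 4 <=
  C * (\sum_c \sum_(q : quad_index K) weight c q *
         \sum_i peval (mderiv i (P c)) (node c q) ^+ 2) ^+ 2.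
Proof.
move=> hd.
have [c0 [C0 [c00 C00 Hcount]]] := box_count R d.
pose Wt := \sum_(q : quad_index K) ref_weight q.
have HW (q : quad_index K) : ref_weight q <= Wt.
  rewrite /Wt (bigD1 q) //= lerDl; apply: sumr_ge0 => q' _.
  exact: ltW (ae_weight AE _).
have Wt0 : 0 <= Wt by apply: sumr_ge0 => q _; exact: ltW (ae_weight AE _).
(* The default 1 keeps the minimum positive even over an empty family. *)
pose wm := \big[Num.min/1]_(q : quad_index K) ref_weight q.
have wm0 : 0 < wm.
  rewrite /wm; elim/big_ind: _ => // [x y x0 y0|q _]; first by rewrite lt_min x0.
  exact: (ae_weight AE).
have Hw (q : quad_index K) : wm <= ref_weight q.
  by rewrite /wm (bigD1 q) //= ge_min lexx.
pose Ca := c0 * (eps * rho) ^+ d / 16.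
have Ca0 : 0 < Ca by rewrite divr_gt0 // mulr_gt0 // exprn_gt0 // mulr_gt0.
pose Cs := 8 * (L + L ^+ 2 + L ^+ 3).
have Cs0 : 0 <= Cs.
  by rewrite mulr_ge0 // !addr_ge0 ?exprn_ge0 // ltW.
pose Cb := C0 * 2 ^+ d * (Lam ^+ 2 * nq / wm).
have Cb0 : 0 <= Cb.
  rewrite mulr_ge0 // ?mulr_ge0 ?exprn_ge0 ?invr_ge0 // ltW //.
exists (nq * Wt * (Ca^-1 * (Cs * Cb ^+ 2))).
  have Ca0' := ltW Ca0.
  apply: mulr_ge0; [exact: mulr_ge0 | apply: mulr_ge0].
    by rewrite invr_ge0.
  by apply: mulr_ge0 => //; exact: sqr_ge0.
move=> T AM P u PK uP u0.
have Hlow (A : 'M[R]_d) : A \in unitmx -> \forall m \near \oo, forall b,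
     box A b `<=` Omega d L -> c0 * `|\det A| <= gsum L m (\1_(box A b)).
  by move=> uA; apply: filterS (Hcount L A L0 uA) => m h b; exact: (h b).2.
have Hup (A : 'M[R]_d) : A \in unitmx -> \forall m \near \oo, forall b,
     gsum L m (\1_(box A b)) <= C0 * `|\det A|.
  by move=> uA; apply: filterS (Hcount L A L0 uA) => m h b; exact: (h b).1.
have H1 := gsum_quartic_ge AM PK uP c00 Hlow.
have H2 := gsum_fdiff_le AM PK uP C00 wm0 Hw Hup.
have H3 := grid_step_small L0 (@ltr01 R).
(* One grid is fixed here, fine enough for this mesh and this function. It links the two quadrature
   sums and leaves no trace in the constant. *)
have [m [m0 h1 h2]] : exists m, [/\ (0 < m)%N,
   Ca * \sum_c `|\det (mesh_linear c)| * max_nodal P c ^+ 4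
     <= gsum L m (fun z => u z ^+ 4) &
   \sum_i gsum L m (fun z => fdiff L m i u z ^+ 2) <=
   Cb * \sum_c \sum_(q : quad_index K) weight c q *
      \sum_i peval (mderiv i (P c)) (node c q) ^+ 2].
  have : \forall m \near \oo, [/\ (0 < m)%N,
   Ca * \sum_c `|\det (mesh_linear c)| * max_nodal P c ^+ 4
     <= gsum L m (fun z => u z ^+ 4) &
   \sum_i gsum L m (fun z => fdiff L m i u z ^+ 2) <=
   Cb * \sum_c \sum_(q : quad_index K) weight c q *
      \sum_i peval (mderiv i (P c)) (node c q) ^+ 2].
    by near=> m; split; [suff [] : (0 < m)%N /\ 2 * L / m%:R <= 1 by []; near: m
      | near: m | near: m].
  by move=> /filter_ex.
have h3 := gsum_sobolev L0 hd m0 u0.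
apply: le_trans (nodal_quartic_le _ HW) _.
set E := \sum_c \sum_q weight c q * \sum_i _ in h2 *.
apply: (@le_trans _ _ (nq * Wt * (Ca^-1 * (Cs * (Cb * E) ^+ 2)))); last first.
  by rewrite exprMn -[nq * Wt * _ * _]mulrA -[Ca^-1 * _ * _]mulrA -[Cs * _ * _]mulrA.
apply: ler_wpM2l; first exact: mulr_ge0.
rewrite ler_pdivlMl //; apply: le_trans h1 _; apply: le_trans h3 _.
apply: ler_wpM2l => //.
apply: lerXn2r => //; rewrite nnegrE.
  by apply: sumr_ge0 => i _; apply: gsum_ge0 => // z; exact: sqr_ge0.
apply: le_trans h2.
by apply: sumr_ge0 => i _; apply: gsum_ge0 => // z; exact: sqr_ge0.
Unshelve. all: by end_near.
Qed.

End ElementSobolev.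

(** * Reference elements *)

(** The sup bound accompanies the Lipschitz bound because the product rule needs both. *)
Definition cube_lipschitz (R : realType) (d : nat) (f : 'rV[R]_d -> R) : Prop :=
  exists2 C : R, 0 <= C &
    (forall y : 'rV[R]_d, (forall i, `|y ord0 i| <= 1) -> `|f y| <= C) /\
    (forall (x y : 'rV[R]_d) e, 0 <= e -> (forall i, `|x ord0 i| <= 1) ->
       (forall i, `|y ord0 i| <= 1) -> (forall i, `|x ord0 i - y ord0 i| <= e) ->
       `|f x - f y| <= C * e).

Section CubeLipschitz.
Variables (R : realType) (d : nat).
Implicit Types f g : 'rV[R]_d -> R.

Lemma cube_lipschitz_cst (c : R) : cube_lipschitz (fun _ : 'rV[R]_d => c).
Proof.
exists `|c| => //; split => // x y e e0 _ _ _.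
by rewrite subrr normr0 mulr_ge0.
Qed.

Lemma cube_lipschitz_coord i : cube_lipschitz (fun y : 'rV[R]_d => y ord0 i).
Proof. by exists 1 => //; split => [y|x y e e0 _ _ h]; rewrite ?mul1r. Qed.

Lemma cube_lipschitzD f g : cube_lipschitz f -> cube_lipschitz g ->
  cube_lipschitz (fun y => f y + g y).
Proof.
move=> [A A0 [Ab Al]] [B B0 [Bb Bl]]; exists (A + B); first exact: addr_ge0.
split=> [y hy|x y e e0 hx hy hxy].
  by apply: le_trans (ler_normD _ _) _; apply: lerD; [exact: Ab | exact: Bb].
have -> : f x + g x - (f y + g y) = (f x - f y) + (g x - g y) by ring.
apply: le_trans (ler_normD _ _) _; rewrite mulrDl.
by apply: lerD; [exact: Al | exact: Bl].
Qed.

Lemma cube_lipschitzM f g : cube_lipschitz f -> cube_lipschitz g ->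
  cube_lipschitz (fun y => f y * g y).
Proof.
move=> [A A0 [Ab Al]] [B B0 [Bb Bl]].
exists (A * B + A * B); first by rewrite addr_ge0 // mulr_ge0.
split=> [y hy|x y e e0 hx hy hxy].
  rewrite normrM; apply: (@le_trans _ _ (A * B)); last by rewrite lerDl mulr_ge0.
  by apply: ler_pM => //; [exact: Ab | exact: Bb].
have -> : f x * g x - f y * g y = (f x - f y) * g x + f y * (g x - g y) by ring.
apply: le_trans (ler_normD _ _) _; rewrite [leRHS]mulrDl !normrM; apply: lerD.
  by rewrite mulrAC; apply: ler_pM => //; [exact: Al | exact: Bb].
by rewrite -mulrA; apply: ler_pM => //; [exact: Ab | exact: Bl].
Qed.

Lemma cube_lipschitz_prod (I : Type) (r : seq I) (F : I -> 'rV[R]_d -> R) :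
  (forall i, cube_lipschitz (F i)) -> cube_lipschitz (fun y => \prod_(i <- r) F i y).
Proof.
move=> hF; elim: r => [|i r IH].
  rewrite (_ : (fun y => _) = fun=> 1); first exact: cube_lipschitz_cst.
  by apply/funext => y; rewrite big_nil.
rewrite (_ : (fun y => _) = fun y => F i y * \prod_(i <- r) F i y).
  exact: cube_lipschitzM.
by apply/funext => y; rewrite big_cons.
Qed.

Lemma cube_lipschitz_peval (p : mpoly d R) : cube_lipschitz (peval p).
Proof.
elim/mpoly_ring_ind: p => [c|i|p q hp hq|p q hp hq].
- rewrite (_ : peval _ = fun=> c); first exact: cube_lipschitz_cst.
  by apply/funext => y; rewrite pevalC.
- rewrite (_ : peval _ = fun y => y ord0 i); first exact: cube_lipschitz_coord.
  by apply/funext => y; rewrite pevalX.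
- rewrite (_ : peval _ = fun y => peval p y + peval q y); first exact: cube_lipschitzD.
  by apply/funext => y; rewrite pevalD.
- rewrite (_ : peval _ = fun y => peval p y * peval q y); first exact: cube_lipschitzM.
  by apply/funext => y; rewrite pevalM.
Qed.

Lemma cube_lipschitz_horner (p : {poly R}) i :
  cube_lipschitz (fun y : 'rV[R]_d => p.[y ord0 i]).
Proof.
elim/poly_ind: p => [|p c hp].
  rewrite (_ : (fun y => _) = fun=> 0); first exact: cube_lipschitz_cst.
  by apply/funext => y; rewrite horner0.
rewrite (_ : (fun y => _) = fun y : 'rV[R]_d => p.[y ord0 i] * y ord0 i + c).
  apply: cube_lipschitzD; last exact: cube_lipschitz_cst.
  by apply: cube_lipschitzM => //; exact: cube_lipschitz_coord.
by apply/funext => y; rewrite hornerMXaddC.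
Qed.

Lemma cube_lipschitz_family (Q : finType) (l : Q -> 'rV[R]_d -> R) :
  (forall q, cube_lipschitz (l q)) -> exists2 C : R, 0 < C &
    (forall q (y : 'rV[R]_d), (forall i, `|y ord0 i| <= 1) -> `|l q y| <= C) /\
    (forall q (x y : 'rV[R]_d) e, 0 <= e -> (forall i, `|x ord0 i| <= 1) ->
       (forall i, `|y ord0 i| <= 1) -> (forall i, `|x ord0 i - y ord0 i| <= e) ->
       `|l q x - l q y| <= C * e).
Proof.
move=> hl.
have /choice[C hC] : forall q, exists C : R, [/\ 0 <= C,
    (forall (y : 'rV[R]_d), (forall i, `|y ord0 i| <= 1) -> `|l q y| <= C) &
    (forall (x y : 'rV[R]_d) e, 0 <= e -> (forall i, `|x ord0 i| <= 1) ->
       (forall i, `|y ord0 i| <= 1) -> (forall i, `|x ord0 i - y ord0 i| <= e) ->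
       `|l q x - l q y| <= C * e)].
  by move=> q; have [C C0 [h1 h2]] := hl q; exists C.
have C0 q : 0 <= C q by have [] := hC q.
have Cq q : C q <= \sum_q' C q' + 1.
  by rewrite (bigD1 q) //= -addrA lerDl addr_ge0 // sumr_ge0.
exists (\sum_q C q + 1); first by rewrite ltr_wpDl // sumr_ge0.
split=> [q y hy|q x y e e0 hx hy hxy].
  by apply: le_trans (Cq q); have [_ + _] := hC q; apply.
apply: (@le_trans _ _ (C q * e)); last by apply: ler_wpM2r.
by have [_ _] := hC q; apply.
Qed.

End CubeLipschitz.

Section AffineClosed.
Variable R : realType.

Lemma closed_affine_ge (a b c : R) : closed [set t : R | c <= a + t * b].
Proof.
have hf : continuous (fun t : R => a + t * b).
  move=> t; apply: cvgD; first exact: cvg_cst.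
  by apply: cvgM; [exact: cvg_id | exact: cvg_cst].
exact: ((continuous_closedP _).1 hf _ (@closed_ge _ c)).
Qed.

Lemma closed_affine_le (a b c : R) : closed [set t : R | a + t * b <= c].
Proof.
have hf : continuous (fun t : R => a + t * b).
  move=> t; apply: cvgD; first exact: cvg_cst.
  by apply: cvgM; [exact: cvg_id | exact: cvg_cst].
exact: ((continuous_closedP _).1 hf _ (@closed_le _ c)).
Qed.

End AffineClosed.

Definition open_simplex (R : realType) (d : nat) : set 'rV[R]_d :=
  [set x | (forall i, 0 < x ord0 i) /\ \sum_i x ord0 i < 1].

Lemma simplex_affine_element (R : realType) (d k : nat)
    (x : 'I_'C(k + d, d) -> 'rV[R]_d) (w : 'I_'C(k + d, d) -> R) :
  simplex_rule x w -> exists l Lam rho b0,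
  affine_element (K := simplex_element x w) (fun=> True) (@open_simplex R d) l Lam rho b0.
Proof.
move=> [xs w0 unis _].
(* Unisolvence supplies the Lagrange polynomials; its uniqueness half then gives the interpolation
   formula. *)
have /choice[Lp HLp] q : exists p : mpoly d R, Pk k p /\
   forall q', peval p (x q') = (q' == q)%:R.
  by have [p [hp _]] := unis (fun q' => (q' == q)%:R); exists p.
have interp (p : mpoly d R) : Pk k p -> forall y,
    peval p y = \sum_q peval p (x q) * peval (Lp q) y.
  move=> hp y; have [p0 [_ uniq0]] := unis (fun q => peval p (x q)).
  have e1 := uniq0 p (conj hp (fun=> erefl)).
  have e2 : p0 = \sum_q peval p (x q) *: Lp q.
    apply: uniq0; split.
      by apply: monomial_space_sum => q; apply: monomial_spaceZ; exact: (HLp q).1.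
    move=> q; rewrite peval_sum (bigD1 q) //= big1 => [|q' q'q].
      by rewrite pevalZ (HLp q).2 eqxx mulr1 addr0.
    by rewrite pevalZ (HLp q').2 eq_sym (negbTE q'q) mulr0.
  rewrite -{1}e1 e2 peval_sum; by apply: eq_bigr => q _; rewrite pevalZ.
pose dd : R := d%:R + 1.
have dd0 : 0 < dd by rewrite ltr_wpDl.
have [Lam Lam0 [Lb Ll]] := cube_lipschitz_family (fun q => cube_lipschitz_peval (Lp q)).
(* On the cube with centre 1 / (2 (d + 1)) and half-side 1 / (4 (d + 1)) all coordinates are
   positive, and their sum is at most 3d / (4 (d + 1)) < 1. *)
exists (fun q => peval (Lp q)), Lam, (4 * dd)^-1, (const_mx (2 * dd)^-1).
split => //=.
- move=> y [y0 y1] i; rewrite ger0_norm //; apply: le_trans y1.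
  by rewrite (bigD1 i) //= lerDl sumr_ge0.
- move=> y v.
  rewrite (_ : mkset _ = (\bigcap_(i in [set: 'I_d]) [set t : R | 0 <= y ord0 i + t * v ord0 i])
    `&` [set t : R | \sum_i y ord0 i + t * (\sum_i v ord0 i) <= 1]).
    apply: closedI; last exact: closed_affine_le.
    by apply: closed_bigI => i _; exact: closed_affine_ge.
  have sE t : \sum_i (y + t *: v) ord0 i = \sum_i y ord0 i + t * (\sum_i v ord0 i).
    by rewrite mulr_sumr -big_split; apply: eq_bigr => i _; rewrite !mxE.
  apply/seteqP; split => t /= [h1 h2]; split; rewrite ?sE //.
  + by move=> i _; have := h1 i; rewrite !mxE.
  + by rewrite -sE.
  + by move=> i; rewrite !mxE; apply: h1.
- move=> a b e [a0 a1] [b0 b1] /andP[e0 e1]; split.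
    by move=> i; rewrite !mxE addr_ge0 // mulr_ge0 // subr_ge0.
  under eq_bigr do rewrite !mxE.
  rewrite big_split /= -!mulr_sumr.
  have := ler_wpM2l e0 b1; have := ler_wpM2l (x := 1 - e) _ a1.
  rewrite subr_ge0 => /(_ e1); lra.
- by move=> y [y0 y1]; split; [move=> i; exact: ltW | exact: ltW].
- move=> a b e [a0 a1] [b0 b1] /andP[e0 e1]; split.
    move=> i; rewrite !mxE ltr_wpDl // ?mulr_gt0 //.
    by rewrite mulr_ge0 // subr_ge0.
  under eq_bigr do rewrite !mxE.
  rewrite big_split /= -!mulr_sumr.
  have h1 : e * \sum_i b ord0 i < e * 1 by rewrite ltr_pM2l.
  have := ler_wpM2l (x := 1 - e) _ a1.
  rewrite subr_ge0 => /(_ e1); lra.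
- by rewrite invr_gt0 mulr_gt0.
- move=> s hs.
  have hb i : (4 * dd)^-1 <= (2 * dd)^-1 + (4 * dd)^-1 * s ord0 i <= 3 * (4 * dd)^-1.
    have -> : (2 * dd)^-1 = 2 * (4 * dd)^-1 by field; rewrite gt_eqF.
    have := hs i; rewrite ler_norml => /andP[h1 h2].
    have r0 : 0 < (4 * dd)^-1 by rewrite invr_gt0 mulr_gt0.
    by apply/andP; split; nra.
  split.
    move=> i; rewrite !mxE; apply: lt_le_trans (proj1 (andP (hb i))).
    by rewrite invr_gt0 mulr_gt0.
  apply: (@le_lt_trans _ _ (\sum_(i < d) 3 * (4 * dd)^-1)).
    by apply: ler_sum => i _; rewrite !mxE; exact: (proj2 (andP (hb i))).
  rewrite sumr_const card_ord -[_ *+ d]mulr_natl mulrA ltr_pdivrMr ?mulr_gt0 // mul1r.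
  have := ler0n R d; rewrite /dd; lra.
- move=> i p hp; apply: monomial_space_mderiv hp => m.
  by apply: leq_trans; rewrite mdegD leq_addr.
- move=> p o A y hp _.
  have [p' hp' p'E] := Pk_affine o A hp.
  by rewrite -p'E (interp _ hp'); apply: eq_bigr => q _; rewrite p'E.
Qed.

(** * Lagrange interpolation and positivity of the Gauss-Lobatto weights *)

Lemma lagrange_interpolation (F : fieldType) (n : nat) (x : 'I_n -> F) :
  injective x -> exists l : 'I_n -> {poly F},
  forall p : {poly F}, (size p <= n)%N -> p = \sum_j p.[x j] *: l j.
Proof.
move=> xinj.
pose g j := \prod_(i < n | i != j) ('X - (x i)%:P).
have gne i j : i != j -> (g j).[x i] = 0.
  move=> ij; rewrite /g horner_prod (bigD1 i) //= hornerXsubC subrr mul0r //.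
have gee j : (g j).[x j] != 0.
  rewrite /g horner_prod; apply/prodf_neq0 => i ij.
  by rewrite hornerXsubC subr_eq0 (inj_eq xinj) eq_sym.
have sg j : (size (g j) <= n)%N.
  rewrite /g size_prod => [|i _]; last by rewrite polyXsubC_eq0.
  rewrite (eq_bigr (fun=> 2%N)) => [|i _]; last by rewrite size_XsubC.
  rewrite sum_nat_const cardC1 card_ord.
  by have := ltn_ord j; lia.
exists (fun j => (g j).[x j]^-1 *: g j) => p sp.
apply/eqP; rewrite -subr_eq0; apply/eqP.
set q := _ - _.
have sq : (size q <= n)%N.
  rewrite (leq_trans (size_polyD _ _)) // geq_max sp size_polyN /=.
  apply: (big_ind (fun r : {poly F} => size r <= n)%N) => [|r s hr hs|j _].
  - by rewrite size_poly0.
  - by rewrite (leq_trans (size_polyD _ _)) // geq_max hr.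
  - by rewrite scalerA; apply: leq_trans (size_scale_leq _ _) (sg j).
(* The interpolation error has size at most n and vanishes at the n nodes. *)
apply: (@roots_geq_poly_eq0 _ _ (map x (enum 'I_n))).
- apply/allP => _ /mapP[i _ ->]; rewrite /root /q hornerD hornerN horner_sum.
  rewrite (bigD1 i) //= big1 => [|j ji].
    by rewrite !hornerZ mulVf // mulr1 addr0 subrr.
  by rewrite !hornerZ (gne i j) 1?eq_sym // !mulr0.
- by rewrite map_inj_uniq // enum_uniq.
- by rewrite size_map size_enum_ord.
Qed.

Section PolyIntegral.
Variable R : realType.

Lemma poly_itv_eq0 (p : {poly R}) :
  (forall t, -1 <= t <= 1 -> p.[t] = 0) -> p = 0.
Proof.
move=> hp; apply: (@roots_geq_poly_eq0 _ _ [seq (i.+1%:R : R)^-1 | i <- iota 0 (size p)]).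
- apply/allP => _ /mapP[i _ ->]; apply/eqP; apply: hp.
  have h : 0 < (i.+1%:R : R)^-1 by rewrite invr_gt0 ltr0n.
  by rewrite invf_le1 ?ltr0n // ler1n andbT (le_trans _ (ltW h)) // lerN10.
- rewrite map_inj_in_uniq ?iota_uniq // => i j _ _ /invr_inj /eqP.
  by rewrite eqr_nat eqSS => /eqP.
- by rewrite size_map size_iota.
Qed.

Lemma poly_antiderivative (p : {poly R}) : exists Q : {poly R}, Q^`() = p.
Proof.
exists (\poly_(i < (size p).+1) (p`_i.-1 / i%:R)).
apply/polyP => i; rewrite coef_deriv coef_poly ltnS /=.
case: ltnP => h; last by rewrite mul0rn nth_default.
by rewrite -[_ *+ i.+1]mulr_natr divfK // pnatr_eq0.
Qed.

(** An antiderivative is nondecreasing on [-1, 1]. If its increment were 0 it would be constant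
    there, hence constant as a polynomial, and its derivative would be 0. *)
Lemma poly_integral_gt0 (p : {poly R}) : p != 0 ->
  (forall t, -1 <= t <= 1 -> 0 <= p.[t]) ->
  0 < \int[lebesgue_measure]_(t in `[(-1 : R), 1]) p.[t].
Proof.
move=> p0 hp; have [Q QE] := poly_antiderivative p.
have -> : \int[lebesgue_measure]_(t in `[(-1 : R), 1]) p.[t] = Q.[1] - Q.[-1].
  rewrite /Rintegral (@continuous_FTC2 _ (horner p) (horner Q)) //=.
  - by apply: continuous_subspaceT; exact: continuous_horner.
  - split=> [t _||]; first exact: derivable_horner.
      by apply: cvg_at_right_filter; exact: continuous_horner.
    by apply: cvg_at_left_filter; exact: continuous_horner.
  - by move=> t _; rewrite -derivE QE.
have mono s t : -1 <= s -> s <= t -> t <= 1 -> Q.[s] <= Q.[t].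
  move=> s1; rewrite le_eqVlt => /orP[/eqP -> //|st] t1.
  rewrite -subr_ge0; have [c] := poly_mvt Q st; rewrite in_itv /= => /andP[sc ct] ->.
  rewrite mulr_ge0 ?subr_ge0 ?(ltW st) // QE hp //.
  by rewrite (le_trans s1 (ltW sc)) (le_trans (ltW ct) t1).
rewrite lt_neqAle subr_ge0 mono ?lexx ?andbT //.
apply: contraNneq p0 => h.
suff : Q - (Q.[1])%:P = 0.
  by rewrite -QE => /(congr1 (@deriv R)); rewrite derivB derivC subr0 deriv0 => ->.
apply: poly_itv_eq0 => t /andP[t1 t2].
rewrite hornerD hornerN hornerC; apply/eqP; rewrite subr_eq0 eq_le mono //=.
have := mono (-1) t (lexx _) t1 t2; move/eqP: h; rewrite eq_sym subr_eq0 => /eqP ->.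
by [].
Qed.

End PolyIntegral.

Section GaussLobatto.
Variables (R : realType) (k : nat) (x w : 'I_k.+1 -> R).
Hypothesis GL : gauss_lobatto x w.
Hypothesis k1 : (1 <= k)%N.

Lemma gauss_lobatto_inj : injective x.
Proof.
have [xlt _ _ _] := GL => i j xij; apply/val_inj.
by case: (ltngtP i j) => // /xlt; rewrite xij ltxx.
Qed.

Lemma gauss_lobatto_bound i : -1 <= x i <= 1.
Proof.
have [xlt x0 xm _] := GL; apply/andP; split.
- rewrite -x0; have [->//|i0] := eqVneq i ord0.
  by apply/ltW/xlt; rewrite lt0n.
- rewrite -xm; have [->//|im] := eqVneq i ord_max.
  apply/ltW/xlt; rewrite ltn_neqAle -ltnS ltn_ord andbT.
  by rewrite -[k]/(val (@ord_max k)) val_eqE.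
Qed.

(* The rule is exact on the nonnegative polynomial of degree at most 2k - 1
   that vanishes at all the nodes but one, doubly at the interior ones. *)
Lemma gauss_lobatto_weight_gt0 j : 0 < w j.
Proof.
have [xlt x0 xm exact_] := GL.
pose g (i : 'I_k.+1) : {poly R} :=
  (* At the end points a linear factor suffices, signed so as to be nonnegative on [-1, 1]. *)
  if i == ord0 then 'X + 1%:P else if i == ord_max then 1%:P - 'X
  else ('X - (x i)%:P) ^+ 2.
pose e (i : 'I_k.+1) : nat := if (i == ord0) || (i == ord_max) then 1%N else 2%N.
have m0 : ord_max != ord0 :> 'I_k.+1 by rewrite -val_eqE /= -lt0n.
have gE i t : (g i).[t] = if i == ord0 then t - x i else if i == ord_max
   then x i - t else (t - x i) ^+ 2.
  rewrite /g; case: eqP => [->|_]; first by rewrite hornerD hornerX hornerC x0 opprK.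
  case: eqP => [->|_]; first by rewrite hornerD hornerN hornerX hornerC xm.
  by rewrite horner_exp hornerXsubC.
have sgE i : size (g i) = (e i).+1.
  rewrite /g /e; case: eqP => _ /=; first by rewrite size_XaddC.
  case: eqP => _ /=; first by rewrite -opprB size_polyN size_XsubC.
  by rewrite size_exp_XsubC.
have g_ge0 i t : -1 <= t <= 1 -> 0 <= (g i).[t].
  move=> /andP[t1 t2]; rewrite gE; case: eqP => [->|_]; first by rewrite x0; lra.
  case: eqP => [->|_]; first by rewrite xm; lra.
  exact: sqr_ge0.
have g0 i : (g i).[x i] = 0.
  by rewrite gE subrr expr0n; case: ifP => // _; case: ifP.
have gn0 i : i != j -> (g i).[x j] != 0.
  move=> ij; have xij : x j - x i != 0.
    by rewrite subr_eq0 (inj_eq gauss_lobatto_inj) eq_sym.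
  rewrite gE; case: ifP => // _; case: ifP => // _; last by rewrite expf_neq0.
  by rewrite -oppr_eq0 opprB.
pose p := \prod_(i < k.+1 | i != j) g i.
have gne0 i : g i != 0 by rewrite -size_poly_eq0 sgE.
have p0 : p != 0 by apply/prodf_neq0.
(* The degrees of all factors add up to 2k; leaving out the factor of j, of degree at least 1,
   brings the product within the degree of exactness 2k - 1. *)
have sume : (\sum_i e i = 2 * k)%N.
  rewrite (bigD1 ord0) //= (bigD1 ord_max) //= /e eqxx eqxx orbT /=.
  rewrite (eq_bigr (fun=> 2%N)); last first.
    by move=> i /andP[/negbTE -> /negbTE ->].
  rewrite sum_nat_const.
  have -> : #|[pred i : 'I_k.+1 | (i != ord0) && (i != ord_max)]| = k.-1.
    have := cardC (pred2 ord0 (@ord_max k)); rewrite card2 eq_sym m0 card_ord /= => h.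
    have : #|[pred i : 'I_k.+1 | (i != ord0) && (i != ord_max)]| =
      #|[predC pred2 ord0 (@ord_max k)]|.
      by apply: eq_card => i; rewrite !inE negb_or.
    by move=> ->; have := congr1 (fun n => n.-2) h; rewrite add2n.
  by move: k1; lia.
have sp : (size p <= 2 * k)%N.
  rewrite size_prod; last by move=> i _.
  rewrite (eq_bigr (fun i => (e i).+1)) //.
  have -> : (\sum_(i < k.+1 | i != j) (e i).+1 =
     \sum_(i < k.+1 | i != j) e i + #|[pred i : 'I_k.+1 | i != j]|)%N.
    by rewrite -sum1_card -big_split /=; apply: eq_bigr => i _; rewrite addn1.
  have ej : (1 <= e j)%N by rewrite /e; case: ifP.
  move: sume; rewrite (bigD1 j) //= => sume.
  by rewrite -addSn addnK -sume -[X in (X <= _)%N]add1n leq_add2r.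
have := exact_ p sp; rewrite (bigD1 j) //= big1 => [|i ij]; last first.
  by rewrite /p horner_prod (bigD1 i) //= g0 mul0r mulr0.
rewrite addr0 => hw.
have : 0 < w j * p.[x j].
  rewrite hw; apply: poly_integral_gt0 => // t ht.
  by rewrite /p horner_prod; apply: prodr_ge0 => i _; exact: g_ge0.
rewrite pmulr_lgt0 // lt_neqAle eq_sym /p horner_prod.
apply/andP; split; first by apply/prodf_neq0.
by apply: prodr_ge0 => i _; apply: g_ge0; exact: gauss_lobatto_bound.
Qed.

Definition open_cube (d : nat) : set 'rV[R]_d := [set y | forall i, -1 < y ord0 i < 1].

Lemma cube_affine_element (d : nat) : exists l Lam rho b0,
  affine_element (K := cube_element d x w) (fun A => exists a : R, A = a%:M)
    (@open_cube d) l Lam rho b0.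
Proof.
have [lg lgE] := lagrange_interpolation gauss_lobatto_inj.
pose l (q : {ffun 'I_d -> 'I_k.+1}) (y : 'rV[R]_d) := \prod_i (lg (q i)).[y ord0 i].
have [Lam Lam0 [Lb Ll]] : exists2 C : R, 0 < C &
    (forall q (y : 'rV[R]_d), (forall i, `|y ord0 i| <= 1) -> `|l q y| <= C) /\
    (forall q (x y : 'rV[R]_d) e, 0 <= e -> (forall i, `|x ord0 i| <= 1) ->
       (forall i, `|y ord0 i| <= 1) -> (forall i, `|x ord0 i - y ord0 i| <= e) ->
       `|l q x - l q y| <= C * e).
  apply: cube_lipschitz_family => q; apply: cube_lipschitz_prod => i.
  exact: cube_lipschitz_horner.
exists l, Lam, 2^-1, 0; split => //=.
- by move=> q; apply: prodr_gt0 => i _; exact: gauss_lobatto_weight_gt0.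
- by move=> q i; rewrite mxE; exact: gauss_lobatto_bound.
- by move=> y hy i; rewrite ler_norml.
- move=> y v.
  rewrite (_ : mkset _ = (\bigcap_(i in [set: 'I_d]) [set t : R | -1 <= y ord0 i + t * v ord0 i])
    `&` (\bigcap_(i in [set: 'I_d]) [set t : R | y ord0 i + t * v ord0 i <= 1])).
    by apply: closedI; apply: closed_bigI => i _;
      [exact: closed_affine_ge | exact: closed_affine_le].
  apply/seteqP; split => t /=.
  + by move=> h; split => i _; have := h i; rewrite !mxE /= => /andP[].
  + by move=> [h1 h2] i; rewrite !mxE; apply/andP; split; [exact: h1 | exact: h2].
- move=> a b e ha hb /andP[e0 e1] i; rewrite !mxE.
  have /andP[a1 a2] := ha i; have /andP[b1 b2] := hb i.
  by apply/andP; split; nra.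
- by move=> y hy i; have /andP[h1 h2] := hy i; rewrite !ltW.
- move=> a b e ha hb /andP[e0 e1] i; rewrite !mxE.
  have /andP[a1 a2] := ha i; have /andP[b1 b2] := hb i.
  have h1 : e * -1 < e * b ord0 i by rewrite ltr_pM2l.
  have h2 : e * b ord0 i < e * 1 by rewrite ltr_pM2l.
  by apply/andP; split; nra.
- move=> s hs i; rewrite !mxE add0r; have := hs i; rewrite ler_norml => /andP[h1 h2].
  by apply/andP; split; lra.
- move=> i p hp; apply: (monomial_space_mderiv (D := fun m => forall i, (m i <= k)%N)) hp.
  by move=> m h j; apply: leq_trans (h j); rewrite mnmDE leq_addr.
- move=> p o A y hp [a ->].
  (* Under a scaling each coordinate of the image depends on one reference coordinate only, so a
     power of it is a univariate polynomial of degree at most k, which the k+1 nodes reproduce. *)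
  have interp1 n (c t : R) : (n <= k)%N ->
    (c + t * a) ^+ n = \sum_j (c + x j * a) ^+ n * (lg j).[t].
    move=> nk; pose P : {poly R} := (c%:P + a *: 'X) ^+ n.
    have PE s : P.[s] = (c + s * a) ^+ n.
      by rewrite /P horner_exp hornerD hornerC hornerZ hornerX [s * a]mulrC.
    have sP : (size P <= k.+1)%N.
      apply: leq_trans (size_poly_exp_leq _ _) _; rewrite ltnS.
      apply: leq_trans nk; rewrite -[X in (_ <= X)%N]mul1n leq_mul2r; apply/orP; right.
      rewrite -subn1 leq_subLR; apply: leq_trans (size_polyD _ _) _.
      rewrite geq_max (leq_trans (size_polyC_leq1 _)) //=.
      by apply: leq_trans (size_scale_leq _ _) _; rewrite size_polyX.
    rewrite -PE {1}(lgE P sP) horner_sum; apply: eq_bigr => j _.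
    by rewrite hornerZ PE.
  rewrite [p]mpolyE !peval_sum.
  rewrite (eq_bigr (fun q : {ffun 'I_d -> 'I_k.+1} => \sum_(m <- msupp p)
     mcoeff m p * peval (mpolyX R m) (o + (\row_i x (q i)) *m a%:M) * l q y)); last first.
    by move=> q _; rewrite peval_sum mulr_suml; apply: eq_bigr => m _; rewrite pevalZ.
  rewrite exchange_big /=; rewrite !big_seq; apply: eq_bigr => m mp.
  rewrite pevalZ; under eq_bigr do rewrite -mulrA; rewrite -mulr_sumr; congr (_ * _).
  have XE z : peval (mpolyX R m) z = \prod_i z ord0 i ^+ m i by exact: mevalX.
  rewrite XE (eq_bigr (fun i =>
    \sum_j (o ord0 i + x j * a) ^+ m i * (lg j).[y ord0 i])); last first.
    move=> i _; rewrite mxE mul_mx_scalar mxE [a * _]mulrC interp1 //.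
    exact: hp.
  (* Distributing the product of one-dimensional interpolations over the axes gives the sum over the
     tensor-product nodes [q]. *)
  rewrite bigA_distr_bigA /=; apply: eq_bigr => q _.
  rewrite XE /l -big_split /=; apply: eq_bigr => i _.
  by rewrite mxE mul_mx_scalar !mxE [a * _]mulrC.
Qed.

End GaussLobatto.

(** * Meshes *)

Lemma nat_unit_interval (R : realFieldType) (n : nat) (f : R) : (0 < n)%N -> 0 <= f <= n%:R ->
  exists j : 'I_n, j%:R <= f <= j%:R + 1.
Proof.
elim: n => // n IH _ /andP[f0 fn].
have [n0|n0] := posnP n.
  exists ord0; rewrite f0 add0r /=; move: fn; rewrite n0; lra.
have [fle|flt] := leP f n%:R.
  have [||j jP] := IH; rewrite ?f0 //.
  by exists (widen_ord (leqnSn n) j).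
by exists ord_max; rewrite /= (ltW flt) natr1.
Qed.

Lemma cube_affine_mesh (R : realType) (d k n : nat) (L : R) (x w : 'I_k.+1 -> R) :
  0 < L -> (0 < n)%N ->
  affine_mesh L (cube_element d x w) (fun A => exists a : R, A = a%:M)
    (@open_cube R d) (cube_mesh d L n).
Proof.
move=> L0 n0; pose h := L / n%:R.
have nR : 0 < n%:R :> R by rewrite ltr0n.
have h0 : 0 < h by rewrite divr_gt0.
have hn : h * n%:R = L by rewrite /h divfK ?gt_eqF.
have mapE (c : mesh_cell (cube_mesh d L n)) y i :
    cell_map c y ord0 i = - L + (2 * (c i)%:R + 1 + y ord0 i) * h.
  rewrite /cell_map mul_mx_scalar !mxE -/h natrD natrM; ring.
have cn (c : mesh_cell (cube_mesh d L n)) i : (c i)%:R + 1 <= n%:R :> R.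
  by rewrite natr1 ler_nat.
split=> //=.
- by move=> c; rewrite unitmxE det_scalar unitfE expf_neq0 // gt_eqF.
- by move=> c; exists h.
- move=> z zO.
  have /choice[j jP] i : exists j : 'I_n,
      j%:R <= (z ord0 i + L) / (2 * h) <= j%:R + 1.
    apply: nat_unit_interval => //; have /andP[z1 z2] := zO i.
    have h20 : 0 < 2 * h by rewrite mulr_gt0.
    apply/andP; split; first by rewrite divr_ge0 ?(ltW h20) //; move: z1; lra.
    rewrite ler_pdivrMr //.
    have -> : n%:R * (2 * h) = 2 * L by rewrite -hn; ring.
    by move: z2; lra.
  exists [ffun i => j i], (\row_i (2 * ((z ord0 i + L) / (2 * h)) - (2 * (j i)%:R + 1))).
    by move=> i; rewrite mxE; have /andP[j1 j2] := jP i; apply/andP; split; lra.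
  apply/rowP => i; rewrite mapE ffunE mxE; field; rewrite gt_eqF //.
- move=> c z [y yK <-] i; rewrite mapE; have /andP[y1 y2] := yK i.
  have c0 : 0 <= (c i)%:R :> R by exact: ler0n.
  have e1 : 0 <= (2 * (c i)%:R + 1 + y ord0 i) * h.
    by apply: mulr_ge0; [lra | exact: ltW].
  have e2 : (2 * (c i)%:R + 1 + y ord0 i) * h <= 2 * n%:R * h.
    by apply: ler_wpM2r; [exact: ltW | have := cn c i; lra].
  by apply/andP; split; move: e1 e2; rewrite -hn; lra.
(* Along each axis the open intervals of two different indices are separated by a cell boundary, so
   a common point forces both inequalities between the indices. *)
- have half (c c' : mesh_cell (cube_mesh d L n)) y y' i :
     open_cube y -> open_cube y' -> cell_map c y = cell_map c' y' -> (c i <= c' i)%N.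
    move=> hy hy' /(congr1 (fun z : 'rV[R]_d => z ord0 i)) /=; rewrite !mapE.
    move=> /addrI /(mulIf (lt0r_neq0 h0)) e.
    rewrite leqNgt; apply/negP => lt; have : (c' i)%:R + 1 <= (c i)%:R :> R.
      by rewrite natr1 ler_nat.
    have /andP[y1 y2] := hy i; have /andP[y1' y2'] := hy' i; lra.
  move=> c c' y y' hy hy' e; apply/ffunP => i; apply/val_inj/eqP.
  by rewrite eqn_leq (half _ _ _ _ _ hy hy' e) (half _ _ _ _ _ hy' hy (esym e)).
Qed.

(** Vertex 0 is the origin of the cell map, so its coordinate is the one that the reference
    coordinates omit. *)
Definition barycentric (R : realType) (d : nat) (y : 'rV[R]_d) (i : 'I_d.+1) : R :=
  if unlift ord0 i is Some j then y ord0 j else 1 - \sum_j y ord0 j.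

Section SimplexMesh.
Variables (R : realType) (d n : nat) (L : R) (v : 'I_n -> 'I_d.+1 -> 'rV[R]_d).

Lemma barycentric0 (y : 'rV[R]_d) : barycentric y ord0 = 1 - \sum_j y ord0 j.
Proof. by rewrite /barycentric unlift_none. Qed.

Lemma barycentricS (y : 'rV[R]_d) i : barycentric y (lift ord0 i) = y ord0 i.
Proof. by rewrite /barycentric liftK. Qed.

Lemma barycentric_sum (y : 'rV[R]_d) : \sum_i barycentric y i = 1.
Proof.
rewrite big_ord_recl barycentric0; under [X in _ + X]eq_bigr do rewrite barycentricS.
by rewrite subrK.
Qed.

Lemma cell_map_barycentric (c : mesh_cell (simplex_mesh v)) (l : 'I_d.+1 -> R) :
  \sum_i l i = 1 ->
  cell_map c (\row_i l (lift ord0 i)) = \sum_i l i *: v c i.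
Proof.
move=> l1; rewrite /cell_map /= mulmx_sum_row big_ord_recl.
rewrite (eq_bigr (fun i : 'I_d =>
  l (lift ord0 i) *: v c (lift ord0 i) - l (lift ord0 i) *: v c ord0)); last first.
  by move=> i _; rewrite rowK mxE scalerBr.
rewrite sumrB -scaler_suml; move: l1; rewrite big_ord_recl => l1.
have -> : l ord0 = 1 - \sum_(i < d) l (lift ord0 i) by rewrite -l1 addrK.
by rewrite scalerBl scale1r addrA addrAC.
Qed.

Lemma row_barycentric (y : 'rV[R]_d) : \row_i barycentric y (lift ord0 i) = y.
Proof. by apply/rowP => i; rewrite mxE barycentricS. Qed.

Lemma simplex_affine_mesh (k : nat)
    (x : 'I_'C(k + d, d) -> 'rV[R]_d) (w : 'I_'C(k + d, d) -> R) :
  conforming_triangulation L v ->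
  affine_mesh L (simplex_element x w) (fun=> True) (@open_simplex R d) (simplex_mesh v).
Proof.
move=> [vu cov vinj conf].
have faceE c z : cell_set (simplex_element x w) (T := simplex_mesh v) c z <->
    face (v c) setT z.
  split.
  - move=> [y [y0 y1] <-]; exists (barycentric y); split.
    + move=> i; case: (unliftP ord0 i) => [j ->|->]; first by rewrite barycentricS.
      by rewrite barycentric0 subr_ge0.
    + exact: barycentric_sum.
    + by move=> i /(_ I).
    + by rewrite -cell_map_barycentric ?barycentric_sum // row_barycentric.
  - move=> [l [l0 l1 _ ->]]; exists (\row_i l (lift ord0 i)); last by rewrite cell_map_barycentric.
    split=> [i|]; first by rewrite mxE.
    under eq_bigr do rewrite mxE.
    by move: l1; rewrite big_ord_recl => <-; rewrite lerDr.
split=> //.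
- by move=> z; rewrite -cov => -[c _ zc]; exists c; apply/faceE.
- by move=> c z /faceE zc; rewrite -cov; exists c.
(* By conformity a common point lies in the face of c spanned by the common vertices. Its
   barycentric coordinates in c are unique and, as it is interior, nonzero; so every vertex of c is
   a vertex of c'. *)
have sub (c c' : mesh_cell (simplex_mesh v)) y y' : open_simplex y -> open_simplex y' ->
    cell_map c y = cell_map c' y' -> range (v c) `<=` range (v c').
  move=> [y0 y1] [y0' y1'] e.
  have zc : face (v c) setT (cell_map c y).
    by apply/faceE; exists y => //; split; [move=> i; exact: ltW | exact: ltW].
  have zc' : face (v c') setT (cell_map c y).
    by rewrite e; apply/faceE; exists y' => //; split; [move=> i; exact: ltW | exact: ltW].
  have : face (v c) [set i | range (v c') (v c i)] (cell_map c y).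
    by rewrite -conf.
  move=> [l [_ l1 lI lE]].
  have yl : y = \row_i l (lift ord0 i).
    move: lE; rewrite -(cell_map_barycentric c l1) /cell_map => /addrI.
    by move=> /(congr1 (fun z => z *m invmx (mesh_linear c))); rewrite !mulmxK.
  have lpos i : l i != 0.
    case: (unliftP ord0 i) => [j ->|->].
      by have := y0 j; rewrite yl mxE => /lt0r_neq0.
    move: l1; rewrite big_ord_recl => /(canRL (addrK _)) ->.
    rewrite gt_eqF // subr_gt0; move: y1; rewrite yl.
    by under eq_bigr do rewrite mxE.
  move=> _ [i _ <-]; apply: contrapT => ni.
  by have := lI i ni; apply/eqP/lpos.
move=> c c' y y' hy hy' e; apply: vinj; apply/seteqP; split.
  exact: sub hy hy' e.
exact: sub hy' hy (esym e).
Qed.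

End SimplexMesh.

Theorem method_sobolev (R : realType) (d k : nat) (L : R) (m : method R d k) :
  (1 <= d <= 3)%N -> (1 <= k)%N -> 0 < L ->
  (forall q : quad_index (element m), 0 < ref_weight q) /\
  exists2 C : R, 0 <= C &
  forall T : mesh R d, is_mesh L m T ->
  [/\ forall c : mesh_cell T, mesh_linear c \in unitmx,
      forall (c : mesh_cell T) (q : quad_index (element m)),
        cell_set (element m) c (node c q),
      forall (c : mesh_cell T) x, cell_set (element m) c x -> Omega d L x &
  forall (P : mesh_cell T -> mpoly d R) (u : 'rV[R]_d -> R),
  (forall c, local_space (element m) (P c)) ->
  (forall c x, cell_set (element m) c x -> u x = peval (P c) x) ->
  (forall z : 'rV[R]_d, (exists i, z ord0 i = - L \/ z ord0 i = L) -> u z = 0) ->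
  \sum_c \sum_(q : quad_index (element m)) weight c q * peval (P c) (node c q) ^+ 4 <=
  C * (\sum_c \sum_(q : quad_index (element m)) weight c q *
         \sum_i peval (mderiv i (P c)) (node c q) ^+ 2) ^+ 2].
Proof.
move=> hd hk L0.
suff [adm [core [l [Lam [rho [b0 [AE AM]]]]]]] : exists adm core l Lam rho b0,
    affine_element (K := element m) adm core l Lam rho b0 /\
    forall T, is_mesh L m T -> affine_mesh L (element m) adm core T.
  split; first exact: (ae_weight AE).
  have [C C0 HC] := element_sobolev L0 AE hd.
  exists C => // T /AM TM; split; last exact: HC TM.
  - exact: (am_unit TM).
  - by move=> c q; exists (ref_node q) => //; exact: (ae_node AE).
  - exact: (am_sub TM).
case: m => [x w GL|x w SR].
- have [l [Lam [rho [b0 AE]]]] := cube_affine_element GL hk d.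
  exists (fun A => exists a : R, A = a%:M), (@open_cube R d), l, Lam, rho, b0.
  by split=> // T [n [n0 ->]]; exact: cube_affine_mesh.
- have [l [Lam [rho [b0 AE]]]] := simplex_affine_element SR.
  exists (fun=> True), (@open_simplex R d), l, Lam, rho, b0.
  by split=> // T [n [v [cv ->]]]; exact: simplex_affine_mesh.
Qed.

(** * Nodal bases *)

Lemma interior_Omega (R : realType) (d : nat) (L : R) (z : 'rV[R]_d) :
  (Omega d L)° z -> forall i, - L < z ord0 i < L.
Proof.
move=> /nbhs_ballP[e /= e0 he] i.
have shift (a : R) : `|a| = 1 -> - L <= z ord0 i + a * (e / 2) <= L.
  move=> a1; have zb : ball z e (z + (a * (e / 2)) *: delta_mx ord0 i).
    split=> // j k; rewrite /ball /= !mxE opprD addrA subrr add0r normrN.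
    have h : 0 < e / 2 < e by apply/andP; split; lra.
    case/andP: h => h1 h2; rewrite normrM [`|a * _|]normrM a1 mul1r (gtr0_norm h1).
    by case: (_ && _); rewrite /= ?normr1 ?normr0 ?mulr1 ?mulr0.
  by have := he _ zb i; rewrite !mxE !eqxx mulr1.
have := shift 1 (normr1 _); have := shift (-1).
rewrite normrN1 => /(_ erefl) /andP[h1 h2] /andP[h3 h4].
by apply/andP; split; lra.
Qed.

Lemma local_space_lincomb (R : realType) (d k : nat) (m : method R d k)
    (I : finType) (a : I -> R) (F : I -> mpoly d R) :
  (forall i, local_space (element m) (F i)) ->
  local_space (element m) (\sum_i a i *: F i).
Proof.
by case: m => [x w GL|x w SR] hF; apply: monomial_space_sum => i;
  apply: monomial_spaceZ; exact: hF.
Qed.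

Lemma sum_quadratic (R : comPzRingType) (T : finType) (N : nat)
    (W : T -> R) (a : T -> 'I_N -> R) (u : 'I_N -> R) :
  \sum_i \sum_j u i * (\sum_t W t * (a t i * a t j)) * u j =
  \sum_t W t * (\sum_i u i * a t i) ^+ 2.
Proof.
under eq_bigr => i _.
  under eq_bigr => j _ do rewrite mulr_sumr mulr_suml.
  rewrite exchange_big /=; over.
rewrite exchange_big /=; apply: eq_bigr => t _.
rewrite expr2 big_distrlr /= mulr_sumr; apply: eq_bigr => i _.
by rewrite mulr_sumr; apply: eq_bigr => j _; ring.
Qed.

Lemma quadratic_formE (R : comPzRingType) (N : nat) (A : 'M[R]_N) (u v : 'cV[R]_N) :
  (u^T *m A *m v) ord0 ord0 = \sum_i \sum_j u i ord0 * A i j * v j ord0.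
Proof.
rewrite mxE exchange_big /=; apply: eq_bigr => j _.
by rewrite mxE mulr_suml; apply: eq_bigr => i _; rewrite mxE.
Qed.

Section NodalBasis.
Variables (R : realType) (d k : nat) (L : R) (m : method R d k).
Variables (T : mesh R d) (N : nat) (x : 'I_N -> 'rV[R]_d) (phi : 'I_N -> 'rV[R]_d -> R).
Local Notation K := (element m).

(** The diagonal of [mass_mx], which is thereby [diag_mx (\row_i nodal_weight i)] up to
    conversion. *)
Definition nodal_weight (i : 'I_N) : R :=
  \sum_(c : mesh_cell T) \sum_(q : quad_index K | node c q == x i) weight c q.

Hypothesis NB : nodal_basis L K T x phi.

Lemma local_polyP i (c : mesh_cell T) : local_space K (local_poly K (phi i) c) /\
  forall z, cell_set K c z -> phi i z = peval (local_poly K (phi i) c) z.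
Proof.
have [_ _ hV _] := NB; have [_ _ hp] := hV i; have [p pK pE] := hp c.
rewrite /local_poly; set D := [set p | _].
by have : D (xget 0 D) by apply: xgetPex; exists p.
Qed.

Let lpoly (u : 'cV[R]_N) (c : mesh_cell T) : mpoly d R := \sum_i u i ord0 *: local_poly K (phi i) c.

Let interpolant (u : 'cV[R]_N) z : R := \sum_i u i ord0 * phi i z.

Lemma interpolant_cell u c z : cell_set K c z -> interpolant u z = peval (lpoly u c) z.
Proof.
move=> zc; rewrite /lpoly peval_sum; apply: eq_bigr => i _.
by rewrite pevalZ (local_polyP i c).2.
Qed.

Lemma peval_mderiv_lpoly u c l z : peval (mderiv l (lpoly u c)) z =
  \sum_i u i ord0 * peval (mderiv l (local_poly K (phi i) c)) z.
Proof.
by rewrite /lpoly raddf_sum peval_sum; apply: eq_bigr => i _ /=; rewrite mderivZ pevalZ.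
Qed.

Lemma stiffness_quadratic (u : 'cV[R]_N) :
  (u^T *m stiffness_mx K T phi *m u) ord0 ord0 =
  \sum_(c : mesh_cell T) \sum_(q : quad_index K) weight c q *
    \sum_l peval (mderiv l (lpoly u c)) (node c q) ^+ 2.
Proof.
(* Cells, quadrature points and directions are merged into one index t, so that the stiffness matrix
   is a weighted sum of rank-one matrices as in [sum_quadratic]. *)
pose a (t : mesh_cell T * quad_index K * 'I_d) i :=
  peval (mderiv t.2 (local_poly K (phi i) t.1.1)) (node t.1.1 t.1.2).
pose W (t : mesh_cell T * quad_index K * 'I_d) := weight t.1.1 t.1.2.
have flat (F : mesh_cell T -> quad_index K -> 'I_d -> R) :
    \sum_c \sum_(q : quad_index K) weight c q * \sum_l F c q l =
    \sum_t W t * F t.1.1 t.1.2 t.2.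
  rewrite -(pair_bigA _ (fun p l => weight p.1 p.2 * F p.1 p.2 l)) /=.
  rewrite -(pair_bigA _ (fun c q => \sum_l weight c q * F c q l)) /=.
  by apply: eq_bigr => c _; apply: eq_bigr => q _; rewrite mulr_sumr.
rewrite quadratic_formE.
rewrite (flat (fun c q l => peval (mderiv l (lpoly u c)) (node c q) ^+ 2)).
rewrite (eq_bigr (fun t => W t * (\sum_i u i ord0 * a t i) ^+ 2)); last first.
  by move=> t _; rewrite peval_mderiv_lpoly.
rewrite -sum_quadratic; apply: eq_bigr => i _; apply: eq_bigr => j _.
congr (_ * _ * _); rewrite mxE /grad_inner.
exact: (flat (fun c q l => peval (mderiv l (local_poly K (phi i) c)) (node c q) *
  peval (mderiv l (local_poly K (phi j) c)) (node c q))).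
Qed.

Lemma stiffness_sym : (stiffness_mx K T phi)^T = stiffness_mx K T phi.
Proof.
apply/matrixP => i j; rewrite !mxE; apply: eq_bigr => c _; apply: eq_bigr => q _.
by congr (_ * _); apply: eq_bigr => l _; rewrite mulrC.
Qed.

Hypothesis wref0 : forall q : quad_index K, 0 < ref_weight q.
Hypothesis Tunit : forall c : mesh_cell T, mesh_linear c \in unitmx.

Lemma weight_gt0 (c : mesh_cell T) (q : quad_index K) : 0 < weight c q.
Proof. by rewrite /weight mulr_gt0 // normr_gt0 -unitfE -unitmxE. Qed.

Lemma stiffness_ge0 (u : 'cV[R]_N) :
  0 <= (u^T *m stiffness_mx K T phi *m u) ord0 ord0.
Proof.
rewrite stiffness_quadratic; apply: sumr_ge0 => c _; apply: sumr_ge0 => q _.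
apply: mulr_ge0; first exact: ltW (weight_gt0 c q).
by apply: sumr_ge0 => l _; exact: sqr_ge0.
Qed.

Lemma mass_gt0 i : 0 < nodal_weight i.
Proof.
have [_ rx _ _] := NB.
have : range x (x i) by exists i.
rewrite rx => -[_ [c [q xE]]].
rewrite /nodal_weight (bigD1 c) //= (bigD1 q) ?xE //=.
rewrite -addrA ltr_wpDr ?weight_gt0 // addr_ge0 //.
  by apply: sumr_ge0 => q' _; exact: ltW (weight_gt0 _ _).
by apply: sumr_ge0 => c' _; apply: sumr_ge0 => q' _; exact: ltW (weight_gt0 _ _).
Qed.

Lemma node_Omega i : Omega d L (x i).
Proof.
have [_ rx _ _] := NB.
have : range x (x i) by exists i.
by rewrite rx => -[/interior_subset].
Qed.

(** Each pair of a cell and a quadrature point is attached to at most one [x i], since the nodes are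
    distinct. The pairs attached to none add nonnegative terms to the right-hand side only. *)
Lemma mass_quartic_le (u : 'cV[R]_N) :
  (forall (c : mesh_cell T) (q : quad_index K), cell_set K c (node c q)) ->
  \sum_i nodal_weight i * u i ord0 ^+ 4 <=
  \sum_c \sum_(q : quad_index K) weight c q * peval (lpoly u c) (node c q) ^+ 4.
Proof.
move=> nodeK; have [xinj _ _ phix] := NB.
have ux i : interpolant u (x i) = u i ord0.
  rewrite /interpolant (bigD1 i) //= phix eqxx mulr1 big1 ?addr0 // => j ji.
  by rewrite phix (negbTE ji) mulr0.
rewrite (eq_bigr (fun i => \sum_c \sum_(q : quad_index K | node c q == x i)
   weight c q * peval (lpoly u c) (node c q) ^+ 4)); last first.
  move=> i _; rewrite /nodal_weight mulr_suml; apply: eq_bigr => c _.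
  rewrite mulr_suml; apply: eq_bigr => q /eqP qx; congr (_ * _ ^+ _).
  by rewrite -interpolant_cell // qx ux.
rewrite exchange_big; apply: ler_sum => c _.
under eq_bigr do rewrite big_mkcond.
rewrite exchange_big; apply: ler_sum => q _ /=.
have pos : 0 <= weight c q * peval (lpoly u c) (node c q) ^+ 4.
  apply: mulr_ge0; first exact: ltW (weight_gt0 c q).
  by rewrite (exprM _ 2 2) sqr_ge0.
have [[i ix]|none] := pselect (exists i, node c q = x i).
  rewrite (bigD1 i) //= ix eqxx big1 ?addr0 // => j ji.
  by rewrite (inj_eq xinj) eq_sym (negbTE ji).
rewrite big1 // => i _; case: eqP => // ix.
by exfalso; apply: none; exists i.
Qed.

Lemma discrete_sobolev_mesh (C : R) (u : 'cV[R]_N) : 0 < L ->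
  (forall (c : mesh_cell T) (q : quad_index K), cell_set K c (node c q)) ->
  (forall (c : mesh_cell T) z, cell_set K c z -> Omega d L z) ->
  (forall (P : mesh_cell T -> mpoly d R) (v : 'rV[R]_d -> R),
    (forall c, local_space K (P c)) ->
    (forall c z, cell_set K c z -> v z = peval (P c) z) ->
    (forall z : 'rV[R]_d, (exists i, z ord0 i = - L \/ z ord0 i = L) -> v z = 0) ->
    \sum_c \sum_(q : quad_index K) weight c q * peval (P c) (node c q) ^+ 4 <=
    C * (\sum_c \sum_(q : quad_index K) weight c q *
         \sum_i peval (mderiv i (P c)) (node c q) ^+ 2) ^+ 2) ->
  \sum_i nodal_weight i * u i ord0 ^+ 4 <=
  C * (u^T *m stiffness_mx K T phi *m u) ord0 ord0 ^+ 2.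
Proof.
move=> L0 nodeK subO HC; have [_ _ hV _] := NB.
apply: le_trans (mass_quartic_le u nodeK) _; rewrite stiffness_quadratic.
(* Functions of [V0h] are arbitrary outside [Omega], whereas zero values are required on the whole
   hyperplanes where a coordinate is L or -L; hence the extension by 0. *)
apply: (HC _ (fun z => if `[< Omega d L z >] then interpolant u z else 0)).
- by move=> c; apply: local_space_lincomb => i; exact: (local_polyP i c).1.
- move=> c z zc; rewrite asboolT; last exact: subO zc.
  exact: interpolant_cell.
- move=> z [i zi]; case: asboolP => // zO; rewrite /interpolant big1 // => j _.
  have [_ v0 _] := hV j; rewrite v0 ?mulr0 //; split => // /interior_Omega /(_ i).
  by case: zi => ->; rewrite ltxx ?andbF.
Qed.

End NodalBasis.

(** * Energy descent *)

(** The common shape of [inner_h] and of the radicand in [norm_X]; both convert to it. *)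
Definition form (R : comPzRingType) (N : nat) (A : 'M[R]_N) (u v : 'cV[R]_N) : R :=
  (u^T *m A *m v) ord0 ord0.

Section Form.
Variables (R : comPzRingType) (N : nat).
Implicit Types (A : 'M[R]_N) (u v : 'cV[R]_N).

Lemma formDr A u v1 v2 : form A u (v1 + v2) = form A u v1 + form A u v2.
Proof. by rewrite /form mulmxDr mxE. Qed.

Lemma formZr A u a v : form A u (a *: v) = a * form A u v.
Proof. by rewrite /form -scalemxAr mxE. Qed.

Lemma formNr A u v : form A u (- v) = - form A u v.
Proof. by rewrite /form mulmxN mxE. Qed.

Lemma form_sym A u v : A^T = A -> form A u v = form A v u.
Proof.
move=> sA; have -> : form A u v = (u^T *m A *m v)^T ord0 ord0 by rewrite mxE.
by rewrite !trmx_mul trmxK sA mulmxA.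
Qed.

Lemma form_mul A B u v : form A u (B *m v) = form (A *m B) u v.
Proof. by rewrite /form !mulmxA. Qed.

Lemma formZl A u a v : form A (a *: u) v = a * form A u v.
Proof. by rewrite /form linearZ /= -!scalemxAl mxE. Qed.

Lemma formDm A B u v : form (A + B) u v = form A u v + form B u v.
Proof. by rewrite /form mulmxDr mulmxDl mxE. Qed.

Lemma formZm a A u v : form (a *: A) u v = a * form A u v.
Proof. by rewrite /form -scalemxAr -scalemxAl mxE. Qed.

Lemma form_diag (d : 'I_N -> R) u v :
  form (diag_mx (\row_i d i)) u v = \sum_i d i * u i ord0 * v i ord0.
Proof.
rewrite /form mxE; apply: eq_bigr => i _.
by rewrite mul_mx_diag !mxE [u _ _ * _]mulrC.
Qed.

Lemma form_subZ A u v t : A^T = A ->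
  form A (u - t *: v) (u - t *: v) =
  form A u u - 2 * t * form A u v + t ^+ 2 * form A v v.
Proof.
move=> sA; rewrite formDr formNr formZr (form_sym _ u sA) (form_sym _ v sA).
rewrite !formDr !formNr !formZr (form_sym v u sA); ring.
Qed.

End Form.

Section Descent.
Variables (R : realType) (N : nat) (w p : 'I_N -> R) (S : 'M[R]_N).
Variables (alpha beta Vmax Cs : R).
Hypotheses (alpha0 : 0 < alpha) (beta0 : 0 < beta) (Vmax0 : 0 < Vmax) (Cs0 : 0 <= Cs).
Hypothesis w0 : forall i, 0 < w i.
Hypothesis p0 : forall i, 0 <= p i.
Hypothesis pV : forall i, p i <= Vmax.
Hypothesis Ssym : S^T = S.
Implicit Types u g v : 'cV[R]_N.
Hypothesis S0 : forall u, 0 <= form S u u.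
Hypothesis sobolev : forall u, \sum_i w i * u i ord0 ^+ 4 <= Cs * form S u u ^+ 2.

Let M := diag_mx (\row_i w i).
Let P := diag_mx (\row_i p i).
Let X := S + alpha *: M.
Let B := S + diag_mx (\row_i (w i * p i)).
(** The constant of [B_le_X]: the potential term is at most Vmax / alpha times the mass term of
    [X]. *)
Let K := 1 + Vmax / alpha.
Let quartic u := \sum_i w i * u i ord0 ^+ 4.

(** The discrete energy with the mass matrix multiplied through: [B] stands for S + M P. *)
Definition energy u : R := form B u u / 2 + beta / 4 * quartic u.

Let sym_diag (d : 'rV[R]_N) : (diag_mx d)^T = diag_mx d.
Proof. exact: tr_diag_mx. Qed.

Let Msym : M^T = M. Proof. exact: sym_diag. Qed.

Let Bsym : B^T = B.
Proof. by rewrite /B linearD /= Ssym sym_diag. Qed.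

Let formME u v : form M u v = \sum_i w i * u i ord0 * v i ord0.
Proof. exact: form_diag. Qed.

Let M_ge0 u : 0 <= form M u u.
Proof.
rewrite formME; apply: sumr_ge0 => i _.
by rewrite -mulrA mulr_ge0 ?(ltW (w0 i)) // -expr2 sqr_ge0.
Qed.

Let formXE u v : form X u v = form S u v + alpha * form M u v.
Proof. by rewrite formDm formZm. Qed.

Let formBE u v : form B u v = form S u v + \sum_i w i * p i * u i ord0 * v i ord0.
Proof. by rewrite formDm form_diag. Qed.

Let X_ge0 u : 0 <= form X u u.
Proof. by rewrite formXE addr_ge0 // mulr_ge0 // ltW. Qed.

Let S_le_X u : form S u u <= form X u u.
Proof. by rewrite formXE lerDl mulr_ge0 // ltW. Qed.

Let K1 : 1 <= K.
Proof. by rewrite lerDl divr_ge0 // ltW. Qed.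

Let B_ge0 u : 0 <= form B u u.
Proof.
rewrite formBE addr_ge0 //; apply: sumr_ge0 => i _.
by rewrite -mulrA mulr_ge0 // -?expr2 ?sqr_ge0 // mulr_ge0 // ltW.
Qed.

Lemma B_le_X u : form B u u <= K * form X u u.
Proof.
rewrite formBE formXE.
have h : \sum_i w i * p i * u i ord0 * u i ord0 <= Vmax * form M u u.
  rewrite formME mulr_sumr; apply: ler_sum => i _.
  have -> : w i * p i * u i ord0 * u i ord0 = p i * (w i * u i ord0 * u i ord0) by ring.
  apply: ler_wpM2r => //.
  by rewrite -mulrA mulr_ge0 ?(ltW (w0 i)) // -expr2 sqr_ge0.
have -> : K * (form S u u + alpha * form M u u) = form S u u + alpha * form M u u
   + Vmax / alpha * form S u u + Vmax * form M u u.
  by rewrite /K; field; rewrite gt_eqF.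
have : 0 <= Vmax / alpha * form S u u by rewrite mulr_ge0 // divr_ge0 // ltW.
have : 0 <= alpha * form M u u by rewrite mulr_ge0 // ltW.
move: h; lra.
Qed.

Let quartic_ge0 u : 0 <= quartic u.
Proof.
apply: sumr_ge0 => i _; apply: mulr_ge0; first exact: ltW.
by rewrite (exprM _ 2 2) sqr_ge0.
Qed.

Let quartic_le_X u : quartic u <= Cs * form X u u ^+ 2.
Proof.
apply: le_trans (sobolev u) _; apply: ler_wpM2l => //.
by apply: lerXn2r; rewrite ?nnegrE.
Qed.

Lemma energy_ge0 u : 0 <= energy u.
Proof.
by rewrite addr_ge0 // ?divr_ge0 // mulr_ge0 // divr_ge0 // ltW.
Qed.

Definition energy_bound (r : R) : R := K * r ^+ 2 / 2 + beta / 4 * (Cs * r ^+ 4).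

Lemma energy_bound_ge0 r : 0 <= energy_bound r.
Proof.
rewrite /energy_bound addr_ge0 //.
  by rewrite divr_ge0 // mulr_ge0 ?sqr_ge0 // (le_trans ler01).
rewrite mulr_ge0 ?(ltW (divr_gt0 beta0 (ltr0n R 4))) // mulr_ge0 //.
by rewrite (exprM _ 2 2) sqr_ge0.
Qed.

Lemma energy_le u : energy u <= energy_bound (norm_X M S alpha u).
Proof.
have nE : norm_X M S alpha u ^+ 2 = form X u u.
  by rewrite /norm_X -/(form X u u) sqr_sqrtr.
rewrite /energy_bound (exprM _ 2 2) nE /energy; apply: lerD.
  by rewrite ler_pM2r ?invr_gt0 // B_le_X.
by apply: ler_wpM2l; [exact: ltW (divr_gt0 beta0 (ltr0n R 4)) | exact: quartic_le_X].
Qed.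

(** Cauchy-Schwarz with the weight split into two square roots, then the Sobolev inequality for g.
    The parameter y stands in for the square root of [quartic u * Cs]. *)
Lemma mixed_quartic_le u g (y : R) : 0 <= y -> quartic u * Cs <= y ^+ 2 ->
  \sum_i w i * u i ord0 ^+ 2 * g i ord0 ^+ 2 <= y * form X g g.
Proof.
move=> y0 hy.
have sw i : Num.sqrt (w i) * Num.sqrt (w i) = w i by rewrite -expr2 sqr_sqrtr // ltW.
have := cauchy_schwarz_sum (fun i => Num.sqrt (w i) * u i ord0 ^+ 2)
  (fun i => Num.sqrt (w i) * g i ord0 ^+ 2).
rewrite (eq_bigr (fun i => w i * u i ord0 ^+ 2 * g i ord0 ^+ 2)); last first.
  by move=> i _; rewrite -[in RHS](sw i); ring.
rewrite [X in _ <= X * _](eq_bigr (fun i => w i * u i ord0 ^+ 4)); last first.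
  by move=> i _; rewrite -[in RHS](sw i); ring.
rewrite [X in _ <= _ * X](eq_bigr (fun i => w i * g i ord0 ^+ 4)); last first.
  by move=> i _; rewrite -[in RHS](sw i); ring.
rewrite -/(quartic u) -/(quartic g) => h.
rewrite -(@ler_pXn2r _ 2) ?nnegrE //; first last.
- exact: mulr_ge0.
- apply: sumr_ge0 => i _; rewrite -mulrA mulr_ge0 //; first exact: ltW.
  by rewrite mulr_ge0 ?sqr_ge0.
apply: le_trans h _; rewrite exprMn.
apply: le_trans (ler_wpM2l (quartic_ge0 u) (quartic_le_X g)) _.
by rewrite mulrA; apply: ler_wpM2r; rewrite ?sqr_ge0.
Qed.

Section Step.
Variable E0 : R.
Hypothesis E00 : 0 <= E0.

(* As [sqrt t <= 1 + t], this bounds [sqrt (Cs * sum_i w_i u_i^4)] on the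
   sublevel set [energy u <= E0]. *)
Definition mixed_bound : R := 1 + 4 * E0 * Cs / beta.
(** Each of the two terms of X(g, g) in [gE] is bounded by Young's inequality at the price of X(g,
    g) / 4; absorbing the resulting half doubles the rest, 2 K E0 + 4 beta [mixed_bound] E0. *)
Definition grad_bound : R := 4 * K * E0 + 8 * beta * mixed_bound * E0.
(** The denominator bounds twice the coefficient of t^2 X(g, g) in the expansion of the energy: the
    three terms come from the quadratic part, from the mixed quartic term, and from the fourth-order
    term, where 3/2 is rounded up to 2. *)
Definition step_bound : R :=
  (K + 4 * beta * mixed_bound + 2 * beta * Cs * grad_bound)^-1.

Let mb1 : 1 <= mixed_bound.
Proof. by rewrite lerDl divr_ge0 ?(ltW beta0) // mulr_ge0 // mulr_ge0. Qed.

Let gb0 : 0 <= grad_bound.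
Proof.
have b0 := ltW beta0; have m0 := le_trans ler01 mb1; have k0 := le_trans ler01 K1.
by rewrite /grad_bound addr_ge0 // !mulr_ge0.
Qed.

Let step_denom : 1 <= K + 4 * beta * mixed_bound + 2 * beta * Cs * grad_bound.
Proof.
have b0 := ltW beta0; have m0 := le_trans ler01 mb1.
have h1 : 0 <= 4 * beta * mixed_bound by rewrite !mulr_ge0.
have h2 : 0 <= 2 * beta * Cs * grad_bound by rewrite !mulr_ge0.
by move: K1 h1 h2; lra.
Qed.

Lemma step_bound_gt0 : 0 < step_bound.
Proof. by rewrite invr_gt0; apply: lt_le_trans step_denom. Qed.

Section OneStep.
Variables u g : 'cV[R]_N.
Hypothesis uE : energy u <= E0.
Hypothesis gE : form X g g =
  form B u g + beta * \sum_i w i * u i ord0 ^+ 3 * g i ord0.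

Let Buu : form B u u <= 2 * E0.
Proof.
have := quartic_ge0 u => h; have : 0 <= beta / 4 * quartic u.
  by rewrite mulr_ge0 // divr_ge0 // ltW.
by move: uE; rewrite /energy; lra.
Qed.

Let quarticu : quartic u <= 4 * E0 / beta.
Proof.
rewrite ler_pdivlMr //; move: uE (B_ge0 u); rewrite /energy; lra.
Qed.

Let mixed : \sum_i w i * u i ord0 ^+ 2 * g i ord0 ^+ 2 <= mixed_bound * form X g g.
Proof.
apply: mixed_quartic_le; first exact: le_trans ler01 mb1.
apply: (@le_trans _ _ (mixed_bound - 1)).
  by rewrite /mixed_bound addrAC subrr add0r mulrAC; apply: ler_wpM2r.
by move: mb1; nra.
Qed.

Lemma grad_norm_le : form X g g <= grad_bound.
Proof.
have b0 := ltW beta0; have m0 : 0 < mixed_bound by apply: lt_le_trans mb1.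
have k0 : 0 < K by apply: lt_le_trans K1.
have h1 : form B u g <= K * form B u u + form X g g / 4.
  (* Young's inequality for B, with the weight chosen so that [B <= K X] leaves exactly X(g, g) /
     4. *)
  have := B_ge0 (u - (2 * K)^-1 *: g); rewrite form_subZ //.
  have -> : form B u u - 2 * (2 * K)^-1 * form B u g + (2 * K)^-1 ^+ 2 * form B g g
    = (K * form B u u - form B u g + form B g g / K / 4) / K.
    by field; rewrite gt_eqF.
  rewrite pmulr_lge0 ?invr_gt0 //.
  have : form B g g / K <= form X g g by rewrite ler_pdivrMr // mulrC B_le_X.
  lra.
have h2 : beta * \sum_i w i * u i ord0 ^+ 3 * g i ord0 <=
   beta ^+ 2 * mixed_bound * quartic u + form X g g / 4.
  have hs : \sum_i w i * u i ord0 ^+ 3 * g i ord0 <= beta * mixed_bound * quartic u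
    + (4 * (beta * mixed_bound))^-1 * \sum_i w i * u i ord0 ^+ 2 * g i ord0 ^+ 2.
    rewrite /quartic !mulr_sumr -big_split /=; apply: ler_sum => i _.
    set th := beta * mixed_bound; have th0 : 0 < th by exact: mulr_gt0.
    set a := u i ord0; set b := g i ord0.
    (* The same device pointwise: the square is tuned so that [mixed_bound] cancels and the g-term
       is again X(g, g) / 4. *)
    have : 0 <= w i * (2 * th * a ^+ 2 - a * b) ^+ 2 / (4 * th).
      apply: divr_ge0; first by rewrite mulr_ge0 ?sqr_ge0 ?(ltW (w0 i)).
      by rewrite mulr_ge0 ?(ltW th0).
    have -> : w i * (2 * th * a ^+ 2 - a * b) ^+ 2 / (4 * th) =
      th * (w i * a ^+ 4) + (4 * th)^-1 * (w i * a ^+ 2 * b ^+ 2) - w i * a ^+ 3 * b.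
      by field; rewrite gt_eqF.
    by rewrite subr_ge0.
  apply: le_trans (ler_wpM2l b0 hs) _.
  rewrite mulrDr; apply: lerD; first by rewrite expr2 !mulrA.
  have h3 : 0 <= beta * (4 * (beta * mixed_bound))^-1.
    by rewrite mulr_ge0 // invr_ge0 !mulr_ge0 // ltW.
  rewrite [leLHS]mulrA; apply: le_trans (ler_wpM2l h3 mixed) _.
  rewrite le_eqVlt; apply/orP; left; apply/eqP; field.
  by rewrite !gt_eqF.
have h4 : beta ^+ 2 * mixed_bound * quartic u <= 4 * beta * mixed_bound * E0.
  apply: le_trans (ler_wpM2l _ quarticu) _; first by rewrite mulr_ge0 ?sqr_ge0 // ltW.
  rewrite le_eqVlt; apply/orP; left; apply/eqP; field.
  by rewrite gt_eqF.
have h5 : K * form B u u <= K * (2 * E0) by apply: ler_wpM2l; first exact: ltW.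
by rewrite /grad_bound; move: h1 h2 h4 h5; rewrite gE; lra.
Qed.

Lemma energy_step t : 0 < t -> t <= 1 -> t <= step_bound ->
  energy (u - t *: g) <= energy u - t / 2 * form X g g.
Proof.
move=> t0 t1 tC; have b0 := ltW beta0.
set X2 := form X g g; have X20 : 0 <= X2 by exact: X_ge0.
(* In (a - t b)^4 the cubic term -4 t^3 a b^3 is at most 2 t^2 a^2 b^2 + 2 t^4 b^4, which turns the
   coefficients 6 and 1 into 8 and 3. *)
have hq : quartic (u - t *: g) <= quartic u - 4 * t * (\sum_i w i * u i ord0 ^+ 3 * g i ord0)
   + 8 * t ^+ 2 * (\sum_i w i * u i ord0 ^+ 2 * g i ord0 ^+ 2) + 3 * t ^+ 4 * quartic g.
  rewrite /quartic !mulr_sumr -sumrB -!big_split /=; apply: ler_sum => i _.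
  rewrite !mxE; set a := u i ord0; set b := g i ord0.
  have h : 0 <= w i * (2 * t ^+ 2 * (b * (a + t * b)) ^+ 2).
    by rewrite mulr_ge0 ?(ltW (w0 i)) // mulr_ge0 ?sqr_ge0 // mulr_ge0 // sqr_ge0.
  rewrite -subr_ge0; move: h; congr (0 <= _); ring.
(* By Sobolev [quartic g] is of second degree in X(g, g). One factor is bounded by [grad_bound], and
   t <= 1 lowers t^4 to t^2, so this term joins those of order t^2. *)
have t4 : t ^+ 4 * quartic g <= t ^+ 2 * (Cs * grad_bound * X2).
  have h1 : quartic g <= Cs * grad_bound * X2.
    apply: le_trans (quartic_le_X g) _; rewrite -mulrA; apply: ler_wpM2l => //.
    by rewrite expr2; apply: ler_wpM2r => //; exact: grad_norm_le.
  apply: ler_pM => //; first by rewrite (exprM _ 2 2) sqr_ge0.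
  by apply: ler_wiXn2l => //; exact: ltW.
have hB : form B g g <= K * X2 by exact: B_le_X.
have hm := mixed; rewrite -/X2 in hm.
have t20 : 0 <= t ^+ 2 by exact: sqr_ge0.
have h1 : t ^+ 2 * form B g g <= t ^+ 2 * (K * X2) by exact: ler_wpM2l.
have h2 : t ^+ 2 * (\sum_i w i * u i ord0 ^+ 2 * g i ord0 ^+ 2) <=
   t ^+ 2 * (mixed_bound * X2) by exact: ler_wpM2l.
have hstep : t * X2 * (t * (K + 4 * beta * mixed_bound + 2 * beta * Cs * grad_bound)) <= t * X2 * 1.
  apply: ler_wpM2l; first by rewrite mulr_ge0 // ltW.
  move: tC; rewrite /step_bound -ler_pdivlMr ?div1r //.
  by apply: lt_le_trans step_denom.
have hbq := ler_wpM2l (ltW (divr_gt0 beta0 (ltr0n R 4))) hq.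
have hb2 := ler_wpM2l b0 h2.
have hb4 := ler_wpM2l b0 t4.
have hc : 0 <= beta * (t ^+ 2 * (Cs * grad_bound * X2)).
  apply: mulr_ge0 => //; apply: mulr_ge0 => //; apply: mulr_ge0 => //.
  exact: mulr_ge0.
rewrite /energy form_subZ //.
have gE' : t * X2 = t * form B u g + t * (beta * \sum_i w i * u i ord0 ^+ 3 * g i ord0).
  by rewrite /X2 gE mulrDr.
move: hbq hb2 hb4 hc h1 hstep gE'.
move: (quartic (u - t *: g)) (quartic u) (quartic g) (\sum_i w i * u i ord0 ^+ 2 * g i ord0 ^+ 2)
  (\sum_i w i * u i ord0 ^+ 3 * g i ord0) (form B u u) (form B u g) (form B g g)
  => q1 q2 q3 s2 s3 buu bug bgg.
move: grad_bound mixed_bound => gb mb hbq hb2 hb4 hc h1 hstep gE'.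
lra.
Qed.

End OneStep.

Lemma energy_scale u c : 0 <= c -> c <= 1 -> energy (c *: u) <= energy u.
Proof.
move=> c0 c1; rewrite /energy formZr formZl.
have -> : quartic (c *: u) = c ^+ 4 * quartic u.
  by rewrite /quartic mulr_sumr; apply: eq_bigr => i _; rewrite mxE; ring.
have h1 : c * (c * form B u u) <= form B u u.
  rewrite mulrA -[leRHS]mul1r; apply: ler_wpM2r => //.
  by rewrite -expr2 expr_le1.
have h2 : c ^+ 4 * quartic u <= quartic u.
  by rewrite -[leRHS]mul1r; apply: ler_wpM2r => //; rewrite expr_le1.
have h3 := ler_wpM2l (ltW (divr_gt0 beta0 (ltr0n R 4))) h2.
by move: h1 h3; lra.
Qed.

Lemma retraction_step u g t : 0 < t -> t <= 1 -> t <= step_bound ->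
  energy u <= E0 -> form M u u = 1 -> form M u g = 0 ->
  form X g g = form B u g + beta * \sum_i w i * u i ord0 ^+ 3 * g i ord0 ->
  form M (retraction M (u - t *: g)) (retraction M (u - t *: g)) = 1 /\
  energy (retraction M (u - t *: g)) <= energy u - t / 2 * form X g g.
Proof.
move=> t0 t1 tC uE uM ug gE.
have hM : inner_h M (u - t *: g) (u - t *: g) = 1 + t ^+ 2 * form M g g.
  rewrite -[inner_h _ _ _]/(form M _ _) form_subZ // uM ug; ring.
have hM1 : 1 <= inner_h M (u - t *: g) (u - t *: g).
  by rewrite hM lerDl mulr_ge0 ?sqr_ge0.
set s := inner_h M _ _ in hM1.
have s1 : 1 <= Num.sqrt s by rewrite -sqrtr1 ler_wsqrtr.
have s0 : 0 < Num.sqrt s by apply: lt_le_trans s1.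
rewrite /retraction -/s; split.
  rewrite formZr formZl -[form M _ _]/s.
  rewrite -{3}[s]sqr_sqrtr ?(le_trans ler01) // expr2.
  by rewrite mulrA mulrACA mulVf ?gt_eqF // mul1r.
apply: le_trans (energy_scale _ _ _) (energy_step uE gE t0 t1 tC).
  by rewrite invr_ge0 ltW.
by rewrite invf_le1.
Qed.

End Step.

End Descent.

(** * Riemannian gradient and limit points *)

Section PosDef.
Variables (R : realType) (N : nat) (w : 'I_N -> R) (S : 'M[R]_N) (alpha : R).
Hypothesis alpha0 : 0 < alpha.
Hypothesis w0 : forall i, 0 < w i.
Hypothesis Ssym : S^T = S.
Hypothesis S0 : forall u : 'cV[R]_N, 0 <= form S u u.
Implicit Types u g v : 'cV[R]_N.

Let M := diag_mx (\row_i w i).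
Let X := S + alpha *: M.

Let Msym : M^T = M. Proof. exact: tr_diag_mx. Qed.

Lemma mass_coord_le u i : w i * u i ord0 ^+ 2 <= form M u u.
Proof.
rewrite form_diag (bigD1 i) //= expr2 mulrA lerDl; apply: sumr_ge0 => j _.
by rewrite -mulrA mulr_ge0 ?(ltW (w0 j)) // -expr2 sqr_ge0.
Qed.

Lemma form_X_ge0 u : 0 <= form X u u.
Proof.
rewrite formDm formZm addr_ge0 // mulr_ge0 ?(ltW alpha0) // form_diag.
apply: sumr_ge0 => j _.
by rewrite -mulrA mulr_ge0 ?(ltW (w0 j)) // -expr2 sqr_ge0.
Qed.

Lemma mass_coord_le_X u i : alpha * (w i * u i ord0 ^+ 2) <= form X u u.
Proof.
rewrite formDm formZm; apply: ler_wpDl; first exact: S0.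
by apply: ler_wpM2l; [exact: ltW | exact: mass_coord_le].
Qed.

Lemma form_X_eq0 u : form X u u = 0 -> u = 0.
Proof.
move=> u0; apply/colP => i; rewrite mxE; apply/eqP.
have := mass_coord_le_X u i; rewrite u0 pmulr_rle0 // pmulr_rle0 // => h.
by rewrite -sqrf_eq0 eq_le h sqr_ge0.
Qed.

Lemma X_unit : X \in unitmx.
Proof.
rewrite -row_free_unit -kermx_eq0; apply/eqP/row_matrixP => i; rewrite row0.
set r := row i _; have rX : r *m X = 0 by rewrite /r -row_mul mulmx_ker row0.
by rewrite -[r]trmxK (form_X_eq0 (u := r^T)) ?trmx0 // /form trmxK rX mul0mx mxE.
Qed.

Lemma mass_unit : M \in unitmx.
Proof.
rewrite unitmxE det_diag unitfE; apply/prodf_neq0 => i _.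
by rewrite mxE gt_eqF.
Qed.

(** Since -laplace_h + alpha = M^-1 X, the matrix [G_X] is X^-1 M. It thus represents M-pairings in
    the X inner product. *)
Lemma mul_X_G : X *m G_X M S alpha = M.
Proof.
have HE : - laplace_h M S + alpha%:M = invmx M *m X.
  rewrite /laplace_h opprK /X mulmxDr -scalemxAr mulVmx ?mass_unit //.
  by rewrite scalemx1.
rewrite /G_X HE -[X in X *m _]mul1mx -(mulmxV mass_unit) -mulmxA -mulmxA.
by rewrite (mulmxA (invmx M)) mulmxV ?mulmx1 // unitmx_mul unitmx_inv mass_unit X_unit.
Qed.

Lemma form_X_G u g : form X u (G_X M S alpha *m g) = form M u g.
Proof. by rewrite form_mul mul_X_G. Qed.

(** The denominator of [riem_grad_X]: it is the squared X-norm of G u, and G u = 0 would give M u =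
    0. *)
Lemma form_G_gt0 u : form M u u = 1 -> 0 < form M (G_X M S alpha *m u) u.
Proof.
move=> u1; set y := G_X _ _ _ *m u.
have yX : form M y u = form X y y by rewrite /y form_X_G.
rewrite yX lt_neqAle eq_sym; apply/andP; split.
  apply/eqP => /form_X_eq0 y0; have : M *m u = 0.
    by rewrite -mul_X_G -mulmxA -/y y0 mulmx0.
  move=> Mu; move: u1; rewrite /form -mulmxA Mu mulmx0 mxE => /esym/eqP.
  by rewrite oner_eq0.
exact: form_X_ge0.
Qed.

Variables (p : 'I_N -> R) (beta : R).
Let P := diag_mx (\row_i p i).
Let B := S + diag_mx (\row_i (w i * p i)).

(** The right-hand side is the derivative of [energy] at u in direction g. *)
Lemma form_A u g : form M g (A_mx M S P beta u *m u) =
  form B u g + beta * \sum_i w i * u i ord0 ^+ 3 * g i ord0.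
Proof.
rewrite /A_mx /laplace_h opprK !mulmxDl !formDr -mulmxA form_mul.
rewrite mulmxV ?mass_unit //.
have -> : form 1%:M g (S *m u) = form S u g.
  by rewrite form_mul mul1mx form_sym.
rewrite formDm -!addrA; congr (_ + _).
have Pu i : (P *m u) i ord0 = p i * u i ord0 by rewrite mul_diag_mx !mxE.
have Du i : ((beta *: diag_mx (\row_j u j ord0 ^+ 2)) *m u) i ord0 = beta * u i ord0 ^+ 3.
  by rewrite -scalemxAl mxE mul_diag_mx !mxE; ring.
rewrite !form_diag mulr_sumr -!big_split /=; apply: eq_bigr => i _.
by rewrite Pu Du; ring.
Qed.

Let G := G_X M S alpha.
Let rg u := riem_grad_X M S P alpha beta u.

Lemma riem_grad_tangent u : form M u u = 1 -> form M u (rg u) = 0.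
Proof.
move=> u1; rewrite /rg /riem_grad_X formDr formNr formZr.
rewrite -[inner_h M u _]/(form M u _) -[inner_h M (_ *m u) u]/(form M (G *m u) u).
rewrite (form_sym _ (G *m u) Msym) divfK ?subrr //.
by rewrite gt_eqF // form_G_gt0.
Qed.

(** The component of the gradient along G u is X-orthogonal to [rg u], because X-pairing with G u is
    M-pairing with u and [rg u] is tangent. What remains is the derivative of the energy along
    [rg u], the identity on which [energy_step] rests. *)
Lemma riem_grad_norm u : form M u u = 1 -> form X (rg u) (rg u) =
  form B u (rg u) + beta * \sum_i w i * u i ord0 ^+ 3 * rg u i ord0.
Proof.
move=> u1; rewrite -form_A {2}/rg /riem_grad_X.
rewrite formDr formNr formZr /grad_X !form_X_G (form_sym _ u Msym) riem_grad_tangent //.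
by rewrite mulr0 subr0.
Qed.

Section Continuity.
Variable v : 'cV[R]_N.

(** Continuity at the single point [v]: the denominator of [riem_grad_X] is shown to be nonzero
    where the mass is 1. *)
Let cont (f : 'cV[R]_N -> R) := f u @[u --> v] --> f v.

Let cont_cst (a : R) : cont (fun=> a).
Proof. exact: (@cvg_cst _ a _ (nbhs v) _). Qed.

Let cont_coord i : cont (fun u => u i ord0).
Proof. exact: (@coord_continuous R N 1 i ord0 v). Qed.

Let contD f h : cont f -> cont h -> cont (fun u => f u + h u).
Proof. move=> hf hh; exact: (cvgD hf hh). Qed.

Let contM f h : cont f -> cont h -> cont (fun u => f u * h u).
Proof. move=> hf hh; exact: (cvgM hf hh). Qed.

Let cont_ext f h : (forall u, f u = h u) -> cont f -> cont h.
Proof. by move=> /funext ->. Qed.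

Let cont_sum (I : Type) (r : seq I) (F : I -> 'cV[R]_N -> R) :
  (forall i, cont (F i)) -> cont (fun u => \sum_(i <- r) F i u).
Proof.
move=> hF; elim: r => [|i r IH].
  by apply: (@cont_ext (fun=> 0)) => [u|]; rewrite ?big_nil.
apply: (@cont_ext (fun u => F i u + \sum_(i <- r) F i u)) => [u|].
  by rewrite big_cons.
exact: contD.
Qed.

Let cont_mulmx (A : 'M[R]_N) (F : 'cV[R]_N -> 'cV[R]_N) i :
  (forall j, cont (fun u => F u j ord0)) -> cont (fun u => (A *m F u) i ord0).
Proof.
move=> hF; apply: (@cont_ext (fun u => \sum_j A i j * F u j ord0)) => [u|].
  by rewrite mxE.
by apply: cont_sum => j; apply: contM.
Qed.

Let cont_form (F H : 'cV[R]_N -> 'cV[R]_N) :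
  (forall j, cont (fun u => F u j ord0)) -> (forall j, cont (fun u => H u j ord0)) ->
  cont (fun u => form M (F u) (H u)).
Proof.
move=> hF hH; apply: (@cont_ext (fun u => \sum_j w j * F u j ord0 * H u j ord0)) => [u|].
  by rewrite form_diag.
by apply: cont_sum => j; apply: contM => //; apply: contM.
Qed.

Lemma continuous_mass : cont (fun u => form M u u).
Proof. exact: cont_form. Qed.

Lemma continuous_riem_grad i : form M v v = 1 -> cont (fun u => rg u i ord0).
Proof.
move=> v1.
have cA j : cont (fun u => (A_mx M S P beta u *m u) j ord0).
  apply: (@cont_ext (fun u => ((- laplace_h M S + P) *m u) j ord0 +
    beta * (u j ord0 * (u j ord0 * u j ord0)))) => [u|].
    rewrite /A_mx [in RHS]mulmxDl [in RHS]mxE; congr (_ + _).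
    by rewrite -scalemxAl mxE mul_diag_mx !mxE; ring.
  apply: contD; first exact: cont_mulmx.
  by apply: contM => //; apply: contM => //; apply: contM.
have cg j : cont (fun u => grad_X M S P alpha beta u j ord0) by exact: cont_mulmx.
have cG j : cont (fun u => (G *m u) j ord0) by exact: cont_mulmx.
apply: (@cont_ext (fun u => grad_X M S P alpha beta u i ord0 +
  (-1) * (form M u (grad_X M S P alpha beta u) * (form M (G *m u) u)^-1 *
    (G *m u) i ord0))) => [u|].
  by rewrite /rg /riem_grad_X !mxE mulN1r.
apply: contD => //; apply: contM => //; apply: contM => //; apply: contM.
  exact: cont_form.
have hD : cont (fun u => form M (G *m u) u) by exact: cont_form.
have hn : form M (G *m v) v != 0 by rewrite gt_eqF // form_G_gt0.
exact: (cvgV hn hD).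
Qed.

End Continuity.

End PosDef.

(** * Descent along the iteration and criticality of limit points *)

Section Limit.
Variables (R : realType) (N : nat) (w p : 'I_N -> R) (S : 'M[R]_N).
Variables (alpha beta Vmax Cs E0 : R).
Hypotheses (alpha0 : 0 < alpha) (beta0 : 0 < beta) (Vmax0 : 0 < Vmax) (Cs0 : 0 <= Cs).
Hypothesis E00 : 0 <= E0.
Hypothesis w0 : forall i, 0 < w i.
Hypothesis p0 : forall i, 0 <= p i.
Hypothesis pV : forall i, p i <= Vmax.
Hypothesis Ssym : S^T = S.
Hypothesis S0 : forall u : 'cV[R]_N, 0 <= form S u u.
Hypothesis sobolev : forall u : 'cV[R]_N,
  \sum_i w i * u i ord0 ^+ 4 <= Cs * form S u u ^+ 2.

Let M := diag_mx (\row_i w i).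
Let P := diag_mx (\row_i p i).
Let X := S + alpha *: M.
Let rg u := riem_grad_X M S P alpha beta u.
Let E := energy w p S beta.

Variables (tau : nat -> R) (tau_min tau_max : R) (u : nat -> 'cV[R]_N).
Hypothesis tmin0 : 0 < tau_min.
Hypothesis tauP : forall n, tau_min <= tau n <= tau_max.
Hypothesis tmax : tau_max <= Num.min 1 (step_bound alpha beta Vmax Cs E0).
Hypothesis u0M : form M (u 0%N) (u 0%N) = 1.
Hypothesis u0E : E (u 0%N) <= E0.
Hypothesis uS : forall n, u n.+1 = retraction M (u n - tau n *: rg (u n)).


(** The bound [E0] propagates by induction, so the step bound computed from the initial energy stays
    valid at every step. *)
Lemma iterates_descend n : [/\ form M (u n) (u n) = 1, E (u n) <= E0 &
  E (u n.+1) <= E (u n) - tau_min / 2 * form X (rg (u n)) (rg (u n))].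
Proof.
have step k : form M (u k) (u k) = 1 -> E (u k) <= E0 ->
    form M (u k.+1) (u k.+1) = 1 /\
    E (u k.+1) <= E (u k) - tau_min / 2 * form X (rg (u k)) (rg (u k)).
  move=> hM hE; have /andP[t1 t2] := tauP k.
  have := le_trans t2 tmax; rewrite le_min => /andP[t3 t4].
  have t0 := lt_le_trans tmin0 t1.
  have [] := retraction_step alpha0 beta0 Vmax0 Cs0 w0 p0 pV Ssym S0 sobolev E00
    t0 t3 t4 hE hM (riem_grad_tangent alpha0 w0 S0 p beta hM)
    (riem_grad_norm alpha0 w0 Ssym S0 p beta hM).
  rewrite -uS => h1 h2; split => //; apply: le_trans h2 _.
  rewrite lerD2l lerN2; apply: ler_wpM2r.
    exact: form_X_ge0.
  by rewrite ler_pM2r ?invr_gt0.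
have X0 v : 0 <= form X v v by exact: form_X_ge0.
have inv k : form M (u k) (u k) = 1 /\ E (u k) <= E0.
  elim: k => [//|k [hM hE]]; have [h1 h2] := step k hM hE; split => //.
  apply: le_trans h2 _; apply: le_trans hE.
  by rewrite gerBl mulr_ge0 // divr_ge0 // ltW.
have [hM hE] := inv n; have [h1 h2] := step n hM hE.
by split.
Qed.

Lemma limit_points_critical v : cluster (u @ \oo) v -> form M v v = 1 /\ rg v = 0.
Proof.
move=> clv.
have X0 y : 0 <= form X y y by exact: form_X_ge0.
have v1 : form M v v = 1.
  apply: contrapT => v1; have e0 : 0 < `|form M v v - 1|.
    by rewrite normr_gt0 subr_eq0; apply/eqP.
  have /(_ (ball (form M v v) `|form M v v - 1|)) := continuous_mass (w := w) (v := v).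
  move=> /(_ (nbhsx_ballx _ _ e0)) nb.
  have FA : \forall n \near \oo, form M (u n) (u n) = 1.
    by apply: nearW => n; have [] := iterates_descend n.
  have [y [/= y1 yb]] := clv [set y | form M y y = 1] _ FA nb.
  by move: yb; rewrite /= y1 /ball /= ltxx.
split=> //; apply/colP => i; rewrite [RHS]mxE; apply: contrapT => gi.
have g0 : 0 < `|rg v i ord0| / 2 by rewrite divr_gt0 // normr_gt0; apply/eqP.
have nb := @continuous_riem_grad R N w S alpha alpha0 w0 S0 p beta v i v1 _
  (nbhsx_ballx _ _ g0).
(* The energies decrease and are bounded below by 0, so they converge and their successive
   differences tend to 0. *)
have Ecv : (fun n => E (u n) - E (u n.+1)) @ \oo --> (0 : R).
  have ni : nonincreasing_seq (fun n => E (u n)).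
    apply/nonincreasing_seqP => n; have [_ _ h] := iterates_descend n.
    by apply: le_trans h _; rewrite gerBl mulr_ge0 // divr_ge0 // ltW.
  have lb : has_lbound (range (fun n => E (u n))).
    by exists 0 => _ [n _ <-]; exact: energy_ge0.
  have cv := nonincreasing_is_cvgn ni lb.
  rewrite -[X in _ --> X](subrr (limn (fun n => E (u n)))).
  by apply: cvgB => //; rewrite (cvg_shiftS (fun n => E (u n))).
(* The energy drop forced at an iterate whose gradient has i-th coordinate at least half that of
   [rg v] in absolute value. *)
pose c := tau_min / 2 * (alpha * (w i * (`|rg v i ord0| / 2) ^+ 2)).
have c0 : 0 < c.
  apply: mulr_gt0; first exact: divr_gt0.
  by apply: mulr_gt0 => //; apply: mulr_gt0 => //; exact: exprn_gt0.
have small : \forall n \near \oo, E (u n) - E (u n.+1) < c.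
  by apply: (cvgr_lt _ Ecv).
(* Clustering speaks of sets of vectors, so the index that witnesses the small drop is carried by an
   existential. *)
have FA : \forall n \near \oo, exists k, u n = u k /\ E (u k) - E (u k.+1) < c.
  by apply: filterS small => n hn; exists n.
have [y [[n [yE hn]] yb]] :=
  clv [set y | exists n, y = u n /\ E (u n) - E (u n.+1) < c] _ FA nb.
rewrite yE in yb.
have [_ _ h] := iterates_descend n.
have hg := mass_coord_le_X alpha0 w0 S0 (rg (u n)) i.
have hgi : (`|rg v i ord0| / 2) ^+ 2 <= rg (u n) i ord0 ^+ 2.
  rewrite -[leRHS]real_normK ?num_real //.
  apply: lerXn2r; rewrite ?nnegrE ?(ltW g0) //.
  move: yb; rewrite /ball /= => yb.
  have := ler_normB (rg v i ord0 - rg (u n) i ord0) (- rg (u n) i ord0).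
  by rewrite opprK subrK normrN; lra.
have : c <= tau_min / 2 * form X (rg (u n)) (rg (u n)).
  apply: ler_wpM2l; first by rewrite divr_ge0 // ltW.
  apply: le_trans hg; apply: ler_wpM2l; first exact: ltW.
  by apply: ler_wpM2l => //; exact: ltW.
by move: hn h; lra.
Qed.

End Limit.

Theorem corollary5p3 (R : realType) (d k : nat)
    (L alpha beta Vmin Vmax : R) (m : method R d k)
    (hd : (1 <= d <= 3)%N) (hk : (1 <= k)%N) (hL : 0 < L)
    (halpha : 0 < alpha) (hbeta : 0 < beta)
    (hVmin : 0 < Vmin) (hVmax : 0 < Vmax) :
  forall r : R,
  exists2 Ctau : R, 0 < Ctau &
  forall (T : mesh R d) (N : nat) (x : 'I_N -> 'rV[R]_d)
      (phi : 'I_N -> 'rV[R]_d -> R) (V : 'rV[R]_d -> R),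
    is_mesh L m T ->
    nodal_basis L (element m) T x phi ->
    (forall y, Omega d L y -> Vmin <= V y <= Vmax) ->
    let M := mass_mx (element m) T x in
    let Sh := stiffness_mx (element m) T phi in
    let P := potential_mx x V in
    forall u0 : 'cV[R]_N,
      manifold M u0 -> norm_X M Sh alpha u0 = r ->
    forall (tau : nat -> R) (tau_min tau_max : R),
      0 < tau_min ->
      (forall n, tau_min <= tau n <= tau_max) ->
      tau_max <= Num.min 1 Ctau ->
    forall u : nat -> 'cV[R]_N,
      u 0%N = u0 ->
      (forall n, u n.+1 =
         retraction M (u n - tau n *: riem_grad_X M Sh P alpha beta (u n))) ->
    forall v : 'cV[R]_N, cluster (u @ \oo) v ->
      manifold M v /\ riem_grad_X M Sh P alpha beta v = 0.
Proof.
move=> r; have [wref0 [Cs Cs0 HC]] := method_sobolev m hd hk hL.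
(* The initial norm r enters through the energy bound alone, and [Cs] was obtained before any mesh
   is given. *)
exists (step_bound alpha beta Vmax Cs (energy_bound alpha beta Vmax Cs r)).
  by apply: step_bound_gt0 => //; exact: energy_bound_ge0.
move=> T N x phi V Tmesh NB VP M Sh P u0 u0M u0r tau tau_min tau_max tmin0 tauP
  tmax u uu0 uS v clv.
have [Tunit nodeK subO sob] := HC T Tmesh.
have xO := node_Omega NB.
have Vpos i : 0 <= V (x i) by have /andP[h _] := VP _ (xO i); exact: le_trans (ltW hVmin) h.
have Vle i : V (x i) <= Vmax by have /andP[] := VP _ (xO i).
have Sob w := discrete_sobolev_mesh NB wref0 Tunit w hL nodeK subO sob.
pose w := nodal_weight m T x.
have w0 i : 0 < w i by exact: (mass_gt0 NB wref0 Tunit).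
have S0 (y : 'cV[R]_N) : 0 <= form Sh y y by exact: (stiffness_ge0 phi wref0 Tunit y).
have E00 := energy_bound_ge0 halpha hbeta hVmax Cs0 r.
have u0E : energy w (fun i => V (x i)) Sh beta (u 0%N) <=
    energy_bound alpha beta Vmax Cs r.
  by rewrite uu0 -u0r; apply: energy_le.
have u0M' : form M (u 0%N) (u 0%N) = 1 by rewrite uu0; exact: u0M.
exact: (@limit_points_critical R N w (fun i => V (x i)) Sh alpha beta Vmax Cs
  (energy_bound alpha beta Vmax Cs r) halpha hbeta hVmax Cs0 E00 w0 Vpos Vle
  (stiffness_sym m T phi) S0 Sob tau tau_min tau_max u tmin0 tauP tmax u0M' u0E uS v clv).
Qed.
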